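(* Let $d\in\{2,3\}$, and let $D$ and $\Omega$ be nonempty open, bounded sets in $\mathbb{R}^d$ such that $D\subset\Omega$ and $\partial D$, $\partial\Omega$ are smooth. Let $\mu,\lambda_1,\lambda_2\in\mathbb{R}$ satisfy $\mu>0$, $d\lambda_j+2\mu>0$ for $j=1,2$, and $\lambda_1\neq\lambda_2$. Suppose $\mathbb{R}^d$ is filled with a linearly elastic material with local elasticity tensor $\mathbb{C}(\mathbf{x})=\lambda(\mathbf{x})\,\mathbf{I}\otimes\mathbf{I}+2\mu\,\mathbb{I}$, where $\lambda(\mathbf{x})=\lambda_1$ for $\mathbf{x}\in D$ and $\lambda(\mathbf{x})=\lambda_2$ for $\mathbf{x}\in\mathbb{R}^d\setminus\overline{D}$. Let $g:\mathbb{R}^d\to\mathbb{R}$ be three times continuously differentiable and let $\mathbf{f}=\nabla g$ satisfy $\mathcal{L}_2\mathbf{f}=-(\lambda_2+\mu)\nabla(\nabla\cdot\mathbf{f})-\mu\Delta\mathbf{f}=0$ in $\mathbb{R}^d$ with $\Delta g\not\equiv 0$; equivalently, $\Delta g=C_g$ in $\mathbb{R}^d$ for a constant $C_g\neq 0$. Let $\mathbf{u}$ be the solution of the transmission problem $$\begin{cases}\mathcal{L}_1\mathbf{u}=0 & \text{in } D,\\ \mathcal{L}_2\mathbf{u}=0 & \text{in } \mathbb{R}^d\setminus\overline{D},\\ \mathbf{u}\ \text{and}\ (\mathcal{S}\mathbf{u})\cdot\mathbf{n}_D & \text{continuous across } \partial D,\\ \mathbf{u}-\mathbf{f}=\mathcal{O}(|\mathbf{x}|^{1-d})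 & \text{as } |\mathbf{x}|\to\infty,\end{cases}$$ and assume that $\mathbf{u}=\nabla\phi$ for some continuously differentiable $\phi:\mathbb{R}^d\to\mathbb{R}$. Then the volume fraction of $D$ in $\Omega$ is determined by the values of $\mathbf{u}\cdot\mathbf{n}_\Omega$ on $\partial\Omega$ through $$\frac{|D|}{|\Omega|}=\frac{1}{C_1-C_2}\left(\frac{1}{|\Omega|}\int_{\partial\Omega}\mathbf{u}\cdot\mathbf{n}_\Omega\,\mathrm{d}S-C_2\right),\qquad C_1=\left(\frac{\lambda_2+2\mu}{\lambda_1+2\mu}\right)C_g,\quad C_2=C_g.$$
   Context: $|U|$ is the Lebesgue measure of $U\subset\mathbb{R}^d$; $\mathbf{n}_D$ and $\mathbf{n}_\Omega$ are the outward unit normals to $\partial D$ and $\partial\Omega$. $\mathbf{I}$ is the second-order identity tensor and $\mathbb{I}$ is the fourth-order identity tensor acting on symmetric matrices. For $j=1,2$ the Lamé operator is $\mathcal{L}_j\mathbf{u}=-(\lambda_j+\mu)\nabla(\nabla\cdot\mathbf{u})-\mu\Delta\mathbf{u}$. The stress operator is $\mathcal{S}\mathbf{u}(\mathbf{x})=\lambda(\mathbf{x})[\nabla\cdot\mathbf{u}(\mathbf{x})]\mathbf{I}+\mu[\nabla\mathbf{u}(\mathbf{x})+\nabla\mathbf{u}(\mathbf{x})^T]$, and $(\mathcal{S}\mathbf{u})\cdot\mathbf{n}_D$ is the traction. The solution $\mathbf{u}:\mathbb{R}^d\to\mathbb{R}^d$ of the transmission problem is understood to be smooth in $D$ and in $\mathbb{R}^d\setminus\overline{D}$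 and continuous on $\mathbb{R}^d$; continuity of the traction across $\partial D$ means that the limits of $(\mathcal{S}\mathbf{u})\cdot\mathbf{n}_D$ on $\partial D$ from inside and from outside $D$ exist and agree (using $\lambda_1$ inside and $\lambda_2$ outside). It is known that this problem has a unique solution. *)

(* Defs.v *)
From HB Require Import structures.
From mathcomp Require Import all_boot all_order all_algebra.
From mathcomp Require Import all_classical all_reals all_analysis.
Import Order.TTheory GRing.Theory Num.Theory.
Import numFieldNormedType.Exports.
Set Implicit Arguments.
Unset Strict Implicit.
Unset Printing Implicit Defensive.
Local Open Scope classical_set_scope.
Local Open Scope ring_scope.

Section lebesgue_tuple.
Variable R : realType.
Local Notation mR := (measurableTypeR R).

Definition tuple_cons n (p : mR * n.-tuple mR) : n.+1.-tuple mR :=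
  [tuple of p.1 :: p.2].

Definition tuple_uncons n (t : n.+1.-tuple mR) : mR * n.-tuple mR :=
  (tnth t ord0, [tuple of behead t]).

Lemma tuple_consK n : cancel (@tuple_cons n) (@tuple_uncons n).
Proof. by case=> x t; congr pair; exact: val_inj. Qed.

Lemma measurable_tuple_cons n :
  measurable_fun [set: mR * n.-tuple mR] (@tuple_cons n).
Proof. exact: measurable_cons. Qed.

Lemma measurable_tuple_uncons n :
  measurable_fun [set: n.+1.-tuple mR] (@tuple_uncons n).
Proof.
by apply: measurable_fun_pair; [exact: measurable_tnth|exact: measurable_behead].
Qed.

Section lebesgue_step.
Variables (n : nat) (m : {sigma_finite_measure set (n.-tuple mR) -> \bar R}).

Definition lebesgue_step : set (n.+1.-tuple mR) -> \bar R :=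
  pushforward (lebesgue_measure \x m)%E (@tuple_cons n).

Let lebesgue_step0 : lebesgue_step set0 = 0%E.
Proof. by rewrite /lebesgue_step /pushforward preimage_set0 measure0. Qed.

Let lebesgue_step_ge0 A : (0 <= lebesgue_step A)%E.
Proof. exact: (measure_ge0 (lebesgue_measure \x m)%E). Qed.

Let lebesgue_step_sigma_additive : semi_sigma_additive lebesgue_step.
Proof.
have mf := @measurable_tuple_cons n.
move=> F mF tF mUF; rewrite /lebesgue_step /pushforward preimage_bigcup.
apply: measure_semi_sigma_additive.
- by move=> k; rewrite -[X in measurable X]setTI; exact: mf.
- apply/trivIsetP => /= i j _ _ ij; rewrite -preimage_setI.
  by move/trivIsetP : tF => /(_ _ _ _ _ ij) ->//; rewrite preimage_set0.
- by rewrite -preimage_bigcup -[X in measurable X]setTI; exact: mf.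
Qed.

HB.instance Definition _ := isMeasure.Build _ _ _ lebesgue_step
  lebesgue_step0 lebesgue_step_ge0 lebesgue_step_sigma_additive.

Let lebesgue_step_sigma_finite : sigma_finite setT lebesgue_step.
Proof.
have /sigma_finiteP[F [TF ndF Foo]] :=
  sigma_finiteT (@lebesgue_measure R : sigma_finite_measure _ _).
have /sigma_finiteP[G [TG ndG Goo]] := sigma_finiteT m.
exists (fun k => @tuple_uncons n @^-1` (F k `*` G k)).
  rewrite -preimage_bigcup; apply/esym; rewrite -subTset => t _ /=.
  have : setT (tuple_uncons t).1 by [].
  have : setT (tuple_uncons t).2 by [].
  rewrite {1}TF {1}TG => -[j _ Gj] [i _ Fi]; exists (maxn i j) => //; split.
    by move: Fi; exact/subsetPset/ndF/leq_maxl.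
  by move: Gj; exact/subsetPset/ndG/leq_maxr.
move=> k; have [mF Fk] := Foo k; have [mG Gk] := Goo k; split.
  rewrite -[X in measurable X]setTI.
  by apply: measurable_tuple_uncons => //; exact: measurableX.
rewrite /lebesgue_step /pushforward -comp_preimage.
rewrite (_ : _ \o _ = id); last by apply/funext => p; exact: tuple_consK.
by rewrite preimage_id product_measure1E// lte_mul_pinfty// ge0_fin_numE.
Qed.

HB.instance Definition _ := Measure_isSigmaFinite.Build _ _ _ lebesgue_step
  lebesgue_step_sigma_finite.

End lebesgue_step.

Fixpoint lebesgue_tuple n : {sigma_finite_measure set (n.-tuple mR) -> \bar R} :=
  if n is n'.+1 then lebesgue_step (lebesgue_tuple n') else dirac [tuple].

End lebesgue_tuple.

Section euclidean_space.
Variables (R : realType) (d : nat).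
Local Notation V := 'rV[R]_d.

Definition dotv (v w : V) : R := \sum_(i < d) v 0 i * w 0 i.

(* The library norm of 'rV is the sup norm; it induces the same topology and
   the same bounded sets, but growth rates are stated with this one. *)
Definition enorm (v : V) : R := Num.sqrt (dotv v v).

Definition row_of_tuple (t : d.-tuple (measurableTypeR R)) : V :=
  \row_i tnth t i.

(* The product measure [lebesgue_tuple] carried to row vectors. *)
Definition volume (U : set V) : \bar R :=
  lebesgue_tuple R d (row_of_tuple @^-1` U).

Definition boundary (U : set V) : set V := closure U `\` interior U.

Definition partial (i : 'I_d) (f : V -> R) : V -> R := 'D_(delta_mx 0 i) f.

(* Meant for open A. *)
Fixpoint Ck (k : nat) (A : set V) (f : V -> R) : Prop :=
  if k is k'.+1 then
    (forall x, A x -> differentiable f x) /\ (forall i, Ck k' A (partial i f))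
  else forall x, A x -> {for x, continuous f}.

Definition smooth (A : set V) (f : V -> R) : Prop := forall k, Ck k A f.

Definition component (u : V -> V) (j : 'I_d) : V -> R := fun x => u x 0 j.

Definition gradient (f : V -> R) (x : V) : V := \row_i partial i f x.

Definition laplacian (f : V -> R) (x : V) : R :=
  \sum_(i < d) partial i (partial i f) x.

Definition divergence (u : V -> V) (x : V) : R :=
  \sum_(i < d) partial i (component u i) x.

Definition vlaplacian (u : V -> V) (x : V) : V :=
  \row_j laplacian (component u j) x.

Definition vgradient (u : V -> V) (x : V) : 'M[R]_d :=
  \matrix_(i, j) partial j (component u i) x.

End euclidean_space.

Section boundaries.
Variables (R : realType) (d : nat).
Local Notation V := 'rV[R]_d.
Local Notation W := 'rV[R]_d.-1.

(* The coordinates of z other than z_i form the row vector [col' i z]; for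
   s = false this is { z_i < gamma(z') } and for s = true { z_i > gamma(z') }. *)
Definition subgraph (i : 'I_d) (s : bool) (gamma : W -> R) : set V :=
  [set z : V | (-1) ^+ s * z 0 i < (-1) ^+ s * gamma (col' i z)].

Definition smooth_boundary (U : set V) : Prop :=
  forall x, boundary U x -> exists i s gamma,
    smooth setT gamma /\ \forall z \near x, U z <-> subgraph i s gamma z.

(* The velocities at x of the curves drawn on S. *)
Definition tangent_vector (S : set V) (x w : V) : Prop :=
  exists c : R -> V, [/\ c 0 = x, \forall t \near (0 : R), S (c t),
    derivable c 0 1 & 'D_1 c 0 = w].

Definition is_outward_normal (U : set V) (x v : V) : Prop :=
  [/\ enorm v = 1,
      forall w, tangent_vector (boundary U) x w -> dotv v w = 0,
      \forall t \near (0 : R)^'+, U (x - t *: v) &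
      \forall t \near (0 : R)^'+, (~` closure U) (x + t *: v)].

Definition outward_normal (U : set V) (x : V) : V :=
  get (is_outward_normal U x).

Definition graph_point (i : 'I_d) (gamma : W -> R) (y : W) : V :=
  \row_j if unlift i j is Some k then y 0 k else gamma y.

(* The integral of h over the graph of gamma for the surface element
   sqrt (1 + |grad gamma|^2) dy. *)
Definition graph_integral (i : 'I_d) (gamma : W -> R) (h : V -> R) : R :=
  \int[lebesgue_tuple R d.-1]_t
    (let y := row_of_tuple t in
     h (graph_point i gamma y) *
     Num.sqrt (1 + enorm (gradient gamma y) ^+ 2)).

(* Graph charts (i k, s k, gamma k) of the boundary of U, with a partition of
   unity on that boundary such that chi k is supported in the k-th chart. *)
Definition boundary_atlas (U : set V) (N : nat) (i : 'I_N -> 'I_d)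
    (s : 'I_N -> bool) (gamma : 'I_N -> W -> R) (chi : 'I_N -> V -> R) : Prop :=
  [/\ forall k, smooth setT (gamma k),
      forall k, [/\ Ck 1 setT (chi k), forall x, 0 <= chi k x &
        bounded_set [set x | chi k x != 0]],
      forall k x, closure [set x | chi k x != 0] x ->
        \forall z \near x, U z <-> subgraph (i k) (s k) (gamma k) z &
      forall x, boundary U x -> \sum_(k < N) chi k x = 1].

Definition is_boundary_integral (U : set V) (h : V -> R) (I : R) : Prop :=
  exists N i s gamma chi, @boundary_atlas U N i s gamma chi /\
    I = \sum_(k < N) graph_integral (i k) (gamma k) (fun x => chi k x * h x).

(* For continuous h the value does not depend on the atlas. *)
Definition boundary_integral (U : set V) (h : V -> R) : R :=
  get (is_boundary_integral U h).

End boundaries.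

Section elasticity.
Variables (R : realType) (d : nat).
Local Notation V := 'rV[R]_d.

Definition lame_operator (lambda mu : R) (u : V -> V) (x : V) : V :=
  - (lambda + mu) *: gradient (divergence u) x - mu *: vlaplacian u x.

(* The value on the boundary of D plays no role. *)
Definition lame_modulus (D : set V) (lambda1 lambda2 : R) (x : V) : R :=
  if x \in D then lambda1 else lambda2.

Definition stress (lambda : V -> R) (mu : R) (u : V -> V) (x : V) : 'M[R]_d :=
  (lambda x * divergence u x)%:M + mu *: (vgradient u x + (vgradient u x)^T).

Definition traction (lambda : V -> R) (mu : R) (u : V -> V) (n x : V) : V :=
  (stress lambda mu u x *m n^T)^T.

Definition continuous_traction (D : set V) (lambda : V -> R) (mu : R)
    (u : V -> V) : Prop :=
  forall x, boundary D x -> exists t : V,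
    (traction lambda mu u (outward_normal D x) @ within D (nbhs x) --> t) /\
    (traction lambda mu u (outward_normal D x)
       @ within (~` closure D) (nbhs x) --> t).

Record transmission_solution (D : set V) (mu lambda1 lambda2 : R)
    (f u : V -> V) : Prop := {
  sol_smooth_in : forall j, smooth D (component u j) ;
  sol_smooth_out : forall j, smooth (~` closure D) (component u j) ;
  sol_lame_in : forall x, D x -> lame_operator lambda1 mu u x = 0 ;
  sol_lame_out :
    forall x, (~` closure D) x -> lame_operator lambda2 mu u x = 0 ;
  sol_continuous : continuous u ;
  sol_traction :
    continuous_traction D (lame_modulus D lambda1 lambda2) mu u ;
  sol_decay : exists C r : R, forall x, r <= enorm x ->
    enorm (u x - f x) <= C * enorm x ^ (1 - d%:Z) }.

End elasticity.

(* Main.v *)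
Require Import Defs.
From HB Require Import structures.
From mathcomp Require Import all_boot all_order all_algebra.
From mathcomp Require Import all_classical all_reals all_analysis.
From mathcomp Require Import measurable_realfun.
From mathcomp Require Import ring lra zify.
Import Order.TTheory GRing.Theory Num.Theory.
Import numFieldNormedType.Exports.
Set Implicit Arguments.
Unset Strict Implicit.
Unset Printing Implicit Defensive.
Local Open Scope classical_set_scope.
Local Open Scope ring_scope.

(** Since [u] is a gradient, the Lame equations reduce to the vanishing of the gradient
    of [div u] on either side of the interface ([lame_potential_div]), so [div u] is
    locally constant in [D] and in the exterior of [D]. The main point is that
    [(lambda1 + 2 mu) div u] inside and [(lambda2 + 2 mu) div u] outside are one and the
    same constant, whatever the number of components of the two sets; the behaviour at
    infinity identifies it as [(lambda2 + 2 mu) Cg] ([transmission_divergence]). Hence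
    [div u] is [C1] in [D] and [C2] outside, the flux of [u] through the boundary of
    [Omega] is [C1 |D| + C2 (|Omega| - |D|)], and solving for [|D|] gives the formula
    ([volume_fraction]).

    The two constants are matched at each point [x] of the boundary of [D], where only
    the limits of the traction are known. Let [n] be the normal at [x], let [a] and [b]
    be the values of [div u] inside and outside, and let [f = u . n]. The gradient of [u]
    is symmetric, so the traction is [lambda (div u) n + 2 mu grad f]
    ([traction_symmetric]); therefore [grad f] has limits at [x] from both sides, and
    they differ by [c n] with [2 mu c = lambda2 b - lambda1 a]. This determines [f] to
    first order near [x], from both sides. As [f] is the derivative of the potential
    [phi] along [n], the difference [phi (z + h n) - phi z], for [z] inside and [z + h n]
    outside at distances comparable to [h], is a quadratic polynomial of [z] up to
    [o(h ^ 2)]. After subtraction of this polynomial the Laplacian is the constant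
    [b - a + c], and by the maximum principle ([laplacian_bound]) a function of size
    [o(h ^ 2)] on a ball of radius comparable to [h] cannot have a nonzero constant
    Laplacian. So [b - a + c = 0] ([blow_up]), which is
    [(lambda1 + 2 mu) a = (lambda2 + 2 mu) b] ([divergence_jump]). At infinity the same
    principle is applied on large balls to [phi - g], whose gradient is bounded
    ([laplacian_far]).

    For the flux formula, [u] is continuous but not differentiable across the boundary of
    [D], which may moreover touch that of [Omega]. First the weak divergence of [u] on the
    whole space is identified: the fluxes through the two sides of the boundary of [D]
    cancel ([weak_divergence]). Then test functions cut off near the boundary of [Omega]
    turn this weak identity into the divergence theorem ([boundary_integral_flux]). Both
    steps come down to [boundary_layer]: the gradient of a cutoff of width [1/k] along a
    graph concentrates on the graph, and in the limit it produces the flux through it. *)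

(** * Row vectors and calculus at a point *)

Section RowVectors.
Context {R : realType} {n : nat}.
Implicit Types (u v w x y z : 'rV[R]_n) (i j : 'I_n).

Lemma coord_le_norm v i : `|v 0 i| <= `|v|.
Proof.
rewrite [leRHS]/Num.Def.normr /= mx_normrE.
exact: (le_bigmax _ (fun k : 'I_1 * 'I_n => `|v k.1 k.2|) (0, i)).
Qed.

Lemma norm_leP v (c : R) : 0 <= c -> reflect (forall i, `|v 0 i| <= c) (`|v| <= c).
Proof.
move=> c0; apply: (iffP idP) => [vc i|vc].
  exact: le_trans (coord_le_norm v i) vc.
rewrite /Num.Def.normr /= mx_normrE; apply: bigmax_le => //= -[a b] _ /=.
by rewrite (ord1 a).
Qed.

Lemma norm_ltP v (c : R) : 0 < c -> reflect (forall i, `|v 0 i| < c) (`|v| < c).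
Proof.
move=> c0; apply: (iffP idP) => [vc i|vc].
  exact: le_lt_trans (coord_le_norm v i) vc.
rewrite /Num.Def.normr /= mx_normrE; apply: bigmax_lt => //= -[a b] _ /=.
by rewrite (ord1 a).
Qed.

Lemma dotvC u v : dotv u v = dotv v u.
Proof. by apply: eq_bigr => i _; rewrite mulrC. Qed.

Lemma dotvDl u v w : dotv (u + v) w = dotv u w + dotv v w.
Proof. by rewrite -big_split /=; apply: eq_bigr => i _; rewrite mxE mulrDl. Qed.

Lemma dotvDr u v w : dotv w (u + v) = dotv w u + dotv w v.
Proof. by rewrite !(dotvC w) dotvDl. Qed.

Lemma dotvZl (a : R) u v : dotv (a *: u) v = a * dotv u v.
Proof. by rewrite mulr_sumr; apply: eq_bigr => i _; rewrite mxE mulrA. Qed.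

Lemma dotvZr (a : R) u v : dotv u (a *: v) = a * dotv u v.
Proof. by rewrite !(dotvC u) dotvZl. Qed.

Lemma dotvNl u v : dotv (- u) v = - dotv u v.
Proof. by rewrite -scaleN1r dotvZl mulN1r. Qed.

Lemma dotvNr u v : dotv u (- v) = - dotv u v.
Proof. by rewrite !(dotvC u) dotvNl. Qed.

Lemma dotvBl u v w : dotv (u - v) w = dotv u w - dotv v w.
Proof. by rewrite dotvDl dotvNl. Qed.

Lemma dotvBr u v w : dotv w (u - v) = dotv w u - dotv w v.
Proof. by rewrite dotvDr dotvNr. Qed.

Lemma dotv0l v : dotv 0 v = 0.
Proof. by rewrite -(scale0r 0) dotvZl mul0r. Qed.

Lemma dotv0r v : dotv v 0 = 0.
Proof. by rewrite dotvC dotv0l. Qed.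

Lemma dotv_delta v i : dotv v (delta_mx 0 i) = v 0 i.
Proof.
rewrite /dotv (bigD1 i)//= mxE !eqxx mulr1 big1 ?addr0// => j ji.
by rewrite mxE eqxx/= (negbTE ji) mulr0.
Qed.

Lemma dotvv_ge0 v : 0 <= dotv v v.
Proof. by apply: sumr_ge0 => i _; rewrite -expr2 sqr_ge0. Qed.

Lemma normr_dotv u v : `|dotv u v| <= n%:R * (`|u| * `|v|).
Proof.
apply: le_trans (ler_norm_sum _ _ _) _.
rewrite mulr_natl -[X in _ *+ X](card_ord n) -sumr_const; apply: ler_sum => i _.
by rewrite normrM ler_pM// coord_le_norm.
Qed.

Lemma sqr_norm_le_dotvv v : `|v| ^+ 2 <= dotv v v.
Proof.
have h : `|v| <= enorm v.
  apply/norm_leP; first exact: sqrtr_ge0.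
  move=> i; rewrite -sqrtr_sqr ler_sqrt ?dotvv_ge0//.
  rewrite /dotv (bigD1 i)//= expr2 lerDl; apply: sumr_ge0 => j _.
  by rewrite -expr2 sqr_ge0.
by rewrite -[leRHS]sqr_sqrtr ?dotvv_ge0// ler_sqr// nnegrE// sqrtr_ge0.
Qed.

Lemma dotvv_le_sqr_norm v : dotv v v <= n%:R * `|v| ^+ 2.
Proof.
by apply: le_trans (ler_norm _) _; rewrite expr2; exact: normr_dotv.
Qed.

Lemma norm_le_enorm v : `|v| <= enorm v.
Proof.
rewrite -(ler_sqr (normr_ge0 v) (sqrtr_ge0 _)) sqr_sqrtr ?dotvv_ge0//.
exact: sqr_norm_le_dotvv.
Qed.

Lemma enormK v : enorm v ^+ 2 = dotv v v.
Proof. by rewrite sqr_sqrtr// dotvv_ge0. Qed.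

Lemma norm_delta_le i : `|delta_mx 0 i : 'rV[R]_n| <= 1.
Proof.
by apply/norm_leP => // j; rewrite mxE eqxx/=; case: eqP => _; rewrite ?normr1 ?normr0.
Qed.

Lemma near_normP (P : 'rV[R]_n -> Prop) x :
  (\forall z \near x, P z) <-> exists2 r : R, 0 < r & forall z, `|z - x| < r -> P z.
Proof.
split=> [/nbhs_normP[r /= r0 H]|[r r0 H]].
  by exists r => // z zx; apply: H; rewrite /ball_ /= distrC.
by apply/nbhs_normP; exists r => // z; rewrite /ball_ /= distrC; exact: H.
Qed.

Lemma cont_normP (f : 'rV[R]_n -> R) x : {for x, continuous f} ->
  forall e : R, 0 < e -> exists2 r : R, 0 < r & forall z, `|z - x| < r -> `|f z - f x| < e.
Proof.
move=> /cvgrPdist_lt cf e e0.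
have /near_normP[r r0 H] : \forall z \near x, `|f x - f z| < e by exact: cf.
by exists r => // z /H; rewrite distrC.
Qed.

Lemma norm_contP (f : 'rV[R]_n -> R) x :
  (forall e : R, 0 < e -> exists2 r : R, 0 < r & forall z, `|z - x| < r -> `|f z - f x| < e) ->
  {for x, continuous f}.
Proof.
move=> H; rewrite /prop_for /continuous_at.
apply/(@cvgrPdist_lt _ _ _ (nbhs x)) => e e0; have [r r0 fr] := H e e0.
suff : \forall z \near x, `|f x - f z| < e by [].
by apply/near_normP; exists r => // z /fr; rewrite distrC.
Qed.

End RowVectors.

Section Calculus.
Context {R : realType} {n : nat}.
Implicit Types (u v w x y z : 'rV[R]_n) (i j : 'I_n) (f g : 'rV[R]_n -> R).

Lemma derive_gradient f x v : differentiable f x ->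
  'D_v f x = dotv v (gradient f x).
Proof.
move=> df; rewrite deriveE// {1}(row_sum_delta v) linear_sum; apply: eq_bigr => i _.
by rewrite linearZ/= mxE /partial deriveE.
Qed.

Lemma is_derive_curve f (p : R -> 'rV[R]_n) (t : R) v : is_derive t 1 p v ->
  differentiable f (p t) -> is_derive t 1 (f \o p) (dotv v (gradient f (p t))).
Proof.
move=> [dp pv] df.
have dp' : differentiable p t by apply/derivable1_diffP.
have dfp : differentiable (f \o p) t by exact: differentiable_comp.
apply: DeriveDef; first exact/derivable1_diffP.
by rewrite deriveE// diff_comp//= -derive_gradient// deriveE// -pv deriveE.
Qed.

Lemma is_derive_line x v (t : R) : is_derive t 1 (fun s : R => x + s *: v) v.
Proof.
have h : is_derive t 1 (fun s : R => s *: v) v.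
  have [d1 d2] := @is_diff_scalel R 'rV[R]_n t v.
  apply: DeriveDef; first exact/derivable1_diffP.
  by rewrite deriveE// d2 scale1r.
rewrite -[X in is_derive _ _ _ X]add0r.
exact: (@is_deriveD _ _ _ (cst x) (fun s : R => s *: v)).
Qed.

Lemma MVT_curve f (p dp : R -> 'rV[R]_n) (a b : R) : a < b ->
  (forall t, a < t < b -> is_derive t 1 p (dp t)) ->
  (forall t, a < t < b -> differentiable f (p t)) ->
  {within `[a, b], continuous (f \o p)} ->
  exists2 c, a < c < b &
    f (p b) - f (p a) = dotv (dp c) (gradient f (p c)) * (b - a).
Proof.
move=> ab dpP df cf.
have [t tab|c cab e] := @MVT R (f \o p)
  (fun t => dotv (dp t) (gradient f (p t))) a b ab _ cf.
  by move: tab; rewrite in_itv/= => tab; apply: is_derive_curve; [exact: dpP|exact: df].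
by exists c => //; move: cab; rewrite in_itv.
Qed.

Lemma MVT_seg f x v : (forall t : R, 0 <= t <= 1 -> differentiable f (x + t *: v)) ->
  exists2 c : R, 0 < c < 1 & f (x + v) - f x = dotv v (gradient f (x + c *: v)).
Proof.
move=> df.
have [||||c cab e] := @MVT_curve f (fun s => x + s *: v) (fun=> v) 0 1.
- exact: ltr01.
- by move=> t _; exact: is_derive_line.
- by move=> t /andP[t0 t1]; apply: df; rewrite !ltW.
- apply: continuous_in_subspaceT => t; rewrite inE/= in_itv/= => t01.
  apply: continuous_comp; last exact/differentiable_continuous/df.
  apply/differentiable_continuous/derivable1_diffP.
  by have [] := is_derive_line x v t.
exists c => //; move: e; by rewrite scale1r scale0r addr0 subr0 mulr1.
Qed.

(** Working at a point rather than on an open set makes the class of C^1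
    functions stable under gluing: only the germ at [x] matters. *)
Definition C1at f x := (\forall z \near x, differentiable f z) /\
  forall i, {for x, continuous (partial i f)}.

Lemma C1at_diff f x : C1at f x -> differentiable f x.
Proof. by case=> /nbhs_singleton. Qed.

Lemma near_eq_diff f g x : (\forall z \near x, f z = g z) -> differentiable f x -> differentiable g x.
Proof.
move=> fg df.
have e0 : \forall h \near (0 : 'rV[R]_n), f (h + x) = g (h + x).
  have : \forall z \near x, f z = g z := fg.
  rewrite (near_shift 0 x (fun z => f z = g z)).
  by apply: filterS => h /=; rewrite subr0.
have fgx : f x = g x by exact: (nbhs_singleton fg).
have gd : g \o shift x = cst (g x) + 'd f x +o_ (0 : 'rV[R]_n) id.
  apply/eqaddoP => e e0'; have /diff_locally/eqaddoP/(_ e e0') := df.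
  apply: filterS2 e0 => h gh.
  by rewrite /= -![(_ + _ : _ -> _) _]/(_ + _) -![(- _ : _ -> _) _]/(- _) /= /cst fgx gh.
have dg := diff_unique (diff_continuous df) gd.
apply/diff_locallyP; rewrite dg; split => //; exact: diff_continuous.
Qed.

Lemma partial_near f g x i : (\forall z \near x, f z = g z) -> partial i f x = partial i g x.
Proof. by move=> fg; exact: near_eq_derive. Qed.

Lemma partial_near_near f g x i : (\forall z \near x, f z = g z) -> (\forall z \near x, partial i f z = partial i g z).
Proof. by move=> /near_join; apply: filterS => z; exact: partial_near. Qed.

Lemma for_cont_near f g x : (\forall z \near x, f z = g z) ->
  {for x, continuous f} -> {for x, continuous g}.
Proof.
move=> fg cf; rewrite /prop_for /continuous_at -(nbhs_singleton fg).
by apply: cvg_trans cf; exact: near_eq_cvg fg.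
Qed.

Lemma C1at_near_eq f g x : (\forall z \near x, f z = g z) -> C1at f x -> C1at g x.
Proof.
move=> fg [df cf]; split; last first.
  by move=> i; apply: for_cont_near (cf i); exact: partial_near_near.
by move/near_join : fg => fg; apply: filterS2 fg df => z; exact: near_eq_diff.
Qed.

Lemma differentiable_mul f g x : differentiable f x -> differentiable g x ->
  differentiable (fun z => f z * g z) x.
Proof. by move=> df dg; exact: (differentiableM df dg). Qed.

Lemma differentiable_add f g x : differentiable f x -> differentiable g x ->
  differentiable (fun z => f z + g z) x.
Proof. by move=> df dg; exact: (differentiableD df dg). Qed.

Lemma partialM f g x i : differentiable f x -> differentiable g x ->
  partial i (fun z => f z * g z) x = f x * partial i g x + g x * partial i f x.
Proof.
move=> df dg.
by rewrite /partial (@deriveM _ _ f g) //; exact: diff_derivable.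
Qed.

Lemma partialD f g x i : differentiable f x -> differentiable g x ->
  partial i (fun z => f z + g z) x = partial i f x + partial i g x.
Proof.
move=> df dg.
by rewrite /partial (@deriveD _ _ _ f g) //; exact: diff_derivable.
Qed.

Lemma partial_cst (c : R) x i : partial i (fun=> c) x = 0.
Proof. exact: (@derive_cst R 'rV[R]_n R c x). Qed.

Lemma partialZ (c : R) f x i : differentiable f x ->
  partial i (fun z => c * f z) x = c * partial i f x.
Proof.
by move=> df; rewrite partialM// partial_cst mulr0 addr0.
Qed.

Lemma near_all (P : 'rV[R]_n -> Prop) x : (forall z, P z) -> \forall z \near x, P z.
Proof. by move=> PA; near=> z; exact: PA. Unshelve. all: by end_near. Qed.

Lemma near_diff_all f x : (forall z, differentiable f z) ->
  \forall z \near x, differentiable f z.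
Proof. by move=> df; near=> z; exact: df. Unshelve. all: by end_near. Qed.

Lemma C1at_cst (c : R) x : C1at (fun=> c) x.
Proof.
split; first by apply: near_diff_all => z; exact: differentiable_cst.
move=> i; have -> : partial i (fun=> c) = fun=> 0.
  by apply/funext => z; exact: partial_cst.
by move=> A; exact: (@cst_continuous _ _ (0 : R) x).
Qed.

Lemma C1at_cont f x : C1at f x -> {for x, continuous f}.
Proof. by move/C1at_diff/differentiable_continuous. Qed.

Lemma C1atM f g x : C1at f x -> C1at g x -> C1at (fun z => f z * g z) x.
Proof.
move=> Cf Cg; have [df cf] := Cf; have [dg cg] := Cg; split.
  by apply: filterS2 df dg => z; exact: differentiable_mul.
move=> i; apply: (@for_cont_near (fun z => f z * partial i g z + g z * partial i f z)).
  by apply: filterS2 df dg => z dfz dgz; rewrite partialM.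
by apply: (@cvgD _ _ _ (nbhs x)); apply: (@cvgM _ _ (nbhs x));
  [exact: C1at_cont|exact: cg|exact: C1at_cont|exact: cf].
Qed.

Lemma C1atD f g x : C1at f x -> C1at g x -> C1at (fun z => f z + g z) x.
Proof.
move=> [df cf] [dg cg]; split.
  by apply: filterS2 df dg => z; exact: differentiable_add.
move=> i; apply: (@for_cont_near (fun z => partial i f z + partial i g z)).
  by apply: filterS2 df dg => z dfz dgz; rewrite partialD.
by apply: (@cvgD _ _ _ (nbhs x)); [exact: cf|exact: cg].
Qed.

Lemma C1atZ (c : R) f x : C1at f x -> C1at (fun z => c * f z) x.
Proof. exact/C1atM/C1at_cst. Qed.

Lemma C1atN f x : C1at f x -> C1at (fun z => - f z) x.
Proof.
move=> /(C1atZ (-1)); apply: C1at_near_eq; apply: near_all => z; exact: mulN1r.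
Qed.

Lemma C1atB f g x : C1at f x -> C1at g x -> C1at (fun z => f z - g z) x.
Proof. by move=> Cf /C1atN; exact: C1atD. Qed.

Lemma C1at_sum (I : Type) (r : seq I) (F : I -> 'rV[R]_n -> R) x :
  (forall k, C1at (F k) x) -> C1at (fun z => \sum_(k <- r) F k z) x.
Proof.
move=> CF; elim: r => [|k r IH].
  by apply: (C1at_near_eq _ (C1at_cst 0 x)); apply: near_all => z; rewrite big_nil.
apply: (C1at_near_eq _ (C1atD (CF k) IH)).
by apply: near_all => z; rewrite big_cons.
Qed.

Lemma C1at_prod (I : Type) (r : seq I) (F : I -> 'rV[R]_n -> R) x :
  (forall k, C1at (F k) x) -> C1at (fun z => \prod_(k <- r) F k z) x.
Proof.
move=> CF; elim: r => [|k r IH].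
  by apply: (C1at_near_eq _ (C1at_cst 1 x)); apply: near_all => z; rewrite big_nil.
apply: (C1at_near_eq _ (C1atM (CF k) IH)).
by apply: near_all => z; rewrite big_cons.
Qed.

Lemma differentiable_sum_fun (I : Type) (r : seq I) (F : I -> 'rV[R]_n -> R) x :
  (forall k, differentiable (F k) x) ->
  differentiable (fun z => \sum_(k <- r) F k z) x.
Proof.
move=> dF; elim: r => [|k r IH].
  rewrite (_ : (fun _ => _) = fun=> 0); first exact: differentiable_cst.
  by apply/funext => z; rewrite big_nil.
rewrite (_ : (fun _ => _) = fun z => F k z + \sum_(j <- r) F j z).
  exact: differentiable_add.
by apply/funext => z; rewrite big_cons.
Qed.

Lemma partial_sum (I : Type) (r : seq I) (F : I -> 'rV[R]_n -> R) x i :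
  (forall k, differentiable (F k) x) ->
  partial i (fun z => \sum_(k <- r) F k z) x = \sum_(k <- r) partial i (F k) x.
Proof.
move=> dF; elim: r => [|k r IH].
  rewrite big_nil -[RHS](partial_cst 0 x i); congr partial.
  by apply/funext => z; rewrite big_nil.
rewrite big_cons -IH -partialD//; last exact: differentiable_sum_fun.
by congr partial; apply/funext => z; rewrite big_cons.
Qed.

Lemma differentiable_comp1 (h : R -> R) f x : derivable h (f x) 1 ->
  differentiable f x -> differentiable (fun z => h (f z)) x.
Proof.
by move=> dh df; apply: (differentiable_comp df); exact/derivable1_diffP.
Qed.

Lemma partial_comp1 (h : R -> R) (dh : R) f x i : is_derive (f x) 1 h dh ->
  differentiable f x -> partial i (fun z => h (f z)) x = dh * partial i f x.
Proof.
move=> [h1 h2] df; have dh1 : differentiable h (f x) by exact/derivable1_diffP.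
rewrite /partial deriveE; last exact: (differentiable_comp df).
rewrite (diff_comp df dh1) /= -(deriveE _ df) diff1E//.
by rewrite derive1E h2 mulrC.
Qed.

Lemma C1at_comp1 (h dh : R -> R) f x : (forall t, is_derive t (1 : R) h (dh t)) ->
  continuous dh -> C1at f x -> C1at (fun z => h (f z)) x.
Proof.
move=> hP cdh Cf; have [df cf] := Cf; split.
  by apply: filterS df => z dfz; apply: differentiable_comp1 => //; case: (hP (f z)).
move=> i; apply: (@for_cont_near (fun z => dh (f z) * partial i f z)).
  by apply: filterS df => z dfz; rewrite (partial_comp1 _ (hP (f z))).
apply: (@cvgM _ _ (nbhs x)); last exact: cf.
apply: (@cvg_comp _ _ _ f dh); last exact: cdh.
exact: C1at_cont.
Qed.

Lemma differentiable_proj i x : differentiable (fun z : 'rV[R]_n => z 0 i) x.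
Proof. exact: differentiable_coord. Qed.

Lemma derive_proj i x v : 'D_v (fun z : 'rV[R]_n => z 0 i) x = v 0 i.
Proof.
by have := derive_mx (@derivable_id _ _ x v); rewrite derive_id => {2}->; rewrite mxE.
Qed.

Lemma partial_proj i j x : partial j (fun z : 'rV[R]_n => z 0 i) x = (i == j)%:R.
Proof. by rewrite /partial derive_proj mxE eqxx. Qed.

Lemma C1at_proj i x : C1at (fun z => z 0 i) x.
Proof.
split; first by apply: near_diff_all => z; exact: differentiable_proj.
move=> j; have -> : partial j (fun z => z 0 i) = fun=> (i == j)%:R.
  by apply/funext => z; exact: partial_proj.
by move=> A; exact: (@cst_continuous _ _ ((i == j)%:R : R) x).
Qed.

Lemma differentiable_dotv w x : differentiable (fun z => dotv w z) x.
Proof.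
apply: differentiable_sum_fun => i; apply: differentiable_mul.
  exact: differentiable_cst.
exact: differentiable_proj.
Qed.

Lemma partial_dotv w x j : partial j (fun z => dotv w z) x = w 0 j.
Proof.
rewrite partial_sum => [|i]; last first.
  by apply: differentiable_mul; [exact: differentiable_cst|exact: differentiable_proj].
rewrite -[RHS]dotv_delta; apply: eq_bigr => i _.
by rewrite partialZ ?partial_proj ?mxE//; exact: differentiable_proj.
Qed.

Lemma Ck1_C1at (A : set 'rV[R]_n) f x : open A -> Ck 1 A f -> A x -> C1at f x.
Proof.
move=> oA [df cf] Ax; split; last by move=> i; exact: cf.
by apply: filterS (open_nbhs_nbhs (conj oA Ax)) => z; exact: df.
Qed.

Lemma C1_Ck1 f : (forall x, C1at f x) -> Ck 1 setT f.
Proof.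
by move=> Cf; split=> [x _|i x _]; [exact: C1at_diff|have [_] := Cf x; exact].
Qed.

End Calculus.

(** * Second derivatives, the maximum principle and gradient fields *)

Section SecondOrder.
Context {R : realType} {n : nat}.
Implicit Types (c u v w x y z : 'rV[R]_n) (i j : 'I_n) (f g : 'rV[R]_n -> R).
Local Notation e_ i := (delta_mx 0 i : 'rV[R]_n).

Lemma partial_shift f v x i : partial i (fun z => f (z + v)) x = partial i f (x + v).
Proof.
rewrite /partial /derive; do 2 f_equal; apply/funext => h /=.
by rewrite -addrA.
Qed.

Lemma differentiable_shift f v x : differentiable f (x + v) ->
  differentiable (fun z => f (z + v)) x.
Proof.
by move=> df; exact: (@differentiable_comp _ _ _ _ (fun z => z + v) f).
Qed.

Lemma gradient_delta f x i (h : R) : dotv (h *: e_ i) (gradient f x) = h * partial i f x.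
Proof. by rewrite dotvZl dotvC dotv_delta mxE. Qed.

Lemma scale_itv (t h : R) : 0 <= t -> t <= 1 -> 0 <= h -> 0 <= t * h <= h.
Proof. by move=> t0 t1 h0; rewrite mulr_ge0//= ler_piMl. Qed.

Lemma norm_two_steps (h s t : R) i j : `|s| <= h -> `|t| <= h ->
  `|s *: e_ i + t *: e_ j| <= 2 * h.
Proof.
move=> sh th; apply: le_trans (ler_normD _ _) _; rewrite !normrZ.
have := norm_delta_le (R := R) i; have := norm_delta_le (R := R) j.
have := normr_ge0 s; have := normr_ge0 t; have := normr_ge0 (e_ i).
have := normr_ge0 (e_ j); nra.
Qed.

Lemma second_difference f x i j (r h : R) : 0 < h -> 2 * h < r ->
  (forall z, `|z - x| < r -> differentiable f z /\ differentiable (partial i f) z) ->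
  exists s t : R, [/\ 0 <= s <= h, 0 <= t <= h &
   f (x + h *: e_ i + h *: e_ j) - f (x + h *: e_ i) - f (x + h *: e_ j) + f x =
   h * h * partial j (partial i f) (x + s *: e_ i + t *: e_ j)].
Proof.
move=> h0 hr df.
have inr (s t : R) : 0 <= s <= h -> 0 <= t <= h ->
    `|x + s *: e_ i + t *: e_ j - x| < r.
  move=> /andP[s0 sh] /andP[t0 th]; rewrite -(addrA x) (addrC x) addrK.
  apply: le_lt_trans hr; apply: norm_two_steps; by rewrite ger0_norm.
have inr' (s : R) : 0 <= s <= h -> `|x + s *: e_ i - x| < r.
  by move=> sh; have := inr s 0 sh; rewrite scale0r addr0; apply; rewrite lexx ltW.
have [t /andP[t0 t1]|c /andP[c0 c1]] :=
  @MVT_seg _ _ (fun z => f (z + h *: e_ j) - f z) x (h *: e_ i).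
  have th : 0 <= t * h <= h by apply: scale_itv => //; exact: ltW.
  rewrite scalerA; apply: differentiable_add.
    by apply: differentiable_shift; case: (df _ (inr _ h th _)) => //; rewrite lexx ltW.
  by apply: (@differentiableN _ _ _ f); case: (df _ (inr' _ th)).
rewrite gradient_delta scalerA => E.
have ch : 0 <= c * h <= h by apply: scale_itv; exact: ltW.
have E2 : partial i (fun z => f (z + h *: e_ j) - f z) (x + (c * h) *: e_ i) =
   partial i f (x + (c * h) *: e_ i + h *: e_ j) - partial i f (x + (c * h) *: e_ i).
  have d1 : differentiable f (x + (c * h) *: e_ i + h *: e_ j).
    by case: (df _ (inr _ h ch _)) => //; rewrite lexx ltW.
  have d2 : differentiable f (x + (c * h) *: e_ i) by case: (df _ (inr' _ ch)).
  rewrite (@partialD _ _ (fun z => f (z + h *: e_ j)) (fun z => - f z)).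
  - rewrite partial_shift; congr (_ + _).
    by rewrite /partial (@deriveN _ _ _ f)//; exact: diff_derivable.
  - exact: differentiable_shift.
  - exact: (@differentiableN _ _ _ f).
have [t /andP[t0 t1]|c' /andP[c'0 c'1]] :=
  @MVT_seg _ _ (partial i f) (x + (c * h) *: e_ i) (h *: e_ j).
  rewrite scalerA.
  have th : 0 <= t * h <= h by apply: scale_itv => //; exact: ltW.
  by case: (df _ (inr _ _ ch th)).
rewrite gradient_delta scalerA => E3.
exists (c * h), (c' * h); split=> //; first by apply: scale_itv; exact: ltW.
by rewrite -mulrA -E3 -E2 -E; ring.
Qed.

(** Both mixed derivatives are limits of the same second difference quotient, which the
    mean value theorem expresses through either of them. *)
Lemma Schwarz f x i j : (\forall z \near x, differentiable f z) ->
  C1at (partial i f) x -> C1at (partial j f) x ->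
  partial j (partial i f) x = partial i (partial j f) x.
Proof.
move=> df [di ci] [dj cj].
set a := LHS; set b := RHS.
apply/eqP/negPn/negP => ab.
have e0 : 0 < `|a - b| / 2 by rewrite divr_gt0// normr_gt0 subr_eq0.
have /near_normP[r1 r10 H1] := df.
have /near_normP[r2 r20 H2] := di.
have /near_normP[r3 r30 H3] := dj.
have [r4 r40 H4] := cont_normP (ci j) e0.
have [r5 r50 H5] := cont_normP (cj i) e0.
pose r := Num.min r1 (Num.min r2 (Num.min r3 (Num.min r4 r5))).
have r0 : 0 < r by rewrite !lt_min r10 r20 r30 r40.
have H z : `|z - x| < r ->
  [/\ differentiable f z, differentiable (partial i f) z, differentiable (partial j f) z,
   `|partial j (partial i f) z - a| < `|a - b| / 2 &
   `|partial i (partial j f) z - b| < `|a - b| / 2].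
  rewrite !lt_min => /and5P[/H1 h1 /H2 h2 /H3 h3 /H4 h4 /H5 h5].
  exact: And5 h1 h2 h3 h4 h5.
clearbody r; have h0 : 0 < r / 3 by rewrite divr_gt0.
have hr : 2 * (r / 3) < r by lra.
have [|s [t [shb thb E]]] := @second_difference f x i j r (r / 3) h0 hr.
  by move=> z /H[].
have [|s' [t' [s'h t'h E']]] := @second_difference f x j i r (r / 3) h0 hr.
  by move=> z /H[].
have E2 : partial j (partial i f) (x + s *: e_ i + t *: e_ j) =
   partial i (partial j f) (x + s' *: e_ j + t' *: e_ i).
  have hh : r / 3 * (r / 3) != 0 by rewrite mulf_neq0// gt_eqF.
  apply: (mulfI hh).
  apply: (etrans (esym E)).
  apply: (etrans _ E').
  have -> : x + (r / 3) *: e_ j + (r / 3) *: e_ i = x + (r / 3) *: e_ i + (r / 3) *: e_ j.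
    exact: addrAC.
  by congr (_ + _); exact: addrAC.
have ins k l (c d : R) : 0 <= c <= r / 3 -> 0 <= d <= r / 3 ->
    `|x + c *: e_ k + d *: e_ l - x| < r.
  move=> /andP[c0 c1] /andP[d0 d1]; rewrite -(addrA x) (addrC x) addrK.
  by apply: le_lt_trans hr; apply: norm_two_steps; rewrite ger0_norm.
have [_ _ _ A1 _] := H _ (ins i j s t shb thb).
have [_ _ _ _ B1] := H _ (ins j i s' t' s'h t'h).
move: A1 B1; rewrite E2; set c := partial _ _ _ => A1 B1.
clearbody a b c.
have : `|a - b| <= `|c - a| + `|c - b| by rewrite (distrC c a); exact: ler_distD.
move=> H6; have := le_lt_trans H6 (ltrD A1 B1).
by rewrite -splitr ltxx.
Qed.

Lemma partialN f x i : differentiable f x ->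
  partial i (fun z => - f z) x = - partial i f x.
Proof. by move=> df; rewrite /partial (@deriveN _ _ _ f)//; exact: diff_derivable. Qed.

Lemma differentiable_opp f x : differentiable f x -> differentiable (fun z => - f z) x.
Proof. exact: (@differentiableN _ _ _ f). Qed.

Lemma exists_lt_two (a b : R) : 0 < a -> 0 < b -> exists t, [/\ 0 < t, t < a & t < b].
Proof.
move=> a0 b0; have m0 : 0 < Num.min a b by rewrite lt_min a0.
exists (Num.min a b / 2); rewrite divr_gt0//.
suff : Num.min a b / 2 < Num.min a b by rewrite lt_min => /andP[].
by rewrite ltr_pdivrMr// mulr2n mulrDr mulr1 ltrDl.
Qed.

Lemma dir_derive_pos_gt f x v : differentiable f x -> 0 < dotv v (gradient f x) ->
  exists2 t0 : R, 0 < t0 & forall t, 0 < t < t0 -> f x < f (x + t *: v).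
Proof.
move=> df L0.
have {}df : h^-1 *: ((f \o shift x) (h *: v) - f x) @[h --> (0 : R)^'] -->
    dotv v (gradient f x).
  by rewrite -derive_gradient//; exact: (diff_derivable (v := v) df).
have /cvgrPdist_lt/(_ _ L0)[r /= r0 H] := df.
exists r => // t /andP[t0 tr].
have := H t; rewrite /= sub0r normrN gtr0_norm// => /(_ tr (lt0r_neq0 t0)).
set q := _ *: _ => /ltr_normlP[_]; rewrite ltrBlDl -ltrBlDr subrr => q0.
move: q0; rewrite /q pmulr_rgt0 ?invr_gt0// subr_gt0.
by rewrite addrC.
Qed.

Lemma derive_pos_gt f x i : differentiable f x -> 0 < partial i f x ->
  exists2 t0 : R, 0 < t0 & forall t, 0 < t < t0 -> f x < f (x + t *: e_ i).
Proof.
move=> df p0; apply: dir_derive_pos_gt => //.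
by rewrite dotvC dotv_delta mxE.
Qed.

(** At a maximum the second derivatives are nonpositive; stated without second
    derivatives of lines, the sign of the first derivative at the point decides
    in which direction [f] grows. *)
Lemma not_max_of_second_derive_pos f x i (r : R) : 0 < r ->
  (forall z, `|z - x| < r -> differentiable f z) ->
  differentiable (partial i f) x -> 0 < partial i (partial i f) x ->
  exists2 z, `|z - x| < r & f x < f z.
Proof.
move=> r0 df dp pp.
have [t0 t00 Ht] := derive_pos_gt dp pp.
have inr (t : R) : `|t| < r -> `|x + t *: e_ i - x| < r.
  rewrite addrC addKr normrZ => tr; apply: le_lt_trans tr.
  by rewrite ler_piMr// norm_delta_le.
have [p0|p0] := leP 0 (partial i f x).
  have [t [tt tt0 tr]] := exists_lt_two t00 r0.
  exists (x + t *: e_ i); first by apply: inr; rewrite gtr0_norm.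
  have [s /andP[s0 s1]|c /andP[c0 c1]] := @MVT_seg _ _ f x (t *: e_ i).
    rewrite scalerA; apply: df; apply: inr; rewrite ger0_norm ?mulr_ge0 ?(ltW tt)//.
    by apply: le_lt_trans tr; rewrite ler_piMl// ltW.
  rewrite gradient_delta scalerA -subr_gt0 => ->; rewrite pmulr_rgt0//.
  apply: le_lt_trans p0 _; apply: Ht; rewrite mulr_gt0//=; apply: lt_trans tt0.
  by rewrite gtr_pMl.
have [r1 r10 H1] := cont_normP (differentiable_continuous dp) (e := - partial i f x) ltac:(by rewrite oppr_gt0).
have [t [tt tt0 tr]] := exists_lt_two r10 r0.
exists (x + (- t) *: e_ i); first by apply: inr; rewrite normrN gtr0_norm.
have [s /andP[s0 s1]|c /andP[c0 c1]] := @MVT_seg _ _ f x ((- t) *: e_ i).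
  rewrite scalerA; apply: df; apply: inr; rewrite mulrN normrN ger0_norm ?mulr_ge0 ?(ltW tt)//.
  by apply: le_lt_trans tr; rewrite ler_piMl// ltW.
rewrite gradient_delta scalerA -subr_gt0 => ->; rewrite mulNr -mulrN pmulr_rgt0//.
have : `|x + (c * - t) *: e_ i - x| < r1.
  rewrite addrC addKr normrZ mulrN normrN ger0_norm ?mulr_ge0 ?(ltW tt) ?(ltW c0)//.
  apply: le_lt_trans tt0; apply: (@le_trans _ _ (t * 1)); last by rewrite mulr1.
  apply: ler_pM => //; rewrite ?mulr_ge0 ?(ltW tt) ?(ltW c0)//.
    by rewrite ler_piMl// ltW.
  exact: norm_delta_le.
move=> /H1 /ltr_normlP[_]; set p := partial i f x; set q := partial i f _.
by rewrite ltrBlDl subrr oppr_gt0.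
Qed.

Lemma compact_norm_ball x (r : R) : compact [set z | `|z - x| <= r].
Proof.
apply: bounded_closed_compact.
  exists (`|x| + r); split; first by rewrite num_real.
  move=> M HM z /= zr; apply: ltW; apply: le_lt_trans HM.
  by rewrite -(subrK x z) addrC; apply: le_trans (ler_normD _ _) _; rewrite lerD2l.
have -> : [set z | `|z - x| <= r] = closed_ball_ Num.norm x r.
  by apply/seteqP; split => z /=; rewrite /closed_ball_ /= distrC.
exact: closed_closed_ball_.
Qed.

Lemma partial_quadratic (a : R) x y i :
  partial i (fun z => a * dotv (z - x) (z - x)) y = 2 * a * (y - x) 0 i.
Proof.
have d j : differentiable (fun z : 'rV[R]_n => (z - x) 0 j) y.
  rewrite (_ : (fun _ => _) = fun z : 'rV[R]_n => z 0 j + (- x 0 j)).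
    by apply: differentiable_add; [exact: differentiable_proj|exact: differentiable_cst].
  by apply/funext => z; rewrite !mxE.
have p j : partial i (fun z : 'rV[R]_n => (z - x) 0 j) y = (j == i)%:R.
  rewrite (_ : (fun _ => _) = fun z : 'rV[R]_n => z 0 j + (- x 0 j)); last first.
    by apply/funext => z; rewrite !mxE.
  rewrite partialD ?partial_cst ?addr0 ?partial_proj//; first exact: differentiable_proj.
rewrite partialZ; last by apply: differentiable_sum_fun => j; exact: differentiable_mul.
rewrite /dotv partial_sum; last by move=> j; exact: differentiable_mul.
rewrite (bigD1 i)//= partialM// p eqxx mulr1 big1 ?addr0 => [|j ji].
  by ring.
by rewrite partialM// p (negbTE ji) mulr0 addr0.
Qed.

Lemma differentiable_quadratic (a : R) x y :
  differentiable (fun z => a * dotv (z - x) (z - x)) y.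
Proof.
apply: differentiable_mul; first exact: differentiable_cst.
apply: differentiable_sum_fun => j.
rewrite (_ : (fun _ => _) = fun z : 'rV[R]_n => (z 0 j + (- x 0 j)) * (z 0 j + (- x 0 j))).
  by apply: differentiable_mul; apply: differentiable_add;
    [exact: differentiable_proj|exact: differentiable_cst|exact: differentiable_proj|exact: differentiable_cst].
by apply/funext => z; rewrite !mxE.
Qed.

Lemma laplacian_bound_pos f c (r K m : R) : 0 < r -> 0 < K ->
  (forall z, `|z - c| <= r -> differentiable f z) ->
  (forall z i, `|z - c| < r -> differentiable (partial i f) z) ->
  (forall z, `|z - c| < r -> laplacian f z = K) ->
  (forall z, `|z - c| <= r -> `|f z| <= m) ->
  K * r ^+ 2 <= 8 * n%:R * m.
Proof.
move=> r0 K0 df ddf lap fm.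
have cc : `|c - c| < r by rewrite subrr normr0.
have n0 : 0 < n%:R :> R.
  rewrite ltr0n lt0n; apply/negP => /eqP n0; move: (lap c cc) K0 => <-.
  rewrite /laplacian big1 ?ltxx// => i; have := ltn_ord i.
  by rewrite [X in (_ < X)%N -> _]n0.
(* The paraboloid of this coefficient has Laplacian K / 2, half of that of f. *)
pose k := K / (4 * n%:R).
have k0 : 0 < k by rewrite divr_gt0// mulr_gt0.
pose V z := f z - k * dotv (z - c) (z - c).
have dV z : `|z - c| <= r -> differentiable V z.
  move=> /df dz; apply: differentiable_add dz _; apply: differentiable_opp.
  exact: differentiable_quadratic.
have pV z i : `|z - c| <= r -> partial i V z = partial i f z - 2 * k * (z - c) 0 i.
  move=> zr; rewrite partialD; [|exact: df|].
    by rewrite partialN ?partial_quadratic//; exact: differentiable_quadratic.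
  by apply: differentiable_opp; exact: differentiable_quadratic.
have [| |y] := @EVT_max_rV R n V [set z | `|z - c| <= r] _ (@compact_norm_ball c r) _.
- by exists c; rewrite /= ltW.
- apply: continuous_in_subspaceT => z; rewrite inE/= => zr.
  exact/differentiable_continuous/dV.
rewrite inE/= => yr Vy.
have [yr'|yr'] := ltP `|y - c| r.
  have near_y : \forall z \near y, `|z - c| < r.
    apply/near_normP; exists (r - `|y - c|); first by rewrite subr_gt0.
    move=> z; rewrite ltrBrDr; apply: le_lt_trans.
    by rewrite -[X in `|X - c|](subrK y z) -addrA ler_normD.
  have lin i : differentiable (fun z : 'rV[R]_n => - (2 * k * (z - c) 0 i)) y.
    rewrite (_ : (fun _ => _) = fun z : 'rV[R]_n => - (2 * k) * z 0 i + (2 * k * c 0 i)).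
      apply: differentiable_add; last exact: differentiable_cst.
      by apply: differentiable_mul; [exact: differentiable_cst|exact: differentiable_proj].
    by apply/funext => z; rewrite !mxE; ring.
  have plin i : partial i (fun z : 'rV[R]_n => - (2 * k * (z - c) 0 i)) y = - (2 * k).
    rewrite (_ : (fun _ => _) = fun z : 'rV[R]_n => - (2 * k) * z 0 i + (2 * k * c 0 i)).
      rewrite partialD; last 2 first.
      - by apply: differentiable_mul; [exact: differentiable_cst|exact: differentiable_proj].
      - exact: differentiable_cst.
      rewrite partial_cst addr0 partialZ; last exact: differentiable_proj.
      by rewrite partial_proj eqxx mulr1.
    by apply/funext => z; rewrite !mxE; ring.
  have near_pV i : \forall z \near y,
      partial i f z + (- (2 * k * (z - c) 0 i)) = partial i V z.
    by apply: filterS near_y => z /ltW zr; rewrite pV.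
  have dpV i : differentiable (partial i V) y.
    by apply: (near_eq_diff (near_pV i)); apply: differentiable_add; [exact: ddf|exact: lin].
  have ppV i : partial i (partial i V) y = partial i (partial i f) y - 2 * k.
    rewrite -(partial_near i (near_pV i)) partialD ?plin//; exact: ddf.
  have : \sum_(i < n) partial i (partial i V) y = K / 2.
    under eq_bigr do rewrite ppV.
    rewrite big_split/= sumr_const card_ord -/(laplacian f y) lap// /k.
    by rewrite -mulr_natl; field; rewrite gt_eqF.
  have [[i Vi]|noi] := pselect (exists i, 0 < partial i (partial i V) y).
    have r1 : 0 < r - `|y - c| by rewrite subr_gt0.
    have [z zy|z zy yz] := not_max_of_second_derive_pos r1 _ (dpV i) Vi.
      apply: dV; rewrite -[X in `|X - c|](subrK y z) -addrA.
      by apply: le_trans (ler_normD _ _) _; rewrite -lerBrDr ltW.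
    have zin : z \in [set z | `|z - c| <= r].
      rewrite inE/= -[X in `|X - c|](subrK y z) -addrA.
      by apply: le_trans (ler_normD _ _) _; rewrite -lerBrDr ltW.
    by have := lt_le_trans yz (Vy z zin); rewrite ltxx.
  move=> sK; have : \sum_(i < n) partial i (partial i V) y <= 0.
    by apply: sumr_le0 => i _; rewrite leNgt; apply/negP => Vi; apply: noi; exists i.
  by rewrite sK leNgt divr_gt0.
have Vc : V c <= V y by apply: Vy; rewrite inE/= ltW.
have r2 : r ^+ 2 <= dotv (y - c) (y - c).
  by apply: le_trans (sqr_norm_le_dotvv _); rewrite ler_sqr ?nnegrE ?(ltW r0).
have /ler_normlP[fc1 fc2] := fm c (ltW cc); have /ler_normlP[fy1 fy2] := fm y yr.
have k2 : k * r ^+ 2 <= 2 * m.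
  have : k * r ^+ 2 <= k * dotv (y - c) (y - c) by apply: ler_wpM2l r2; exact: ltW.
  move: Vc; rewrite /V subrr dotv0l mulr0 subr0 => Vc H.
  clear -Vc H fc1 fy2; lra.
have -> : K * r ^+ 2 = 4 * n%:R * (k * r ^+ 2).
  rewrite /k; by field; rewrite gt_eqF.
rewrite (_ : 8 * n%:R * m = 4 * n%:R * (2 * m)); last by ring.
by rewrite ler_pM2l// mulr_gt0.
Qed.

(** The maximum principle: a function that is small on a ball cannot have a large
    constant Laplacian there, since subtracting a paraboloid would leave an
    interior maximum with a positive Laplacian. *)
Lemma laplacian_bound f c (r K m : R) : 0 < r ->
  (forall z, `|z - c| <= r -> differentiable f z) ->
  (forall z i, `|z - c| < r -> differentiable (partial i f) z) ->
  (forall z, `|z - c| < r -> laplacian f z = K) ->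
  (forall z, `|z - c| <= r -> `|f z| <= m) ->
  `|K| * r ^+ 2 <= 8 * n%:R * m.
Proof.
move=> r0 df ddf lap fm.
have [K0|K0|K0] := ltgtP 0 K.
- by rewrite gtr0_norm//; exact: laplacian_bound_pos lap fm.
- rewrite ltr0_norm//.
  have near_in z : `|z - c| < r -> \forall y \near z, `|y - c| < r.
    move=> zr; apply/near_normP; exists (r - `|z - c|); first by rewrite subr_gt0.
    move=> y; rewrite ltrBrDr; apply: le_lt_trans.
    by rewrite -[X in `|X - c|](subrK z y) -addrA ler_normD.
  have pN z i : `|z - c| < r ->
      \forall y \near z, - partial i f y = partial i (fun x => - f x) y.
    by move=> /near_in; apply: filterS => y /ltW yr; rewrite partialN//; exact: df.
  apply: (@laplacian_bound_pos (fun z => - f z) c) => //.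
  + by rewrite oppr_gt0.
  + by move=> z /df; exact: differentiable_opp.
  + by move=> z i zr; apply: (near_eq_diff (pN z i zr)); exact/differentiable_opp/ddf.
  + move=> z zr; rewrite -(lap z zr) /laplacian -sumrN; apply: eq_bigr => i _.
    by rewrite -(partial_near i (pN z i zr)) partialN//; exact: ddf.
  + by move=> z /fm; rewrite normrN.
- rewrite -K0 normr0 mul0r !mulr_ge0//; apply: le_trans (fm c _); first exact: normr_ge0.
  by rewrite subrr normr0 ltW.
Qed.

(** The components of a gradient field are first derivatives of the potential, so their
    derivatives are mixed second derivatives. *)
Lemma potential_symmetric (A : set 'rV[R]_n) f (u : 'rV[R]_n -> 'rV[R]_n) : open A ->
  (forall x, A x -> differentiable f x) ->
  (forall x j, A x -> partial j f x = u x 0 j) ->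
  (forall j, Ck 1 A (component u j)) ->
  forall x i j, A x -> partial i (component u j) x = partial j (component u i) x.
Proof.
move=> oA df fu Cu x i j Ax.
have nA : \forall z \near x, A z by exact: open_nbhs_nbhs.
have nf k : \forall z \near x, component u k z = partial k f z.
  by apply: filterS nA => z Az; rewrite fu.
rewrite (partial_near i (nf j)) (partial_near j (nf i)); apply: Schwarz.
- by apply: filterS nA.
- by apply: (C1at_near_eq (nf j)); exact: Ck1_C1at (Cu j) Ax.
- by apply: (C1at_near_eq (nf i)); exact: Ck1_C1at (Cu i) Ax.
Qed.

Lemma divergence_C1at (A : set 'rV[R]_n) (u : 'rV[R]_n -> 'rV[R]_n) x : open A ->
  (forall j, Ck 2 A (component u j)) -> A x -> C1at (divergence u) x.
Proof.
move=> oA Cu Ax; apply: C1at_sum => i.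
by have [_ /(_ i) Ci] := Cu i; exact: Ck1_C1at Ci Ax.
Qed.

(** By symmetry of the second derivatives the vector Laplacian of a gradient field is
    the gradient of its divergence, so the Lame operator is [- (la + 2 mu)] times that
    gradient. *)
Lemma lame_potential_div (A : set 'rV[R]_n) f (u : 'rV[R]_n -> 'rV[R]_n) (la mu : R) :
  open A -> la + 2 * mu != 0 ->
  (forall x, A x -> differentiable f x) ->
  (forall x j, A x -> partial j f x = u x 0 j) ->
  (forall j, Ck 2 A (component u j)) ->
  (forall x, A x -> lame_operator la mu u x = 0) ->
  forall x j, A x -> partial j (divergence u) x = 0.
Proof.
move=> oA lm0 df fu Cu lame x j Ax.
have nA y : A y -> \forall z \near y, A z by move=> Ay; exact: open_nbhs_nbhs.
have Cu1 k : Ck 1 A (component u k).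
  have [d H] := Cu k; split=> // i y Ay; have [dd _] := H i.
  exact/differentiable_continuous/dd.
have sym := potential_symmetric oA df fu Cu1.
have C1p k i y : A y -> C1at (partial i (component u k)) y.
  by move=> Ay; have [_ /(_ i) Ci] := Cu k; exact: Ck1_C1at Ci Ay.
have divE : partial j (divergence u) x = \sum_(i < n) partial j (partial i (component u i)) x.
  by rewrite /divergence partial_sum// => i; exact/C1at_diff/C1p.
have lapE : vlaplacian u x 0 j = partial j (divergence u) x.
  rewrite divE mxE; apply: eq_bigr => i _.
  have -> : partial i (partial i (component u j)) x = partial i (partial j (component u i)) x.
    by apply: partial_near; apply: filterS (nA x Ax) => z; exact: sym.
  apply: Schwarz; [|exact: C1p|exact: C1p].
  by apply: filterS (nA x Ax) => z; have [+ _] := Cu i; apply.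
have := lame x Ax; rewrite /lame_operator.
move: (vlaplacian u x) lapE => L LE /rowP/(_ j); rewrite !mxE LE.
set p := partial j _ _; rewrite -mulrBl -opprD -addrA.
rewrite (_ : mu + mu = 2 * mu); last by ring.
by move=> /eqP; rewrite mulf_eq0 oppr_eq0 (negbTE lm0) => /eqP.
Qed.

Lemma potential_divergence_flat f (u : 'rV[R]_n -> 'rV[R]_n) :
  (forall x, differentiable f x) -> (forall x j, partial j f x = u x 0 j) ->
  forall (A : set 'rV[R]_n) (la mu : R), open A -> la + 2 * mu != 0 ->
  (forall j, Ck 2 A (component u j)) ->
  (forall x, A x -> lame_operator la mu u x = 0) ->
  forall x, A x -> differentiable (divergence u) x /\ gradient (divergence u) x = 0.
Proof.
move=> df fu A la mu oA l0 CA lame x Ax; split; first exact: C1at_diff (divergence_C1at oA CA Ax).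
apply/rowP => j; rewrite !mxE.
exact: (lame_potential_div oA l0 (fun x _ => df x) (fun x j _ => fu x j) CA lame).
Qed.

End SecondOrder.

(** * Boundary charts and the outward normal *)

Section Charts.
Context {R : realType} {n : nat}.
Local Notation V := 'rV[R]_n.+1.
Local Notation W := 'rV[R]_n.
Implicit Types (i j : 'I_n.+1) (s : bool) (gamma : W -> R) (x z p v : V) (y : W).
Local Notation e_ i := (delta_mx 0 i : 'rV[R]_n.+1).

(** The inverse of the splitting of a point into its [i]-th coordinate and the others;
    graph points are of this form. *)
Definition insert i y (t : R) : V :=
  \row_j if unlift i j is Some k then y 0 k else t.

Lemma insert_at i y t : insert i y t 0 i = t.
Proof. by rewrite mxE unlift_none. Qed.

Lemma insert_lift i y t (k : 'I_n) : insert i y t 0 (lift i k) = y 0 k.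
Proof. by rewrite mxE liftK. Qed.

Lemma col'E i z (k : 'I_n) : col' i z 0 k = z 0 (lift i k).
Proof. by rewrite mxE. Qed.

Lemma insertK i y t : col' i (insert i y t) = y.
Proof. by apply/rowP => k; rewrite col'E insert_lift. Qed.

Lemma insert_col' i z : insert i (col' i z) (z 0 i) = z.
Proof.
apply/rowP => j; case: (unliftP i j) => [k ->|->]; last by rewrite insert_at.
by rewrite insert_lift col'E.
Qed.

Lemma graph_pointE i gamma y : graph_point i gamma y = insert i y (gamma y).
Proof. by []. Qed.

Lemma rowP_lift i v z : v 0 i = z 0 i ->
  (forall k : 'I_n, v 0 (lift i k) = z 0 (lift i k)) -> v = z.
Proof. by move=> vz H; apply/rowP => j; case: (unliftP i j) => [k ->|->]. Qed.

Lemma dotv_lift i v z :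
  dotv v z = v 0 i * z 0 i + dotv (col' i v) (col' i z).
Proof.
by rewrite /dotv (bigD1_ord i)//=; congr (_ + _); apply: eq_bigr => k _; rewrite !col'E.
Qed.

Lemma norm_col' i z : `|col' i z| <= `|z|.
Proof. by apply/norm_leP => // k; rewrite col'E coord_le_norm. Qed.

Lemma col'D i z v : col' i (z + v) = col' i z + col' i v.
Proof. by apply/rowP => k; rewrite mxE [RHS]mxE !col'E !mxE. Qed.

Lemma col'Z i (a : R) z : col' i (a *: z) = a *: col' i z.
Proof. by apply/rowP => k; rewrite mxE [RHS]mxE !col'E !mxE. Qed.

Lemma col'B i z v : col' i (z - v) = col' i z - col' i v.
Proof. by rewrite -scaleN1r col'D col'Z scaleN1r. Qed.

Lemma col'_delta i : col' i (e_ i) = 0.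
Proof. by apply/rowP => k; rewrite col'E !mxE eqxx/= eq_sym (negbTE (neq_lift _ _)). Qed.

Lemma col'_delta_lift i (k : 'I_n) : col' i (e_ (lift i k)) = delta_mx 0 k.
Proof. by apply/rowP => l; rewrite col'E !mxE eqxx/= (inj_eq (lift_inj)). Qed.

Lemma norm_insert i y t : `|insert i y t| <= Num.max `|y| `|t|.
Proof.
apply/norm_leP => [|j]; first by rewrite le_max normr_ge0.
rewrite mxE; case: unlift => [k|]; rewrite le_max ?lexx ?orbT//.
by rewrite coord_le_norm.
Qed.

Lemma continuous_col' i : continuous (col' i : V -> W).
Proof.
apply: bounded_linear_continuous; exists 1; split; first exact: num_real.
move=> M M1; apply/near_normP; exists 1 => // z; rewrite subr0 => z1.
by apply: le_trans (norm_col' i z) _; apply: ltW; exact: lt_trans M1.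
Qed.

Lemma differentiable_col' i z : differentiable (col' i : V -> W) z.
Proof. exact/linear_differentiable/continuous_col'. Qed.

Lemma differentiable_comp_col' i gamma z : differentiable gamma (col' i z) ->
  differentiable (fun x => gamma (col' i x)) z.
Proof. by move=> dg; exact: (differentiable_comp (differentiable_col' i z) dg). Qed.

Lemma partial_comp_col' i j gamma z : differentiable gamma (col' i z) ->
  partial j (fun x => gamma (col' i x)) z =
    dotv (col' i (e_ j)) (gradient gamma (col' i z)).
Proof.
move=> dg; rewrite -derive_gradient// /partial.
have dc := differentiable_col' i z.
rewrite deriveE; last exact: differentiable_comp_col'.
rewrite deriveE// (diff_comp dc dg)//=; congr ('d _ _ _).
by rewrite diff_lin//; exact: continuous_col'.
Qed.

Lemma continuous_comp_col' i (h : W -> R) z : {for col' i z, continuous h} ->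
  {for z, continuous (fun x => h (col' i x))}.
Proof.
move=> ch; apply: (@continuous_comp _ _ _ (col' i : V -> W) h _ _ ch).
exact: (@continuous_col' i z).
Qed.

Lemma C1at_comp_col' i gamma z : C1at gamma (col' i z) ->
  C1at (fun x => gamma (col' i x)) z.
Proof.
move=> [dg cg].
have /near_normP[r r0 H] := dg.
have near_z : \forall x \near z, differentiable gamma (col' i x).
  apply/near_normP; exists r => // x xr; apply: H; rewrite -col'B.
  exact: le_lt_trans (norm_col' _ _) xr.
have C0 (k : 'I_n) : {for z, continuous (fun x => partial k gamma (col' i x))}.
  exact: continuous_comp_col'.
split; first by apply: filterS near_z => x; exact: differentiable_comp_col'.
move=> j; apply: (@for_cont_near _ _ (fun x => dotv (col' i (e_ j)) (gradient gamma (col' i x)))).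
  by apply: filterS near_z => x dx; rewrite partial_comp_col'.
case: (unliftP i j) => [k ->|->].
  have -> : (fun x => dotv (col' i (e_ (lift i k))) (gradient gamma (col' i x))) =
      fun x => partial k gamma (col' i x); last exact: C0.
  by apply/funext => x; rewrite col'_delta_lift dotvC dotv_delta mxE.
have -> : (fun x => dotv (col' i (e_ i)) (gradient gamma (col' i x))) = fun=> 0.
  by apply/funext => x; rewrite col'_delta dotv0l.
by move=> A; exact: (@cst_continuous _ _ (0 : R) z).
Qed.

(** Positive inside the subgraph, zero on the graph: both sides of the boundary
    are described by the sign of one C^1 function. *)
Definition height i s gamma z : R := (-1) ^+ s * (gamma (col' i z) - z 0 i).

(** The outward normal to the subgraph before normalization, so that its length is
    the surface element of the graph. *)
Definition graph_normal i s gamma y : V :=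
  (-1) ^+ s *: insert i (- gradient gamma y) 1.

Lemma subgraphE i s gamma z : subgraph i s gamma z <-> 0 < height i s gamma z.
Proof. by rewrite /subgraph /height mulrBr subr_gt0. Qed.

Lemma heightN i s gamma z : height i (~~ s) gamma z = - height i s gamma z.
Proof. by rewrite /height signrN mulNr. Qed.

Lemma graph_normalN i s gamma y : graph_normal i (~~ s) gamma y = - graph_normal i s gamma y.
Proof. by rewrite /graph_normal signrN scaleNr. Qed.

Lemma height_up i s gamma z (t : R) :
  height i s gamma (z - (t * (-1) ^+ s) *: e_ i) = height i s gamma z + t.
Proof.
rewrite /height col'B col'Z col'_delta scaler0 subr0 !mxE !eqxx mulr1.
have sgn2 : (-1) ^+ s * (-1) ^+ s = 1 :> R by rewrite -signr_addb addbb.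
move: (_ ^+ _) sgn2 => e sgn2.
by rewrite -[t in RHS]mulr1 -sgn2; ring.
Qed.

Lemma height_insert i s gamma y t :
  height i s gamma (insert i y t) = (-1) ^+ s * (gamma y - t).
Proof. by rewrite /height insertK insert_at. Qed.

Lemma height_graph i s gamma y : height i s gamma (graph_point i gamma y) = 0.
Proof. by rewrite graph_pointE height_insert subrr mulr0. Qed.

Lemma height0_insert i s gamma z : height i s gamma z = 0 ->
  z = graph_point i gamma (col' i z).
Proof.
move=> /eqP; rewrite mulf_eq0 signr_eq0/= subr_eq0 => /eqP E.
by rewrite graph_pointE E insert_col'.
Qed.

Lemma C1at_height i s gamma z : C1at gamma (col' i z) -> C1at (height i s gamma) z.
Proof.
move=> Cg; apply: C1atZ; apply: C1atB; first exact: C1at_comp_col'.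
exact: C1at_proj.
Qed.

Lemma gradient_height i s gamma z : differentiable gamma (col' i z) ->
  gradient (height i s gamma) z = - graph_normal i s gamma (col' i z).
Proof.
move=> dg; have dgc := differentiable_comp_col' dg.
have dN : differentiable (fun x : V => - x 0 i) z.
  exact/differentiable_opp/differentiable_proj.
have pE j : partial j (height i s gamma) z =
    (-1) ^+ s * (dotv (col' i (e_ j)) (gradient gamma (col' i z)) - (i == j)%:R).
  rewrite partialZ; last exact: differentiable_add.
  rewrite partialD// partial_comp_col'// partialN ?partial_proj//.
  exact: differentiable_proj.
apply: (@rowP_lift i) => [|k]; rewrite mxE pE /graph_normal !mxE.
  by rewrite col'_delta dotv0l eqxx sub0r unlift_none mulrN.
rewrite col'_delta_lift dotvC dotv_delta liftK !mxE (negbTE (neq_lift _ _)) subr0.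
by rewrite mulrN opprK.
Qed.

Lemma dotv_graph_normal_ge1 i s gamma y :
  1 <= dotv (graph_normal i s gamma y) (graph_normal i s gamma y).
Proof.
rewrite /graph_normal dotvZl dotvZr mulrA -signr_addb addbb expr0 mul1r.
by rewrite (dotv_lift i) !insert_at mulr1 lerDl dotvv_ge0.
Qed.

Lemma enorm_graph_normal i s gamma y :
  enorm (graph_normal i s gamma y) = Num.sqrt (1 + enorm (gradient gamma y) ^+ 2).
Proof.
rewrite {1}/enorm /graph_normal dotvZl dotvZr mulrA -signr_addb addbb expr0 mul1r.
by rewrite (dotv_lift i) !insert_at insertK mulr1 dotvNl dotvNr opprK enormK.
Qed.

Lemma enorm_graph_normal_gt0 i s gamma y : 0 < enorm (graph_normal i s gamma y).
Proof. by rewrite sqrtr_gt0; apply: lt_le_trans (dotv_graph_normal_ge1 _ _ _ _). Qed.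

(** A boundary chart valid on the ball of radius [r]; the exterior and the
    boundary are described along with the set. *)
Definition chart (U : set V) x i s gamma (r : R) := [/\ 0 < r, smooth setT gamma &
  forall z, `|z - x| < r -> [/\ U z <-> 0 < height i s gamma z,
    (~` closure U) z <-> height i s gamma z < 0 &
    boundary U z <-> height i s gamma z = 0]].

Lemma smooth_C1at gamma y : smooth setT gamma -> C1at gamma y.
Proof. by move=> sg; apply: (Ck1_C1at openT (sg 1%N)). Qed.

(** A description of the open set near a point also describes its closure there: points
    where the height is zero are approached by moving along the distinguished
    coordinate. *)
Lemma near_chart (U : set V) x i s gamma : open U -> smooth setT gamma ->
  (\forall z \near x, U z <-> subgraph i s gamma z) ->
  exists r, chart U x i s gamma r.
Proof.
move=> oU sg /near_normP[r r0 H]; exists r; split=> // z zr.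
have UE : U z <-> 0 < height i s gamma z by rewrite -subgraphE; exact: H.
have Ch w : C1at (height i s gamma) w by apply: C1at_height; exact: smooth_C1at.
have zr0 : 0 < r - `|z - x| by rewrite subr_gt0.
have near_in w : `|w - z| < r - `|z - x| -> `|w - x| < r.
  rewrite ltrBrDr; apply: le_lt_trans.
  by rewrite -[X in `|X - x|](subrK z w) -addrA ler_normD.
have clE : closure U z <-> 0 <= height i s gamma z.
  split=> [cz|h0 B /near_normP[r1 r10 HB]].
    rewrite leNgt; apply/negP => hz.
    have hz' : 0 < - height i s gamma z by rewrite oppr_gt0.
    have [r1 r10 H1] := cont_normP (C1at_cont (Ch z)) hz'.
    have [t [t0 t1 t2]] := exists_lt_two zr0 r10.
    have /cz[w [Uw]] : nbhs z [set w | `|w - z| < t] by apply/near_normP; exists t.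
    rewrite /= => wt; have wx : `|w - x| < r by apply: near_in; exact: lt_trans wt t1.
    have : 0 < height i s gamma w by rewrite -subgraphE -H.
    have := H1 w (lt_trans wt t2) => /ltr_normlP[_].
    by rewrite ltrBlDl subrr => /ltW h1; rewrite ltNge h1.
  have [t [t0 t1 t2]] := exists_lt_two zr0 r10.
  pose w := z - (t * (-1) ^+ s) *: e_ i.
  have wz : `|w - z| <= t.
    rewrite /w addrC addKr normrN normrZ normrM normrX normrN1 expr1n mulr1 gtr0_norm//.
    by rewrite ler_piMr ?norm_delta_le// ltW.
  exists w; split; last by apply: HB; exact: le_lt_trans wz t2.
  rewrite (H w); last by apply: near_in; exact: le_lt_trans wz t1.
  by apply/subgraphE; rewrite /w height_up ltr_wpDl.
split=> //.
  split=> [nc|hz /clE]; last by rewrite leNgt hz.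
  by rewrite ltNge; apply/negP => /clE.
have iU : U^° = U by apply/interior_id.
rewrite /boundary iU; split=> [[/clE h0 nU]|hz].
  by apply/eqP; rewrite eq_le h0 andbT leNgt; apply/negP => /UE.
by split; [apply/clE; rewrite hz|rewrite UE hz ltxx].
Qed.

Lemma boundary_chart (U : set V) x : open U -> smooth_boundary U -> boundary U x ->
  exists i s gamma r, chart U x i s gamma r.
Proof.
move=> oU sU /sU[i [s [gamma [sg near_x]]]].
by have [r Cr] := near_chart oU sg near_x; exists i, s, gamma, r.
Qed.

Lemma near_right0P (P : R -> Prop) :
  (\forall t \near (0 : R)^'+, P t) <-> exists2 t0 : R, 0 < t0 & forall t, 0 < t < t0 -> P t.
Proof.
split=> [[r /= r0 H]|[r r0 H]].
  exists r => // t /andP[t0 tr]; apply: H => //=.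
  by rewrite sub0r normrN gtr0_norm.
exists r => //= t; rewrite /ball_ /= sub0r normrN => tr t0; apply: H.
by rewrite t0/= (le_lt_trans (ler_norm _) tr).
Qed.

Lemma curve_near (c : R -> V) (r : R) : derivable c 0 1 -> 0 < r ->
  \forall t \near (0 : R), `|c t - c 0| < r.
Proof.
move=> /derivable1_diffP/differentiable_continuous/cvgrPdist_lt cc r0.
by have := cc r r0; apply: filterS => t; rewrite distrC.
Qed.

Lemma line_near p v (r : R) : 0 < r -> exists2 t0 : R, 0 < t0 &
  forall t, 0 < t < t0 -> `|p + t *: v - p| < r.
Proof.
move=> r0; exists (r / (`|v| + 1)); first by rewrite divr_gt0// ltr_wpDl.
move=> t /andP[t0]; rewrite ltr_pdivlMr ?ltr_wpDl// => tr.
rewrite addrC addKr normrZ gtr0_norm//; apply: le_lt_trans tr.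
by rewrite ler_pM2l// lerDl.
Qed.

Lemma chart_boundary_pt (U : set V) p i s gamma r : chart U p i s gamma r ->
  boundary U p -> height i s gamma p = 0.
Proof.
by move=> [r0 sg H]; have [|_ _ E /E] := H p; rewrite ?subrr ?normr0.
Qed.

(** Along a direction pointing outwards the height is strictly decreasing to first order,
    so the line leaves the set at the boundary point. *)
Lemma chart_crosses (U : set V) p i s gamma r v : chart U p i s gamma r ->
  boundary U p -> 0 < dotv v (graph_normal i s gamma (col' i p)) ->
  exists2 t0 : R, 0 < t0 & forall t, 0 < t < t0 ->
    U (p - t *: v) /\ (~` closure U) (p + t *: v).
Proof.
move=> ch bp vN; have hp := chart_boundary_pt ch bp; have [r0 sg H] := ch.
have Cg : C1at gamma (col' i p) by exact: smooth_C1at.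
have dh : differentiable (height i s gamma) p by exact/C1at_diff/C1at_height.
have gh := gradient_height s (C1at_diff Cg).
have [t1 t10 H1] : exists2 t0 : R, 0 < t0 & forall t, 0 < t < t0 ->
    height i s gamma p < height i s gamma (p + t *: - v).
  by apply: dir_derive_pos_gt => //; rewrite gh dotvNl dotvNr opprK.
have [t2 t20 H2] : exists2 t0 : R, 0 < t0 & forall t, 0 < t < t0 ->
    - height i s gamma p < - height i s gamma (p + t *: v).
  apply: (@dir_derive_pos_gt _ _ (fun z => - height i s gamma z)).
    exact: differentiable_opp.
  have -> : gradient (fun z => - height i s gamma z) p = - gradient (height i s gamma) p.
    by apply/rowP => j; rewrite !mxE partialN.
  by rewrite gh opprK.
have [t3 t30 H3] := line_near p (- v) r0.
have [t4 t40 H4] := line_near p v r0.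
have m0 : 0 < Num.min (Num.min t1 t2) (Num.min t3 t4) by rewrite !lt_min t10 t20 t30.
exists (Num.min (Num.min t1 t2) (Num.min t3 t4)) => // t /andP[t0].
rewrite !lt_min => /andP[/andP[tt1 tt2] /andP[tt3 tt4]]; split.
  have [|+ _ _] := H (p - t *: v).
    by rewrite -scalerN; apply: H3; rewrite t0.
  by move=> ->; rewrite -scalerN -hp; apply: H1; rewrite t0.
have [|_ + _] := H (p + t *: v); first by apply: H4; rewrite t0.
move=> ->; have := H2 t; rewrite t0 tt2 hp oppr0 oppr_gt0; exact.
Qed.

Lemma chart_tangent (U : set V) p i s gamma r w : chart U p i s gamma r ->
  boundary U p -> tangent_vector (boundary U) p w ->
  dotv (graph_normal i s gamma (col' i p)) w = 0.
Proof.
move=> [r0 sg H] bp [c [c0 near_c dc cw]].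
have Cg : C1at gamma (col' i p) by exact: smooth_C1at.
have dh : differentiable (height i s gamma) (c 0) by rewrite c0; exact/C1at_diff/C1at_height.
have gh := gradient_height s (C1at_diff Cg).
have cd : is_derive (0 : R) 1 c w by exact: DeriveDef.
have [_ E] := is_derive_curve cd dh.
have -> : dotv (graph_normal i s gamma (col' i p)) w = - 'D_1 (height i s gamma \o c) 0.
  by rewrite E c0 gh dotvNr opprK dotvC.
rewrite (@near_eq_derive _ _ _ _ (cst 0)) ?derive_cst ?oppr0//.
have cn := curve_near dc r0; rewrite c0 in cn.
apply: filterS2 near_c cn => t bt ct /=.
by have [_ _ Eb] := H _ ct; apply/Eb.
Qed.

Lemma graph_point_tangent (U : set V) p i s gamma r (k : 'I_n) : chart U p i s gamma r ->
  boundary U p ->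
  tangent_vector (boundary U) p (insert i (delta_mx 0 k) (partial k gamma (col' i p))).
Proof.
move=> ch bp; have hp := chart_boundary_pt ch bp; have [r0 sg H] := ch.
pose y := col' i p.
pose c (t : R) : V := insert i (y + t *: delta_mx 0 k) (gamma (y + t *: delta_mx 0 k)).
have c0 : c 0 = p by rewrite /c scale0r addr0 -graph_pointE -(height0_insert hp).
have dg : differentiable gamma (y + 0 *: delta_mx 0 k).
  by rewrite scale0r addr0; apply: C1at_diff; exact: smooth_C1at.
have dgc : is_derive (0 : R) 1 (fun t : R => gamma (y + t *: delta_mx 0 k)) (partial k gamma y).
  have := is_derive_curve (is_derive_line y (delta_mx 0 k) (0 : R)) dg.
  by rewrite scale0r addr0 dotvC dotv_delta mxE.
have dyc (l : 'I_n) : is_derive (0 : R) 1 (fun t : R => (y + t *: delta_mx 0 k) 0 l)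
    ((delta_mx 0 k : W) 0 l).
  have := is_derive_curve (is_derive_line y (delta_mx 0 k) (0 : R)) (differentiable_proj l _).
  by rewrite -derive_gradient ?derive_proj//; exact: differentiable_proj.
have cE a b : (fun t => c t a b) = if unlift i b is Some l then
    (fun t : R => (y + t *: delta_mx 0 k) 0 l)
    else (fun t : R => gamma (y + t *: delta_mx 0 k)).
  by apply/funext => t; rewrite /c mxE; case: unlift.
have dc : derivable c 0 1.
  apply/derivable_mxP => a b; rewrite cE; case: unlift => [l|].
    by case: (dyc l).
  by case: dgc.
exists c; split=> //.
  have cn := curve_near dc r0; rewrite c0 in cn.
  apply: filterS cn => t ct; have [_ _ E] := H _ ct; apply/E.
  by rewrite /c -graph_pointE height_graph.
rewrite (derive_mx dc); apply/rowP => b; rewrite !mxE cE; case: unlift => [l|].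
  by case: (dyc l) => _ ->; rewrite mxE.
by case: dgc.
Qed.

(** The curves drawn on the graph force a normal to be a multiple of the gradient
    of the height; unit length and the side it points to fix the multiple. *)
Lemma outward_normal_chart (U : set V) p i s gamma r : chart U p i s gamma r ->
  boundary U p ->
  outward_normal U p = (enorm (graph_normal i s gamma (col' i p)))^-1 *:
    graph_normal i s gamma (col' i p).
Proof.
move=> ch bp; set N := graph_normal i s gamma (col' i p).
have eN : 0 < enorm N by exact: enorm_graph_normal_gt0.
have NN : 0 < dotv N N by rewrite -enormK exprn_gt0.
have cross a : 0 < a -> exists2 t0 : R, 0 < t0 & forall t, 0 < t < t0 ->
    U (p - t *: (a *: N)) /\ (~` closure U) (p + t *: (a *: N)).
  by move=> a0; apply: chart_crosses ch bp _; rewrite dotvZl mulr_gt0.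
have enormZ a : enorm (a *: N) = `|a| * enorm N.
  by rewrite /enorm dotvZl dotvZr mulrA -expr2 sqrtrM ?sqr_ge0// sqrtr_sqr.
(* The normal is defined by choice: it remains to show that one exists and is unique. *)
have ex : is_outward_normal U p ((enorm N)^-1 *: N).
  have [|t0 t00 H] := cross (enorm N)^-1; first by rewrite invr_gt0.
  split.
  - by rewrite enormZ ger0_norm ?invr_ge0 ?ltW// mulVf// gt_eqF.
  - by move=> w tw; rewrite dotvZl (chart_tangent ch bp tw) mulr0.
  - by apply/near_right0P; exists t0 => // t /H[].
  - by apply/near_right0P; exists t0 => // t /H[].
have [v1 vT /near_right0P[ti ti0 vi] /near_right0P[to to0 vo]] : is_outward_normal U p (outward_normal U p).
  by apply: (getPex (P := is_outward_normal U p)); exists ((enorm N)^-1 *: N).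
set v := outward_normal U p in v1 vT vi vo *.
have vN : v = (v 0 i * (-1) ^+ s) *: N.
  rewrite /N /graph_normal scalerA -mulrA -signr_addb addbb mulr1.
  apply: (@rowP_lift i) => [|k]; rewrite mxE ?insert_at ?mulr1// insert_lift.
  have := vT _ (graph_point_tangent k ch bp).
  rewrite (dotv_lift i) insert_at insertK dotv_delta col'E => /eqP.
  by rewrite addrC addr_eq0 => /eqP ->; rewrite !mxE mulrN.
move: (v 0 i * _) vN => a vN; rewrite vN in v1 vi vo *.
have a1 : `|a| = (enorm N)^-1.
  by move: v1; rewrite enormZ => /(canRL (mulfK (lt0r_neq0 eN))); rewrite mul1r.
have [a0|a0|a0] := ltgtP 0 a.
- by rewrite -a1 gtr0_norm.
- have [|t0 t00 H] := cross (- a); first by rewrite oppr_gt0.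
  have [t [t1 t2 t3]] := exists_lt_two t00 ti0.
  have /H[_ nU] : 0 < t < t0 by rewrite t1.
  have /vi Ut : 0 < t < ti by rewrite t1.
  by case: nU; rewrite scaleNr scalerN; exact: subset_closure.
- by move: v1; rewrite enormZ -a0 normr0 mul0r => /esym/eqP; rewrite oner_eq0.
Qed.

End Charts.

(** * Measurability and Fubini in an arbitrary coordinate *)

Section Measurability.
Context {R : realType}.
Local Notation mR := (measurableTypeR R).
Implicit Types n : nat.

Definition tuple_of_row n (z : 'rV[R]_n) : n.-tuple mR := [tuple z 0 j | j < n].

Lemma tnth_row n (z : 'rV[R]_n) j : tnth (tuple_of_row z) j = z 0 j.
Proof. by rewrite tnth_mktuple. Qed.

Lemma row_of_tupleE n (t : n.-tuple mR) j : row_of_tuple t 0 j = tnth t j.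
Proof. by rewrite mxE. Qed.

Lemma tuple_of_rowK n : cancel (@tuple_of_row n) (@row_of_tuple R n).
Proof. by move=> z; apply/rowP => j; rewrite row_of_tupleE tnth_row. Qed.

Lemma measurable_box n (c : 'rV[R]_n) (r : R) :
  measurable (@row_of_tuple R n @^-1` [set z | forall i, `|z 0 i - c 0 i| < r]).
Proof.
rewrite (_ : _ @^-1` _ = \bigcap_(i in [set: 'I_n]) ((fun t : n.-tuple mR => tnth t i) @^-1`
    `]c 0 i - r, c 0 i + r[%classic)).
  apply: fin_bigcap_measurable => [|i _]; first exact: finite_finset.
  rewrite -[X in measurable X]setTI.
  by apply: measurable_tnth => //; exact: measurable_itv.
apply/seteqP; split => t /= H i.
  by move=> _ /=; have := H i; rewrite row_of_tupleE in_itv/= ltr_distl.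
by have := H i I; rewrite /= in_itv/= row_of_tupleE ltr_distl.
Qed.

(** Open sets are countable unions of boxes with rational centres. *)
Lemma measurable_open n (U : set 'rV[R]_n) : open U -> measurable (@row_of_tuple R n @^-1` U).
Proof.
move=> oU.
pose box (p : 'rV[rat]_n * nat) : set 'rV[R]_n :=
  [set z | forall i, `|z 0 i - (map_mx ratr p.1 : 'rV[R]_n) 0 i| < p.2.+1%:R^-1].
pose F p := if `[< box p `<=` U >] then @row_of_tuple R n @^-1` box p else set0.
rewrite (_ : _ @^-1` U = \bigcup_p F p).
  apply: countable_bigcupT_measurable; first exact: countableP.
  by move=> p; rewrite /F; case: asboolP => _ //; exact: measurable_box.
apply/seteqP; split => [t /= Ut|t [p _]]; last first.
  by rewrite /F; case: asboolP => // pU /pU.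
have /near_normP[r r0 H] : nbhs (row_of_tuple t) U by exact: open_nbhs_nbhs.
have [k kr] : exists k : nat, (k.+1%:R^-1 : R) < r / 2.
  have [k _ Hk] := near_infty_natSinv_lt (PosNum (divr_gt0 r0 (ltr0Sn R 1))).
  by exists k; apply: (Hk k) => /=.
have k0 : 0 < k.+1%:R^-1 :> R by rewrite invr_gt0.
have /choice[q Hq] : forall i : 'I_n, exists q : rat, `|row_of_tuple t 0 i - ratr q| < k.+1%:R^-1.
  move=> i; set x := row_of_tuple t 0 i.
  have [q] := @rat_in_itvoo R (x - k.+1%:R^-1) (x + k.+1%:R^-1) ltac:(by rewrite ltrBlDr -addrA ltrDl addr_gt0).
  by rewrite in_itv/= => qx; exists q; rewrite distrC ltr_distl.
have bt : box (\row_i q i, k) (row_of_tuple t).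
  by move=> i; rewrite !mxE -row_of_tupleE; exact: Hq.
exists (\row_i q i, k) => //; rewrite /F; case: asboolP => // -[] z zb; apply: H.
apply: le_lt_trans (_ : k.+1%:R^-1 + k.+1%:R^-1 < r); last by rewrite [ltRHS]splitr ltrD.
apply/norm_leP => [|i]; first by rewrite addr_ge0// ltW.
have := zb i; have := bt i; rewrite /= => B1 B2; rewrite !mxE -row_of_tupleE.
apply: le_trans (ler_distD (map_mx ratr (\row_i q i) 0 i) _ _) _.
by rewrite lerD// ltW// distrC.
Qed.

Lemma measurable_cont n (f : 'rV[R]_n -> R) : (forall z, {for z, continuous f}) ->
  measurable_fun [set: n.-tuple mR] (f \o @row_of_tuple R n).
Proof.
move=> cf; apply: (measurability _ (RGenOpens.measurableE R)) => //.
move=> _ [_ [a [b ->] <-]]; rewrite setTI comp_preimage; apply: measurable_open.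
have /continuousP : continuous f by [].
by apply; exact: interval_open.
Qed.

Lemma measurable_tuple_of_row_comp d (T : measurableType d) n (h : T -> 'rV[R]_n) :
  (forall i, measurable_fun [set: T] (fun x => h x 0 i : mR)) ->
  measurable_fun [set: T] (fun x => tuple_of_row (h x)).
Proof.
move=> mh; apply/measurable_fun_tnthP => i.
rewrite (_ : _ \o _ = fun x => h x 0 i); first exact: mh.
by apply/funext => x /=; rewrite tnth_row.
Qed.

Lemma measurable_coord n i : measurable_fun [set: n.-tuple mR] (fun t => row_of_tuple t 0 i : mR).
Proof.
rewrite (_ : (fun _ => _) = (fun t => tnth t i)); first exact: measurable_tnth.
by apply/funext => t; rewrite row_of_tupleE.
Qed.

Definition insert_tuple n (i : 'I_n.+1) (p : mR * n.-tuple mR) : n.+1.-tuple mR :=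
  tuple_of_row (insert i (row_of_tuple p.2) p.1).

Lemma measurable_insert_tuple n (i : 'I_n.+1) :
  measurable_fun [set: mR * n.-tuple mR] (insert_tuple i).
Proof.
apply: measurable_tuple_of_row_comp => j; case: (unliftP i j) => [k ->|->].
  rewrite (_ : (fun _ => _) = (fun t => row_of_tuple t 0 k) \o snd); last first.
    by apply/funext => p; rewrite insert_lift.
  apply: measurableT_comp; last exact: measurable_snd.
  exact: measurable_coord.
rewrite (_ : (fun _ => _) = fst); first exact: measurable_fst.
by apply/funext => p; rewrite insert_at.
Qed.

Lemma row_insert_tuple n (i : 'I_n.+1) p :
  row_of_tuple (insert_tuple i p) = insert i (row_of_tuple p.2) p.1.
Proof. exact: tuple_of_rowK. Qed.

Lemma insert_tuple0 n : @insert_tuple n ord0 = @tuple_cons R n.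
Proof.
apply/funext => -[a t]; apply: eq_from_tnth => j; rewrite tnth_row.
case: (unliftP ord0 j) => [k ->|->]; first by rewrite insert_lift row_of_tupleE tnthS.
by rewrite insert_at tnth0.
Qed.

Lemma insert_tuple_lift n (i : 'I_n.+1) (a t : mR) (y : n.-tuple mR) :
  insert_tuple (lift ord0 i) (t, tuple_cons (a, y)) = tuple_cons (a, insert_tuple i (t, y)).
Proof.
apply: eq_from_tnth => j; rewrite tnth_row /=.
case: (unliftP ord0 j) => [j' ->|->].
  rewrite tnthS tnth_row /=; case: (unliftP i j') => [k ->|->]; last by rewrite !insert_at.
  have -> : lift ord0 (lift i k) = lift (lift ord0 i) (lift ord0 k).
    by apply: val_inj; rewrite /= /bump !leq0n !add1n ltnS addnS.
  by rewrite !insert_lift !row_of_tupleE tnthS.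
have -> : ord0 = lift (lift ord0 i) ord0 :> 'I_n.+2 by exact: val_inj.
by rewrite insert_lift row_of_tupleE !tnth0.
Qed.

Local Open Scope ereal_scope.

Lemma lebesgue_tupleS n (F : n.+1.-tuple mR -> \bar R) :
  @measurable_fun _ _ (n.+1.-tuple mR) (\bar R) setT F -> (forall t, 0 <= F t) ->
  \int[lebesgue_tuple R n.+1]_t F t =
  \int[(@lebesgue_measure R \x lebesgue_tuple R n)]_p F (tuple_cons p).
Proof.
move=> mF F0.
have mc := @measurable_tuple_cons R n.
rewrite -(@ge0_integral_pushforward _ _ _ _ R _ mc (lebesgue_measure \x lebesgue_tuple R n)
  setT)//.
Qed.

(** Fubini with an arbitrary coordinate singled out, by exchanging it with the
    first coordinate of the product. *)
Lemma ge0_integral_insert n (i : 'I_n.+1) (F : n.+1.-tuple mR -> \bar R) :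
  @measurable_fun _ _ (n.+1.-tuple mR) (\bar R) setT F -> (forall t, 0 <= F t) ->
  \int[lebesgue_tuple R n.+1]_t F t =
  \int[(@lebesgue_measure R \x lebesgue_tuple R n)]_p F (insert_tuple i p).
Proof.
elim: n i F => [|n IH] i F mF F0.
  by rewrite (ord1 i) lebesgue_tupleS// insert_tuple0.
case: (unliftP ord0 i) => [j ->|->]; last by rewrite lebesgue_tupleS// insert_tuple0.
have mFc : @measurable_fun _ _ (mR * n.+1.-tuple mR)%type (\bar R) setT (F \o @tuple_cons R n.+1).
  exact: measurableT_comp mF (@measurable_tuple_cons R n.+1).
have mFi : @measurable_fun _ _ (mR * n.+1.-tuple mR)%type (\bar R) setT (F \o insert_tuple (lift ord0 j)).
  exact: measurableT_comp mF (measurable_insert_tuple _).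
rewrite lebesgue_tupleS// (fubini_tonelli1 (F \o @tuple_cons R n.+1))//; last by move=> ?; exact: F0.
rewrite (fubini_tonelli1 _ mFi (fun _ => F0 _)).
rewrite /fubini_F.
pose H (p : (mR * mR) * n.-tuple mR) := F (tuple_cons (p.1.1, insert_tuple j (p.1.2, p.2))).
have mH : @measurable_fun _ _ ((mR * mR) * n.-tuple mR)%type (\bar R) setT H.
  apply: (measurableT_comp mF); apply: (measurableT_comp (@measurable_tuple_cons R n.+1)).
  apply: measurable_fun_pair; first exact: measurableT_comp measurable_fst measurable_fst.
  apply: (measurableT_comp (measurable_insert_tuple j)); apply: measurable_fun_pair => //.
  exact: measurableT_comp measurable_snd measurable_fst.
have H0 p : 0 <= H p by exact: F0.
have mG := @measurable_fun_fubini_tonelli_F _ _ _ _ R (lebesgue_tuple R n) H mH H0.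
set G := fubini_F _ _ in mG.
have G0 q : 0 <= G q by apply: integral_ge0.
transitivity (\int[@lebesgue_measure R]_a \int[@lebesgue_measure R]_t G (a, t)).
  apply: eq_integral => a _.
  rewrite (IH j (fun w => F (tuple_cons (a, w)))) //; last first.
    exact: measurableT_comp mFc (pair1_measurable a).
  rewrite (fubini_tonelli1 (fun p => F (tuple_cons (a, insert_tuple j p))))//.
  apply: (measurableT_comp mFc); apply: (measurableT_comp (pair1_measurable a)).
  exact: measurable_insert_tuple.
rewrite (fubini_tonelli G)//; apply: eq_integral => t _.
rewrite (lebesgue_tupleS (F := fun w => F (insert_tuple (lift ord0 j) (t, w)))) //; last first.
  exact: measurableT_comp mFi (pair1_measurable t).
have mFt : @measurable_fun _ _ (mR * n.-tuple mR)%type (\bar R) setT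
    (fun p => F (insert_tuple (lift ord0 j) (t, tuple_cons p))).
  apply: (measurableT_comp mFi); apply: (measurableT_comp (pair1_measurable t)).
  exact: measurable_tuple_cons.
rewrite (fubini_tonelli1 _ mFt (fun _ => F0 _)).
apply: eq_integral => a _; apply: eq_integral => y _.
by rewrite /= insert_tuple_lift.
Qed.

End Measurability.

(** * Integrals of bounded functions with bounded support *)

Section Admissible.
Context {R : realType}.
Local Notation mR := (measurableTypeR R).
Implicit Types n : nat.

(** Measurability is tested on tuples, where the product measure lives. *)
Definition measurable_row n (F : 'rV[R]_n -> R) :=
  measurable_fun [set: n.-tuple mR] (F \o @row_of_tuple R n).

(** One constant bounds both the values and the support, so that a single number controls
    domination in limits and in slices. *)
Definition vanishes_beyond n (F : 'rV[R]_n -> R) (M : R) :=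
  (forall z, `|F z| <= M) /\ (forall z, M < `|z| -> F z = 0).

(** A class without integrability side conditions that is stable under sums, products
    with locally bounded functions, and integration of one coordinate. *)
Definition admissible n (F : 'rV[R]_n -> R) :=
  measurable_row F /\ exists M, vanishes_beyond F M.

Definition integral_row n (F : 'rV[R]_n -> R) : R :=
  \int[lebesgue_tuple R n]_t F (row_of_tuple t).

Lemma norm_cons n (t : n.+1.-tuple mR) (M : R) : 0 <= M ->
  (`|row_of_tuple t| <= M) = (`|thead t : R| <= M) && (`|row_of_tuple [tuple of behead t]| <= M).
Proof.
move=> M0; apply/norm_leP/andP => //.
  move=> H; split; first by have := H ord0; rewrite row_of_tupleE.
  apply/norm_leP => // i; have := H (lift ord0 i); rewrite !row_of_tupleE.
  by rewrite [in X in X -> _](tuple_eta t) tnthS.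
move=> [h /norm_leP H] i; case: (unliftP ord0 i) => [j ->|->]; last by rewrite row_of_tupleE.
by have := H M0 j; rewrite !row_of_tupleE [in X in _ -> X](tuple_eta t) tnthS.
Qed.

Lemma measurable_norm_le n (M : R) :
  measurable (@row_of_tuple R n @^-1` [set z | `|z| <= M]).
Proof.
have -> : [set z : 'rV[R]_n | `|z| <= M] = ~` [set z | M < `|z|].
  by apply/seteqP; split => z /=; rewrite leNgt => /negP.
have mo : open [set z : 'rV[R]_n | M < `|z|].
  apply: (@open_comp _ _ (@Num.norm R 'rV[R]_n) [set x | M < x]).
    by move=> z _; exact: norm_continuous.
  exact: open_gt.
rewrite preimage_setC; apply: measurableC; exact: (measurable_open mo).
Qed.

Lemma finite_box n (M : R) :
  (lebesgue_tuple R n (@row_of_tuple R n @^-1` [set z | (`|z| <= M)%R]) < +oo)%E.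
Proof.
have [M0|M0] := ltP M 0.
  rewrite (_ : _ @^-1` _ = set0) ?measure0//.
  by apply/seteqP; split => // t /= /(le_trans (normr_ge0 _)); rewrite leNgt M0.
elim: n => [|n IH].
  by rewrite /= diracE; case: (_ \in _); rewrite ltry.
rewrite [X in (X < _)%E](_ : _ = (@lebesgue_measure R \x lebesgue_tuple R n)%E
   (`[(- M)%R, M] `*` (@row_of_tuple R n @^-1` [set z | (`|z| <= M)%R]))); last first.
  rewrite /= /lebesgue_step /pushforward; congr (_ _).
  apply/seteqP; split => -[a t] /=; rewrite norm_cons// in_itv/= -ler_norml.
    by move=> /andP[h1 h2]; split => //; rewrite (_ : t = [tuple of behead [tuple of a :: t]])//; exact: val_inj.
  move=> [h1 h2]; apply/andP; split => //.
  by rewrite (_ : [tuple of behead [tuple of a :: t]] = t)//; exact: val_inj.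
rewrite product_measure1E//; last exact: measurable_norm_le.
have fL : lebesgue_measure (`[(- M)%R, M]%classic : set R) \is a fin_num.
  by rewrite lebesgue_measure_itv/=; case: ifP => _; rewrite -?EFinD.
by apply: lte_mul_pinfty; [exact: measure_ge0|exact: fL|exact: IH].
Qed.

Lemma bounded_support_integrable d (T : measurableType d)
    (mu : {measure set T -> \bar R}) (A : set T) (f : T -> R) (M : R) :
  measurable A -> (mu A < +oo)%E -> measurable_fun [set: T] f ->
  (forall x, `|f x| <= M) -> (forall x, ~ A x -> f x = 0) ->
  mu.-integrable setT (EFin \o f).
Proof.
move=> mA fA mf fM f0.
have : mu.-integrable A (EFin \o f).
  apply: measurable_bounded_integrable => //; first exact: measurable_funTS.
  exists M; split; first exact: num_real.
  by move=> x Mx t _ /=; apply: le_trans (fM _) _; exact: ltW.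
move/(integrable_mkcond _ mA); congr (_.-integrable _ _); apply/funext => t.
by rewrite /patch; case: ifPn => //; rewrite notin_setE /= => tA; rewrite f0.
Qed.

Lemma admissible_integrable n (F : 'rV[R]_n -> R) : admissible F ->
  (lebesgue_tuple R n).-integrable setT (EFin \o (F \o @row_of_tuple R n)).
Proof.
move=> [mF [M [FM F0]]].
apply: (bounded_support_integrable (@measurable_norm_le n M) (finite_box n M) mF (M := M)).
  by move=> t; exact: FM.
by move=> t /= tA; apply: F0; rewrite ltNge; apply/negP.
Qed.

Lemma locally_bounded_cont n (f : 'rV[R]_n -> R) (M : R) :
  (forall z, {for z, continuous f}) -> exists B, forall z, `|z| <= M -> `|f z| <= B.
Proof.
move=> cf; have [M0|M0] := ltP M 0.
  by exists 0 => z /(le_trans (normr_ge0 _)); rewrite leNgt M0.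
have := @EVT_max_rV R n (fun z => `|f z|) [set z | `|z - 0| <= M] _ (@compact_norm_ball _ _ 0 M) _.
case.
- by exists 0; rewrite /= subr0 normr0.
- apply: continuous_subspaceT => z; apply: (@continuous_comp _ _ _ f Num.norm) => //.
  exact: norm_continuous.
- move=> c _ H; exists `|f c| => z zM; apply: (H z).
  by rewrite inE/= subr0.
Qed.

Section Closure.
Variable n : nat.
Implicit Types (F G : 'rV[R]_n -> R).

Lemma measurable_rowM F G : measurable_row F -> measurable_row G ->
  measurable_row (fun z => F z * G z).
Proof. exact: measurable_funM. Qed.

Lemma measurable_rowD F G : measurable_row F -> measurable_row G ->
  measurable_row (fun z => F z + G z).
Proof. exact: measurable_funD. Qed.

Lemma measurable_row_cont F : (forall z, {for z, continuous F}) -> measurable_row F.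
Proof. exact: measurable_cont. Qed.

Lemma measurable_row_open (U : set 'rV[R]_n) : open U -> measurable_row (\1_U : _ -> R).
Proof.
move=> oU; have := @measurable_indic _ _ R setT _ (measurable_open oU).
apply: eq_measurable_fun => t _ /=.
by rewrite /row_of_tuple !indicE; congr (_ %:R); apply/idP/idP; rewrite !inE.
Qed.

Definition locally_bounded F := forall M, exists B, forall z, `|z| <= M -> `|F z| <= B.

Lemma admissibleM F G : admissible F -> measurable_row G -> locally_bounded G ->
  admissible (fun z => F z * G z).
Proof.
move=> [mF [M [FM F0]]] mG /(_ M)[B GB]; split; first exact: measurable_rowM.
exists (Num.max M (M * B)); split=> z; last first.
  by rewrite gt_max => /andP[/F0 -> _]; rewrite mul0r.
rewrite le_max; apply/orP; right.
have [zM|zM] := leP `|z| M; last first.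
  rewrite F0// mul0r normr0.
  have M0 := le_trans (normr_ge0 _) (FM z).
  have [B0|B0] := leP 0 B; first exact: mulr_ge0.
  have := GB 0; rewrite normr0 => /(_ M0)/(le_trans (normr_ge0 _)) Bge0.
  by rewrite ltNge Bge0 in B0.
by rewrite normrM ler_pM// GB.
Qed.

Lemma admissibleD F G : admissible F -> admissible G -> admissible (fun z => F z + G z).
Proof.
move=> [mF [M [FM F0]]] [mG [N [GN G0]]]; split; first exact: measurable_rowD.
have M0 := le_trans (normr_ge0 _) (FM 0); have N0 := le_trans (normr_ge0 _) (GN 0).
exists (M + N); split=> z; first by apply: le_trans (ler_normD _ _) (lerD _ _).
move=> zMN; rewrite F0 ?G0 ?addr0//; apply: le_lt_trans zMN; lra.
Qed.

Lemma admissible0 : admissible (fun _ : 'rV[R]_n => 0).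
Proof. by split; [exact: measurable_cst|exists 0; split=> z; rewrite ?normr0]. Qed.

Lemma admissible_sum (I : Type) (r : seq I) (F : I -> 'rV[R]_n -> R) :
  (forall k, admissible (F k)) -> admissible (fun z => \sum_(k <- r) F k z).
Proof.
move=> aF; elim: r => [|k r IH].
  rewrite (_ : (fun _ => _) = fun=> 0); first exact: admissible0.
  by apply/funext => z; rewrite big_nil.
rewrite (_ : (fun _ => _) = fun z => F k z + \sum_(j <- r) F j z).
  exact: admissibleD.
by apply/funext => z; rewrite big_cons.
Qed.

Lemma admissible_cont F : (forall z, {for z, continuous F}) ->
  (exists M, forall z, M < `|z| -> F z = 0) -> admissible F.
Proof.
move=> cF [M F0]; split; first exact: measurable_row_cont.
have [B FB] := locally_bounded_cont M cF.
exists (Num.max M (Num.max 0 B)); split=> z; last by rewrite gt_max => /andP[/F0].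
rewrite !le_max; have [zM|zM] := leP `|z| M; first by rewrite FB ?orbT.
by rewrite F0// normr0 lexx orbT.
Qed.

Lemma integral_rowD F G : admissible F -> admissible G ->
  integral_row (fun z => F z + G z) = integral_row F + integral_row G.
Proof.
by move=> aF aG; apply: RintegralD => //; exact: admissible_integrable.
Qed.

Lemma integral_rowZ (c : R) F : admissible F ->
  integral_row (fun z => c * F z) = c * integral_row F.
Proof. by move=> aF; apply: RintegralZl => //; exact: admissible_integrable. Qed.

Lemma eq_integral_row F G : F =1 G -> integral_row F = integral_row G.
Proof. by move=> /funext ->. Qed.

Lemma integral_row0 : integral_row (fun _ : 'rV[R]_n => 0) = 0.
Proof. by rewrite /integral_row /Rintegral integral0. Qed.

Lemma integral_row_sum (I : Type) (r : seq I) (F : I -> 'rV[R]_n -> R) :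
  (forall k, admissible (F k)) ->
  integral_row (fun z => \sum_(k <- r) F k z) = \sum_(k <- r) integral_row (F k).
Proof.
move=> aF; elim: r => [|k r IH].
  by rewrite big_nil -[RHS]integral_row0; apply: eq_integral_row => z; rewrite big_nil.
rewrite big_cons -IH -integral_rowD//; last exact: admissible_sum.
by apply: eq_integral_row => z; rewrite big_cons.
Qed.

(** Dominated convergence; a common bound on values and supports provides the
    dominating function. *)
Lemma integral_row_cvg (F_ : nat -> 'rV[R]_n -> R) F (M : R) :
  (forall k, measurable_row (F_ k)) -> (forall k, vanishes_beyond (F_ k) M) ->
  (forall z, F_ k z @[k --> \oo] --> F z) ->
  integral_row (F_ k) @[k --> \oo] --> integral_row F.
Proof.
move=> mF FM cF.
pose A := @row_of_tuple R n @^-1` [set z | `|z| <= M].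
have mA : measurable A := @measurable_norm_le n M.
have aF k : admissible (F_ k) by split; [exact: mF|exists M].
have M0 : 0 <= M by have [+ _] := FM 0%N; move=> /(_ 0); apply: le_trans.
have Fb z : `|F z| <= M.
  rewrite leNgt; apply/negP => MF.
  have e0 : 0 < `|F z| - M by rewrite subr_gt0.
  have /cvgrPdist_lt/(_ _ e0)[k _ /(_ k (leqnn k)) /= H] := cF z.
  have [/(_ z) Fk _] := FM k; have := ler_normD (F z - F_ k z) (F_ k z).
  by rewrite subrK; lra.
have F0 z : M < `|z| -> F z = 0.
  move=> Mz; have cz := cF z; apply/eqP/negPn/negP => Fz0.
  have e0 : 0 < `|F z| by rewrite normr_gt0.
  have /cvgrPdist_lt/(_ _ e0)[k _ /(_ k (leqnn k)) /= H] := cz.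
  by move: H; have [_ ->//] := FM k; rewrite subr0 ltxx.
have iA : (lebesgue_tuple R n).-integrable setT (EFin \o (fun t => M * \1_A t)).
  apply: (bounded_support_integrable mA (finite_box n M) (M := M)).
  - by apply: measurable_funM; [exact: measurable_cst|exact: measurable_indic].
  - move=> t; rewrite normrM ger0_norm// ler_piMr//.
    by rewrite indicE ger0_norm ?ler0n// lern1 leq_b1.
  - by move=> t tA; rewrite indicE memNset// mulr0.
have mF' k : @measurable_fun _ _ (n.-tuple mR) (\bar R) setT (fun t => (F_ k (row_of_tuple t))%:E).
  by apply/measurable_EFinP; exact: mF.
have H : (\int[lebesgue_tuple R n]_t (F_ k (row_of_tuple t))%:E @[k --> \oo] -->
    \int[lebesgue_tuple R n]_t (F (row_of_tuple t))%:E)%E.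
  apply: (dominated_cvg measurableT mF' _ _ iA).
  - by move=> t _; apply/cvg_EFin; [exact: nearW|exact: cF].
  - by [].
  - move=> k t _ /=; rewrite lee_fin; have [Fk1 Fk2] := FM k.
    rewrite indicE; have [/set_mem tA|/negP tA] := boolP (t \in A); first by rewrite mulr1.
    by rewrite mulr0 Fk2 ?normr0// ltNge; apply/negP => h; apply: tA; exact: mem_set.
apply: fine_cvg; rewrite fineK//; apply: integrable_fin_num => //.
apply: (bounded_support_integrable mA (finite_box n M) (M := M)).
- apply: (@measurable_fun_cvg _ _ R setT (fun k => F_ k \o @row_of_tuple R n)) => // t _.
  exact: cF.
- by move=> t.
- by move=> t tA; apply: F0; rewrite ltNge; apply/negP.
Qed.

End Closure.

Definition line_vanishes (f : R -> R) (M : R) :=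
  (forall t, `|f t| <= M) /\ (forall t, M < `|t| -> f t = 0).

Definition line_integral (f : R -> R) : R := \int[@lebesgue_measure R]_t (f t).

Lemma line_integrable (f : R -> R) M : measurable_fun [set: mR] f -> line_vanishes f M ->
  (@lebesgue_measure R).-integrable setT (EFin \o f).
Proof.
move=> mf [fM f0].
apply: (@bounded_support_integrable _ mR lebesgue_measure `[- M, M] f M) => //.
- have fL : (lebesgue_measure (`[(- M)%R, M]%classic : set R) < +oo)%E.
    by rewrite lebesgue_measure_itv/=; case: ifP => _; rewrite -?EFinD ltry.
  exact: fL.
- by move=> t /= tM; apply: f0; rewrite ltNge ler_norml; apply/negP => h; apply: tM; rewrite in_itv.
Qed.

Lemma measurable_insert_comp n (i : 'I_n.+1) (F : 'rV[R]_n.+1 -> R) : measurable_row F ->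
  measurable_fun [set: mR * n.-tuple mR] (fun p => F (insert i (row_of_tuple p.2) p.1)).
Proof.
move=> mF; have := measurableT_comp mF (measurable_insert_tuple i).
by apply: eq_measurable_fun => p _ /=; rewrite row_insert_tuple.
Qed.

Lemma measurable_slice n (i : 'I_n.+1) (F : 'rV[R]_n.+1 -> R) (y : n.-tuple mR) :
  measurable_row F -> measurable_fun [set: mR] (fun t => F (insert i (row_of_tuple y) t)).
Proof.
move=> mF; exact: measurableT_comp (measurable_insert_comp i mF) (pair2_measurable y).
Qed.

Lemma norm_le_insert n (i : 'I_n.+1) (y : 'rV[R]_n) (t : R) :
  `|t| <= `|insert i y t| /\ `|y| <= `|insert i y t|.
Proof.
split; first by rewrite -{1}(insert_at i y t) coord_le_norm.
by rewrite -{1}(insertK i y t); exact: norm_col'.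
Qed.

Lemma line_vanishes_slice n (i : 'I_n.+1) (F : 'rV[R]_n.+1 -> R) (y : 'rV[R]_n) M :
  vanishes_beyond F M -> line_vanishes (fun t => F (insert i y t)) M.
Proof.
move=> [FM F0]; split=> t //= tM; apply: F0; apply: lt_le_trans tM _.
by have [] := norm_le_insert i y t.
Qed.

Lemma le_line_integral (f : R -> R) M : measurable_fun [set: mR] f -> line_vanishes f M ->
  `|line_integral f| <= M * (2 * M).
Proof.
move=> mf fM; have M0 : 0 <= M by have [+ _] := fM; move=> /(_ 0); apply: le_trans.
apply: le_trans (le_normr_Rintegral measurableT (line_integrable mf fM)) _.
have [fM1 f0] := fM.
rewrite -[leRHS](_ : \int[@lebesgue_measure R]_(t in `[- M, M]) M = _); last first.
  rewrite Rintegral_cst//; congr (_ * _).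
  have fL : fine (lebesgue_measure (`[(- M)%R, M]%classic : set R)) = 2 * M.
    rewrite lebesgue_measure_itv/= lte_fin.
    by case: ltP => MM; rewrite /= ?opprK; lra.
  exact: fL.
rewrite [leRHS]Rintegral_mkcond; apply: le_Rintegral => //.
- have := @line_integrable (fun t => `|f t|) M _ _; apply.
    exact: measurableT_comp mf.
  by split=> t; rewrite ?normr_id//; move=> /f0 ->; rewrite normr0.
- have := @line_integrable ((fun=> M) \_ `[- M, M]) M _ _; apply.
    by apply/measurable_restrict => //; exact: measurable_cst.
  split=> t; rewrite /patch.
    by case: ifP => _; rewrite ?normr0// ger0_norm.
  by rewrite ltNge ler_norml => /negP tM; case: ifPn => //; rewrite inE/= in_itv.
- move=> t _; rewrite /patch; case: ifPn => //.
  rewrite notin_setE/= in_itv/= => /negP; rewrite -ler_norml -ltNge => /f0 ->.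
  by rewrite normr0.
Qed.

(** Fubini with the [i]-th coordinate integrated first. *)
Lemma integral_insert n (i : 'I_n.+1) (F : 'rV[R]_n.+1 -> R) : admissible F ->
  integral_row F = integral_row (fun y => line_integral (fun t => F (insert i y t))) /\
  admissible (fun y => line_integral (fun t => F (insert i y t))).
Proof.
move=> aF; have [mF [M vF]] := aF; have M0 : 0 <= M.
  by have [+ _] := vF; move=> /(_ 0); apply: le_trans.
have mFi := measurable_insert_comp i mF.
pose f (t : n.+1.-tuple mR) : \bar R := (F (row_of_tuple t))%:E.
have mf : @measurable_fun _ _ (n.+1.-tuple mR) (\bar R) setT f by exact/measurable_EFinP.
have iF := admissible_integrable aF.
pose g (p : mR * n.-tuple mR) : \bar R := (F (insert i (row_of_tuple p.2) p.1))%:E.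
have mg : @measurable_fun _ _ (mR * n.-tuple mR)%type (\bar R) setT g by exact/measurable_EFinP.
have gE p : g p = f (insert_tuple i p) by rewrite /f row_insert_tuple.
have ig : ((@lebesgue_measure R \x lebesgue_tuple R n)%E).-integrable setT g.
  apply/integrableP; split => //; have /integrableP[_] := iF.
  rewrite (@ge0_integral_insert _ _ i (fun t => `|f t|%E))//; last exact: measurableT_comp.
  by congr (_ < _)%E; apply: eq_integral => p _; rewrite gE.
have slice y : (fubini_G (@lebesgue_measure R) g y) =
    (line_integral (fun t => F (insert i (row_of_tuple y) t)))%:E.
  rewrite /fubini_G /line_integral /Rintegral fineK//.
  apply: integrable_fin_num => //.
  exact: line_integrable (measurable_slice i y mF) (line_vanishes_slice i _ vF).
split; last first.
  split.
    apply/measurable_EFinP; have := measurable_fubini_G ig.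
    by apply: eq_measurable_fun => y _ /=; rewrite slice.
  exists (Num.max M (M * (2 * M))); split=> y; last first.
    rewrite gt_max => /andP[yM _]; rewrite /line_integral.
    have -> : (fun t => F (insert i y t)) = fun=> 0.
      apply/funext => t; have [_ ->//] := vF; apply: lt_le_trans yM _.
      by have [] := norm_le_insert i y t.
    by rewrite /Rintegral integral0.
  rewrite le_max; apply/orP; right; apply: le_line_integral; last exact: line_vanishes_slice.
  have := measurable_slice i (tuple_of_row y) mF.
  by apply: eq_measurable_fun => t _; rewrite tuple_of_rowK.
rewrite /integral_row /Rintegral; congr fine.
transitivity (\int[(@lebesgue_measure R \x lebesgue_tuple R n)]_p g p)%E.
  rewrite [LHS]integralE [RHS]integralE; congr (_ - _)%E.
    rewrite (@ge0_integral_insert _ _ i (f^\+)%E (measurable_funepos mf))//.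
    by apply: eq_integral => p _; rewrite !funeposE -gE.
  rewrite (@ge0_integral_insert _ _ i (f^\-)%E (measurable_funeneg mf))//.
  by apply: eq_integral => p _; rewrite !funenegE -gE.
rewrite -(integral21_prod_meas1 ig); apply: eq_integral => y _; exact: slice.
Qed.

Lemma line_integral_derive (f df : R -> R) (a b : R) : a < b ->
  (forall t, is_derive t (1 : R) f (df t)) -> continuous df ->
  (forall t, ~~ (a <= t <= b) -> df t = 0) ->
  line_integral df = f b - f a.
Proof.
move=> ab fdf cdf df0.
have cf : continuous f.
  by move=> t; apply/differentiable_continuous/derivable1_diffP; case: (fdf t).
have -> : line_integral df = \int[@lebesgue_measure R]_(t in `[a, b]) df t.
  rewrite Rintegral_mkcond; congr Rintegral; apply/funext => t; rewrite /patch.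
  by case: ifPn => //; rewrite notin_setE/= in_itv/= => /negP/df0.
rewrite /Rintegral (@continuous_FTC2 _ _ f)//.
- exact: continuous_subspaceT.
- split; [by move=> t _; case: (fdf t)| |].
    by apply: cvg_at_right_filter; exact: cf.
  by apply: cvg_at_left_filter; exact: cf.
- by move=> t _; rewrite derive1E; case: (fdf t).
Qed.

End Admissible.

(** * Cutoff functions and integration by parts *)

Section Cutoff.
Context {R : realType}.
Implicit Types s t : R.

Definition pos_part s : R := Num.max s 0.

Lemma pos_part_le s : s <= 0 -> pos_part s = 0.
Proof. by move=> s0; rewrite /pos_part max_r. Qed.

Lemma pos_part_ge s : 0 <= s -> pos_part s = s.
Proof. by move=> s0; rewrite /pos_part max_l. Qed.

Lemma continuous_pos_part : continuous pos_part.
Proof.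
move=> s; apply: (@continuous_max _ _ id (cst 0)) => //.
exact: cst_continuous.
Qed.

Lemma is_derive_quadratic_bound (f : R -> R) s a (K : R) :
  (forall t, `|f t - f s - a * (t - s)| <= K * (t - s) ^+ 2) -> is_derive s 1 f a.
Proof.
move=> H; have K0 : 0 <= K.
  have := H (s + 1); rewrite (_ : s + 1 - s = 1); last by ring.
  by rewrite expr1n !mulr1; apply: le_trans.
have c : h^-1 *: ((f \o shift s) (h *: 1) - f s) @[h --> (0 : R)^'] --> a.
  apply/cvgrPdist_lt => e e0; exists (e / (K + 1)); first by rewrite /= divr_gt0// ltr_wpDl.
  move=> h /=; rewrite sub0r normrN => he h0.
  have := H (h + s); rewrite addrK => Hh.
  have -> : a - h^-1 *: (f (h *: 1 + s) - f s) = - (h^-1 * (f (h + s) - f s - a * h)).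
    by rewrite /GRing.scale/= mulr1; field.
  rewrite normrN normrM normfV mulrC ltr_pdivrMr ?normr_gt0//.
  apply: le_lt_trans Hh _; rewrite -real_normK ?num_real// expr2 mulrA.
  rewrite ltr_pM2r ?normr_gt0//; move: he; rewrite ltr_pdivlMr ?ltr_wpDl// mulrDr mulr1.
  by have := normr_ge0 h; rewrite mulrC; lra.
apply: DeriveDef; first exact: (cvgP _ c).
exact: cvg_lim c.
Qed.

(** The square of the positive part is C^1 with a kink only in the derivative; it is the
    building block of all cutoffs. *)
Lemma is_derive_pos_part2 s : is_derive s 1 (fun t => pos_part t ^+ 2) (2 * pos_part s).
Proof.
apply: (@is_derive_quadratic_bound _ _ _ 1) => t; rewrite mul1r ler_norml.
have tt := sqr_ge0 t; have ss := sqr_ge0 s; have ts := sqr_ge0 (t - s).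
have [t0|t0] := leP t 0; have [s0|s0] := leP s 0.
- by rewrite (pos_part_le t0) (pos_part_le s0); apply/andP; split; nra.
- have := mulr_le0_ge0 t0 (ltW s0).
  by rewrite (pos_part_le t0) (pos_part_ge (ltW s0)) => h; apply/andP; split; nra.
- have := mulr_ge0_le0 (ltW t0) s0.
  by rewrite (pos_part_le s0) (pos_part_ge (ltW t0)) => h; apply/andP; split; nra.
- by rewrite (pos_part_ge (ltW t0)) (pos_part_ge (ltW s0)); apply/andP; split; nra.
Qed.

(** A C^1 step from 0 to 1 over [1, 2]; keeping a margin below 1 makes the cut
    functions vanish near the boundary and not only on it. *)
Definition cutoff s : R :=
  2 * (pos_part (s - 1) ^+ 2 - 2 * pos_part (s - 3 / 2) ^+ 2 + pos_part (s - 2) ^+ 2).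

Definition dcutoff s : R :=
  4 * (pos_part (s - 1) - 2 * pos_part (s - 3 / 2) + pos_part (s - 2)).

Lemma is_derive_cutoff s : is_derive s 1 cutoff (dcutoff s).
Proof.
have H a : is_derive s 1 (fun t => pos_part (t - a) ^+ 2) (2 * pos_part (s - a)).
  have d : is_derive s 1 (fun t : R => t - a) 1.
    have := @is_deriveB _ _ _ id (cst a) s 1 1 0 _ _; rewrite subr0; exact.
  have := @is_derive1_comp R (fun x => pos_part x ^+ 2) (fun t => t - a) s _ _
    (is_derive_pos_part2 (s - a)) d.
  by rewrite mulr1.
have H1 := H 1; have H2 := H (3 / 2); have H3 := H 2.
have Z := @is_deriveZ _ _ _ _ 2 s 1 _ (is_deriveD (is_deriveB H1 (is_deriveZ 2 H2)) H3).
move: Z; rewrite (_ : 2 *: _ = dcutoff s); first exact.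
by rewrite /dcutoff /GRing.scale /=; ring.
Qed.

Lemma continuous_dcutoff : continuous dcutoff.
Proof.
have H a : continuous (fun t => pos_part (t - a)).
  move=> t; apply: (@continuous_comp _ _ _ (fun t => t - a) pos_part).
    by apply: cvgB; [exact: cvg_id|exact: cvg_cst].
  exact: continuous_pos_part.
move=> s; apply: cvgM; first exact: cvg_cst.
apply: cvgD; last exact: H.
by apply: cvgB; [exact: H|apply: cvgM; [exact: cvg_cst|exact: H]].
Qed.

Lemma cutoff_le1 s : s <= 1 -> cutoff s = 0.
Proof. by move=> s1; rewrite /cutoff !pos_part_le; lra. Qed.

Lemma dcutoff_le1 s : s <= 1 -> dcutoff s = 0.
Proof. by move=> s1; rewrite /dcutoff !pos_part_le; lra. Qed.

Lemma cutoff_ge2 s : 2 <= s -> cutoff s = 1.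
Proof. by move=> s1; rewrite /cutoff !pos_part_ge; nra. Qed.

Lemma dcutoff_ge2 s : 2 <= s -> dcutoff s = 0.
Proof. by move=> s1; rewrite /dcutoff !pos_part_ge; lra. Qed.

Lemma cutoff_itv s : 0 <= cutoff s <= 1.
Proof.
rewrite /cutoff /pos_part; case: (leP (s - 1) 0) => s1; case: (leP (s - 3 / 2) 0) => s2;
  case: (leP (s - 2) 0) => s3; apply/andP; split; nra.
Qed.

Lemma dcutoff_itv s : 0 <= dcutoff s <= 2.
Proof.
rewrite /dcutoff /pos_part; case: (leP (s - 1) 0) => s1; case: (leP (s - 3 / 2) 0) => s2;
  case: (leP (s - 2) 0) => s3; apply/andP; split; lra.
Qed.

End Cutoff.

Section Lines.
Context {R : realType}.
Local Notation mR := (measurableTypeR R).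

Lemma cont_line_integrable (f : R -> R) (M : R) : continuous f ->
  (forall t, M < `|t| -> f t = 0) ->
  (@lebesgue_measure R).-integrable setT (EFin \o f).
Proof.
move=> cf f0.
have M1 : - `|M| <= `|M| by rewrite ge0_cp ?normr_ge0.
have ac : continuous (fun t => `|f t|).
  by move=> t; apply: (@continuous_comp _ _ _ f Num.norm); [exact: cf|exact: norm_continuous].
have [c _ Hc] := @EVT_max R (fun t => `|f t|) _ _ M1 (continuous_subspaceT ac).
apply: (@line_integrable R f (Num.max `|M| `|f c|)).
  exact: continuous_measurable_fun.
have f0' t : `|M| < `|t| -> f t = 0 by move=> h; apply: f0; exact: le_lt_trans (ler_norm _) h.
split=> t; last by rewrite gt_max => /andP[/f0'].
rewrite le_max; have [tM|/f0' ->] := leP `|t| `|M|; last by rewrite normr0 normr_ge0.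
by rewrite Hc ?orbT// in_itv/= -ler_norml.
Qed.

(** Averaging against a probability density concentrated where the integrand is
    within [e] of [c] gives [c] up to [e]. *)
Lemma line_average (psi phi : R -> R) (c e M : R) : continuous psi -> continuous phi ->
  (forall t, 0 <= psi t) -> (forall t, M < `|t| -> psi t = 0) -> line_integral psi = 1 ->
  (forall t, psi t != 0 -> `|phi t - c| <= e) ->
  `|line_integral (fun t => psi t * phi t) - c| <= e.
Proof.
move=> cpsi cphi psi0 psiM psi1 phic.
have i1 : (@lebesgue_measure R).-integrable setT (EFin \o psi).
  exact: cont_line_integrable psiM.
have cM (h : R -> R) : continuous h -> continuous (fun t => psi t * h t).
  by move=> ch t; apply: cvgM; [exact: cpsi|exact: ch].
have iM (h : R -> R) : continuous h ->
    (@lebesgue_measure R).-integrable setT (EFin \o (fun t => psi t * h t)).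
  by move=> ch; apply: (@cont_line_integrable _ M); [exact: cM|move=> t /psiM ->; rewrite mul0r].
have cphic : continuous (fun t => phi t - c).
  by move=> t; apply: cvgB; [exact: cphi|exact: cvg_cst].
have lin (a : R) : line_integral (fun t => a * psi t) = a.
  by rewrite -[RHS]mulr1 -psi1; exact: RintegralZl.
have icp (a : R) : (@lebesgue_measure R).-integrable setT (EFin \o (fun t => a * psi t)).
  apply: (@cont_line_integrable _ M); last by move=> t /psiM ->; rewrite mulr0.
  by move=> t; apply: cvgM; [exact: cvg_cst|exact: cpsi].
have -> : line_integral (fun t => psi t * phi t) - c =
    line_integral (fun t => psi t * (phi t - c)).
  rewrite -[X in _ - X]lin; apply: etrans (esym (RintegralB measurableT (iM _ cphi) (icp c))) _.
  by congr Rintegral; apply/funext => t; ring.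
apply: le_trans (le_normr_Rintegral measurableT (iM _ cphic)) _.
rewrite -[leRHS]lin; apply: le_Rintegral => //.
- apply: (@cont_line_integrable _ M); last by move=> t /psiM ->; rewrite mul0r normr0.
  move=> t; apply: (@continuous_comp _ _ _ (fun t => psi t * (phi t - c)) Num.norm).
    exact: cM.
  exact: norm_continuous.
move=> t _; rewrite normrM ger0_norm//.
have [->|p0] := eqVneq (psi t) 0; first by rewrite mul0r mulr0.
by rewrite mulrC ler_wpM2r// phic.
Qed.

End Lines.

Section Layer.
Context {R : realType} {n : nat}.
Local Notation V := 'rV[R]_n.+1.
Local Notation W := 'rV[R]_n.
Implicit Types (i j : 'I_n.+1) (s : bool) (gamma : W -> R) (x z p v : V) (y : W).
Implicit Types (f chi eta q : V -> R) (u : V -> V).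
Local Notation e_ i := (delta_mx 0 i : 'rV[R]_n.+1).

Definition bounded_support f := exists M : R, forall z, M < `|z| -> f z = 0.

Lemma partial_beyond f (M : R) i z : (forall z, M < `|z| -> f z = 0) -> M < `|z| ->
  partial i f z = 0.
Proof.
move=> f0 Mz; rewrite -(partial_cst 0 z i); apply: partial_near.
apply/near_normP; exists (`|z| - M); first by rewrite subr_gt0.
move=> w wz; apply: f0; have := ler_normB w (w - z).
by rewrite opprB addrC subrK; lra.
Qed.

Lemma is_derive_insert i y (t : R) : is_derive t 1 (fun t => insert i y t) (e_ i).
Proof.
have -> : (fun t => insert i y t) = fun t => insert i y 0 + t *: e_ i.
  apply/funext => r; apply: (@rowP_lift _ _ i) => [|k]; rewrite !mxE.
    by rewrite unlift_none !eqxx mulr1 add0r.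
  by rewrite liftK eq_sym (negbTE (neq_lift _ _)) mulr0 addr0.
exact: is_derive_line.
Qed.

Lemma continuous_insert i y : continuous (fun t : R => insert i y t).
Proof.
by move=> t; apply/differentiable_continuous/derivable1_diffP; case: (is_derive_insert i y t).
Qed.

(** Integrating the [i]-th coordinate first leaves the difference of the values of [f] at
    two points beyond its support. *)
Lemma integral_partial f i : (forall z, C1at f z) -> bounded_support f ->
  integral_row (partial i f) = 0 /\ admissible (partial i f).
Proof.
move=> Cf [M f0].
have cpf z : {for z, continuous (partial i f)} by have [_] := Cf z; exact.
have aF : admissible (partial i f).
  by apply: admissible_cont => //; exists M => z; exact: partial_beyond.
split=> //.
have [-> _] := integral_insert i aF.
rewrite -(@integral_row0 R n); apply: eq_integral_row => y.
have f0' (t : R) : `|M| < `|t| -> f (insert i y t) = 0.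
  move=> Mt; apply: f0; apply: le_lt_trans (ler_norm M) _; apply: lt_le_trans Mt _.
  by have [] := norm_le_insert i y t.
have := @line_integral_derive R (fun t => f (insert i y t)) (fun t => partial i f (insert i y t))
  (- (`|M| + 1)) (`|M| + 1).
have Mp : `|M| < `| `|M| + 1|.
  by apply: lt_le_trans (ler_norm _); rewrite ltrDl.
rewrite (f0' _ Mp) (f0' (- _)) ?normrN// subrr.
apply.
- by rewrite gtrN// ltr_wpDl.
- move=> t; have := is_derive_curve (is_derive_insert i y t) (C1at_diff (Cf (insert i y t))).
  by rewrite dotvC dotv_delta mxE.
- move=> t; apply: (@continuous_comp _ _ _ (fun t : R => insert i y t) (partial i f)).
    exact: continuous_insert.
  exact: cpf.
- move=> t; rewrite -ler_norml -ltNge => Mt; apply: (partial_beyond _ f0).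
  apply: le_lt_trans (ler_norm M) _.
  have [+ _] := norm_le_insert i y t; lra.
Qed.

(** The product rule and the vanishing of integrals of partial derivatives; the
    field need only be smooth where the test function lives. *)
Lemma integral_transport (A : set V) eta u q :
  (forall z, C1at eta z) -> bounded_support eta ->
  (forall z, ~ A z -> \forall w \near z, eta w = 0) ->
  (forall z j, A z -> C1at (component u j) z) ->
  (forall z, A z -> divergence u z = q z) ->
  integral_row (fun z => dotv (gradient eta z) (u z) + eta z * q z) = 0.
Proof.
move=> Ceta [M eta0] etaA Cu divq.
pose v j z := eta z * u z 0 j.
have Cv j z : C1at (v j) z.
  have [Az|nAz] := pselect (A z); first exact: C1atM (Ceta z) (Cu z j Az).
  apply: (C1at_near_eq _ (C1at_cst 0 z)).
  by apply: filterS (etaA z nAz) => w w0; rewrite /v w0 mul0r.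
have vM j : bounded_support (v j) by exists M => z /eta0 z0; rewrite /v z0 mul0r.
have Iv j := integral_partial j (Cv j) (vM j).
rewrite -[RHS](_ : \sum_(j < n.+1) integral_row (partial j (v j)) = _); last first.
  by apply: big1 => j _; case: (Iv j).
rewrite -integral_row_sum => [|j]; last by case: (Iv j).
apply: eq_integral_row => z.
have [Az|nAz] := pselect (A z).
  rewrite -divq// /dotv /divergence mulr_sumr -big_split/=; apply: eq_bigr => j _.
  rewrite (@partialM _ _ eta (component u j)); [|exact: C1at_diff|exact/C1at_diff/Cu].
  by rewrite mxE addrC [X in _ + X]mulrC.
have e0 := etaA z nAz.
have ge : gradient eta z = 0.
  by apply/rowP => j; rewrite !mxE (partial_near j e0) partial_cst.
rewrite ge dotv0l (nbhs_singleton e0) mul0r addr0 big1// => j _.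
rewrite -(partial_cst 0 z j); apply: partial_near.
by apply: filterS e0 => w w0; rewrite /v w0 mul0r.
Qed.

Lemma partial_comp_cutoff (k : R) f z i : differentiable f z ->
  partial i (fun w => cutoff (k * f w)) z = dcutoff (k * f z) * (k * partial i f z).
Proof.
move=> df.
rewrite (partial_comp1 (f := fun w => k * f w) _ (is_derive_cutoff (k * f z))).
  by rewrite partialZ.
by apply: differentiable_mul => //; exact: differentiable_cst.
Qed.

Lemma C1at_cutoff (k : R) f z : C1at f z -> C1at (fun w => cutoff (k * f w)) z.
Proof.
move=> Cf; apply: (@C1at_comp1 _ _ cutoff dcutoff (fun w => k * f w)).
- exact: is_derive_cutoff.
- exact: continuous_dcutoff.
- exact: C1atZ.
Qed.

Lemma cont_comp_R (h : R -> R) f z : continuous h -> {for z, continuous f} ->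
  {for z, continuous (fun w => h (f w))}.
Proof. by move=> ch cf; apply: (@continuous_comp _ _ _ f h) => //; exact: ch. Qed.

Lemma contM f g z : {for z, continuous f} -> {for z, continuous g} ->
  {for z, continuous (fun w => f w * g w : R)}.
Proof. by move=> cf cg; apply: (@cvgM _ _ (nbhs z)); [exact: cf|exact: cg]. Qed.

Lemma contD f g z : {for z, continuous f} -> {for z, continuous g} ->
  {for z, continuous (fun w => f w + g w : R)}.
Proof. by move=> cf cg; apply: (@cvgD _ _ _ (nbhs z)); [exact: cf|exact: cg]. Qed.

Lemma cont_cst (c : R) z : {for z, continuous (fun=> c : R)}.
Proof. by move=> A; exact: (@cst_continuous _ _ c z). Qed.

Lemma cont_sum (I : Type) (r : seq I) (F : I -> V -> R) z :
  (forall k, {for z, continuous (F k)}) ->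
  {for z, continuous (fun w => \sum_(k <- r) F k w)}.
Proof.
move=> cF; elim: r => [|k r IH].
  by rewrite (_ : (fun _ => _) = fun=> 0); [exact: cont_cst|apply/funext => w; rewrite big_nil].
rewrite (_ : (fun _ => _) = fun w => F k w + \sum_(j <- r) F j w); first exact: contD.
by apply/funext => w; rewrite big_cons.
Qed.

Lemma cont_graph_normal i s gamma z j : smooth setT gamma ->
  {for z, continuous (fun w => graph_normal i s gamma (col' i w) 0 j)}.
Proof.
move=> sg; have [_ /(_ j) c] : C1at (height i s gamma) z by apply: C1at_height; exact: smooth_C1at.
apply: (@for_cont_near _ _ (fun w => - 1 * partial j (height i s gamma) w)).
  apply: near_all => w; rewrite mulN1r.
  have := gradient_height (i := i) s (C1at_diff (smooth_C1at (col' i w) sg)).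
  by move=> /rowP/(_ j); rewrite !mxE => ->; rewrite opprK.
exact: contM (@cont_cst (- 1) z) c.
Qed.

Lemma admissible_field_div chi u q : (forall z, C1at chi z) -> bounded_support chi ->
  (forall z j, {for z, continuous (component u j)}) ->
  measurable_row q -> locally_bounded q ->
  admissible (fun z => dotv (gradient chi z) (u z) + chi z * q z).
Proof.
move=> Cchi chiM cu mq bq; apply: admissibleD.
  apply: admissible_sum => j; apply: admissible_cont.
    move=> z; apply: contM; last exact: cu.
    apply: (@for_cont_near _ _ (partial j chi)); last by have [_] := Cchi z; exact.
    by apply: near_all => w; rewrite mxE.
  by have [M H] := chiM; exists M => z Mz; rewrite mxE (partial_beyond j H Mz) mul0r.
by apply: admissibleM => //; apply: admissible_cont => // z; exact: C1at_cont.
Qed.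

Lemma sgnr_sqr (s : bool) : (-1) ^+ s * (-1) ^+ s = 1 :> R.
Proof. by rewrite -signr_addb addbb. Qed.

(** The derivative of the cutoff across the graph is a probability density on each line,
    supported within [2 / k] of the graph point. *)
Lemma line_integral_kernel (s : bool) (k : nat) (c : R) :
  let psi t := k.+1%:R * dcutoff (k.+1%:R * ((-1) ^+ s * (c - t))) in
  [/\ continuous psi, forall t, 0 <= psi t,
    forall t, 2 / k.+1%:R < `|t - c| -> psi t = 0 & line_integral psi = 1].
Proof.
move=> psi; set K : R := k.+1%:R in psi *; have K0 : 0 < K by rewrite ltr0n.
have K1 : 1 <= K by rewrite ler1n.
have ss := sgnr_sqr s.
have arg (t : R) : is_derive t (1 : R) (fun t => K * ((-1) ^+ s * (c - t))) (- (K * (-1) ^+ s)).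
  have h : is_derive t (1 : R) (fun t => c - t) (- 1).
    have := @is_deriveB _ _ _ (cst c) id t 1 0 1 _ _; rewrite sub0r; exact.
  have := is_deriveZ K (is_deriveZ ((-1) ^+ s) h).
  by rewrite /GRing.scale /= mulrN mulr1 mulrN; exact.
have carg : continuous (fun t => K * ((-1) ^+ s * (c - t))).
  by move=> t; apply/differentiable_continuous/derivable1_diffP; case: (arg t).
have cpsi : continuous psi.
  move=> t; apply: cvgM; first exact: cvg_cst.
  apply: (@continuous_comp _ _ _ (fun t => K * ((-1) ^+ s * (c - t))) dcutoff); first exact: carg.
  exact: continuous_dcutoff.
have psi0 t : 0 <= psi t.
  by apply: mulr_ge0; [exact: ltW|have /andP[] := dcutoff_itv (K * ((-1) ^+ s * (c - t)))].
have psiS t : 2 / K < `|t - c| -> psi t = 0.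
  rewrite ltr_pdivrMr// mulrC => far; rewrite /psi.
  have e : `|K * ((-1) ^+ s * (c - t))| = K * `|t - c|.
    by rewrite normrM gtr0_norm// normrM normrX normrN1 expr1n mul1r distrC.
  rewrite -e in far; move: far; case: ger0P => _ far.
    by rewrite dcutoff_ge2 ?mulr0// ltW.
  by rewrite dcutoff_le1 ?mulr0//; lra.
split=> //.
pose F t := - (-1) ^+ s * cutoff (K * ((-1) ^+ s * (c - t))).
have dF (t : R) : is_derive t (1 : R) F (psi t).
  have h := @is_derive1_comp R cutoff (fun t => K * ((-1) ^+ s * (c - t))) t _ _
    (is_derive_cutoff _) (arg t).
  have := is_deriveZ (- (-1) ^+ s) h; rewrite /GRing.scale /=.
  have -> : - (-1) ^+ s * (dcutoff (K * ((-1) ^+ s * (c - t))) * - (K * (-1) ^+ s)) = psi t.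
    transitivity (((-1) ^+ s * (-1) ^+ s) * psi t); first by rewrite /psi; ring.
    by rewrite ss mul1r.
  exact.
rewrite (@line_integral_derive R F psi (c - 2) (c + 2))//; first last.
- move=> t tc; apply: psiS; have h2 : 2 / K <= 2 by rewrite ler_pdivrMr// ler_peMr.
  apply: le_lt_trans h2 _; rewrite ltNge ler_norml; apply: contra tc => /andP[h1 h3].
  by apply/andP; split; lra.
- by lra.
rewrite /F; case: (s); rewrite /= ?expr1 ?expr0.
  rewrite (cutoff_ge2 (s := K * (-1 * (c - (c + 2))))); last by nra.
  by rewrite cutoff_le1; [ring|nra].
rewrite (cutoff_ge2 (s := K * (1 * (c - (c - 2))))); last by nra.
by rewrite cutoff_le1; [ring|nra].
Qed.

End Layer.

(** * The flux through a graph as the limit of a boundary layer *)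

Section BoundaryLayer.
Context {R : realType} {n : nat}.
Local Notation V := 'rV[R]_n.+1.
Local Notation W := 'rV[R]_n.
Implicit Types (i j : 'I_n.+1) (s : bool) (gamma : W -> R) (x z p v : V) (y : W).
Implicit Types (f chi eta q : V -> R) (u : V -> V).
Local Notation e_ i := (delta_mx 0 i : 'rV[R]_n.+1).

Definition layer i s gamma (k : nat) z : R := cutoff (k.+1%:R * height i s gamma z).

Lemma layer_itv i s gamma k z : 0 <= layer i s gamma k z <= 1.
Proof. exact: cutoff_itv. Qed.

Lemma C1at_layer i s gamma k z : smooth setT gamma -> C1at (layer i s gamma k) z.
Proof. by move=> sg; apply/C1at_cutoff/C1at_height/smooth_C1at. Qed.

Lemma layer_cvg i s gamma z :
  layer i s gamma k z @[k --> \oo] --> (\1_[set w | 0 < height i s gamma w] z : R).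
Proof.
have [h0|h0] := ltP 0 (height i s gamma z); last first.
  rewrite indicE memNset /=; last by move=> /=; rewrite ltNge h0.
  rewrite (_ : (fun k => layer i s gamma k z) = fun=> 0); first exact: cvg_cst.
  apply/funext => k; rewrite /layer cutoff_le1//; apply: le_trans ler01.
  by rewrite mulr_ge0_le0.
rewrite indicE mem_set//=.
apply: (@cvg_trans _ ((fun=> 1 : R) @ \oo)); last exact: cvg_cst.
apply: near_eq_cvg.
have [k _ Hk] := near_infty_natSinv_lt (PosNum (divr_gt0 h0 (ltr0Sn R 1))).
exists k => // m km; rewrite /layer cutoff_ge2//.
have := Hk m km; rewrite /= => Hm; have m0 : 0 < m.+1%:R :> R by rewrite ltr0n.
move: Hm; rewrite invf_plt ?posrE ?divr_gt0// invf_div => Hm.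
by rewrite -ler_pdivrMr// ltW.
Qed.

(** Testing against functions cut off at distance of order 1/k from the graph,
    the gradient of the cutoff concentrates on the graph and produces the flux
    through it in the limit. *)
Lemma boundary_layer i s gamma chi u q (B : R) : smooth setT gamma ->
  (forall z, C1at chi z) -> bounded_support chi ->
  (forall z j, {for z, continuous (component u j)}) ->
  measurable_row q -> (forall z, `|q z| <= B) ->
  (forall k, integral_row (fun z =>
     dotv (gradient (fun w => layer i s gamma k w * chi w) z) (u z) +
     layer i s gamma k z * chi z * q z) = 0) ->
  integral_row (fun z => \1_[set w | 0 < height i s gamma w] z *
     (dotv (gradient chi z) (u z) + chi z * q z)) =
  integral_row (fun y => chi (graph_point i gamma y) *
     dotv (u (graph_point i gamma y)) (graph_normal i s gamma y)).
Proof.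
move=> sg Cchi chiM cu mq qB H.
have lbq : locally_bounded q by move=> M; exists B.
have Ch z : C1at (height i s gamma) z by apply: C1at_height; exact: smooth_C1at.
have cl k z : {for z, continuous (layer i s gamma k)}.
  exact/C1at_cont/C1at_layer.
have aG := admissible_field_div Cchi chiM cu mq lbq.
set G := (fun z => dotv (gradient chi z) (u z) + chi z * q z) in aG *.
pose Phi z := chi z * dotv (u z) (graph_normal i s gamma (col' i z)).
have cPhi z : {for z, continuous Phi}.
  apply: contM; first exact: C1at_cont.
  apply: cont_sum => j; apply: contM; [exact: cu|exact: cont_graph_normal].
have aPhi : admissible Phi.
  apply: admissible_cont => //; have [M HM] := chiM.
  by exists M => z /HM z0; rewrite /Phi z0 mul0r.
(* The length of the gradient of the layer function relative to the normal. *)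
pose psi k z : R := k.+1%:R * dcutoff (k.+1%:R * height i s gamma z).
have cpsi k z : {for z, continuous (psi k)}.
  apply: contM; first exact: cont_cst.
  apply: (@cont_comp_R _ _ dcutoff); first exact: continuous_dcutoff.
  by apply: contM; [exact: cont_cst|exact: C1at_cont].
have aF2 k : admissible (fun z => psi k z * Phi z).
  apply: admissible_cont; first by move=> z; exact: contM.
  have [M HM] := chiM.
  by exists M => z /HM z0; rewrite /Phi z0 mul0r mulr0.
have aF1 k : admissible (fun z => layer i s gamma k z * G z).
  rewrite (_ : (fun _ => _) = fun z => G z * layer i s gamma k z); last first.
    by apply/funext => z; rewrite mulrC.
  apply: admissibleM => //; first exact: measurable_row_cont.
  by move=> M; exact: locally_bounded_cont.
have split_k k : integral_row (fun z => layer i s gamma k z * G z) =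
    integral_row (fun z => psi k z * Phi z).
  apply/eqP; rewrite -subr_eq0 -mulN1r -integral_rowZ//; apply/eqP.
  rewrite -integral_rowD//; last first.
    rewrite (_ : (fun _ => _) = fun z => psi k z * Phi z * - 1).
      apply: admissibleM => //; first exact: measurable_cst.
      by move=> M; exists 1 => z _; rewrite normrN1.
    by apply/funext => z; rewrite mulrC.
  rewrite -[RHS](H k); apply: eq_integral_row => z.
  have -> : gradient (fun w => layer i s gamma k w * chi w) z =
      layer i s gamma k z *: gradient chi z -
      (chi z * psi k z) *: graph_normal i s gamma (col' i z).
    have := gradient_height (i := i) s (C1at_diff (smooth_C1at (col' i z) sg)).
    move=> /rowP gh; apply/rowP => j; have := gh j; rewrite !mxE => ghj.
    rewrite partialM; [|exact/C1at_diff/C1at_layer|exact: C1at_diff].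
    rewrite partial_comp_cutoff; last exact: C1at_diff.
    by rewrite ghj /psi; ring.
  rewrite dotvBl (dotvZl (layer i s gamma k z)) (dotvZl (chi z * psi k z)) /G /Phi (dotvC (u z)) /=.
  by ring.
have lhs : integral_row (fun z => layer i s gamma k z * G z) @[k --> \oo] -->
    integral_row (fun z => \1_[set w | 0 < height i s gamma w] z * G z).
  have [_ [M [GM G0]]] := aG.
  apply: (@integral_row_cvg _ _ _ _ M).
  - by move=> k; case: (aF1 k).
  - move=> k; split=> z; last by move=> /G0 ->; rewrite mulr0.
    have /andP[l0 l1] := layer_itv i s gamma k z.
    by rewrite normrM ger0_norm//; apply: le_trans (GM z); rewrite ler_piMl.
  - by move=> z; apply: cvgM; [exact: layer_cvg|exact: cvg_cst].
have rhs : integral_row (fun z => psi k z * Phi z) @[k --> \oo] -->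
    integral_row (fun y => Phi (graph_point i gamma y)).
  have [_ [M [PM P0]]] := aPhi.
  have sliceE k y : line_integral (fun t => psi k (insert i y t) * Phi (insert i y t)) =
    line_integral (fun t => (k.+1%:R * dcutoff (k.+1%:R * ((-1) ^+ s * (gamma y - t)))) *
      Phi (insert i y t)).
    by congr line_integral; apply/funext => t; rewrite /psi height_insert.
  have cslice y : continuous (fun t : R => Phi (insert i y t)).
    move=> t; apply: (@continuous_comp _ _ _ (fun t : R => insert i y t) Phi).
      exact: continuous_insert.
    exact: cPhi.
  have avg k y (c e : R) :
    (forall t : R, `|t - gamma y| <= 2 / k.+1%:R -> `|Phi (insert i y t) - c| <= e) ->
    `|line_integral (fun t => psi k (insert i y t) * Phi (insert i y t)) - c| <= e.
    move=> He; rewrite sliceE.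
    have [c1 c2 c3 c4] := line_integral_kernel s k (gamma y).
    apply: (line_average (M := `|gamma y| + 2 / k.+1%:R)) => // t.
      move=> far; apply: c3; have := ler_normD (t - gamma y) (gamma y).
      rewrite subrK => h; rewrite -(ltrD2l `|gamma y|) [ltRHS]addrC.
      exact: lt_le_trans far h.
    move=> /eqP nz; apply: He; rewrite leNgt; apply/negP => /c3; exact: nz.
  rewrite [X in X @ _ --> _](_ : _ = fun k => integral_row
     (fun y => line_integral (fun t => psi k (insert i y t) * Phi (insert i y t)))); last first.
    by apply/funext => k; have [] := integral_insert i (aF2 k).
  apply: (@integral_row_cvg _ _ _ _ M).
  - by move=> k; have [_ []] := integral_insert i (aF2 k).
  - move=> k; split=> y.
      rewrite -[X in `|X|]subr0; apply: avg => t _; rewrite subr0; exact: PM.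
    move=> My; rewrite (_ : (fun _ => _) = fun=> 0).
      by rewrite /line_integral /Rintegral integral0.
    apply/funext => t; rewrite P0 ?mulr0//; apply: lt_le_trans My _.
    by have [] := norm_le_insert i y t.
  - move=> y; apply/cvgrPdist_le => e e0.
    have /cvgrPdist_le/(_ _ e0)/nbhs_normP[d /= d0 Hd] := cslice y (gamma y).
    have [k _ Hk] := near_infty_natSinv_lt (PosNum (divr_gt0 d0 (ltr0Sn R 1))).
    exists k => // m /Hk /= Hm; rewrite distrC; apply: avg => t ht.
    rewrite distrC; apply: Hd; rewrite /ball_ /= distrC; apply: le_lt_trans ht _.
    by rewrite mulrC -ltr_pdivlMr.
rewrite -[RHS](_ : integral_row (fun y => Phi (graph_point i gamma y)) = _); last first.
  by apply: eq_integral_row => y; rewrite /Phi graph_pointE insertK.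
rewrite (_ : (fun k => integral_row (fun z => layer i s gamma k z * G z)) =
  (fun k => integral_row (fun z => psi k z * Phi z))) in lhs; last exact/funext.
exact: (cvg_unique _ lhs rhs).
Qed.

End BoundaryLayer.

(** * Partitions of unity along a boundary *)

Section Partition.
Context {R : realType} {n : nat}.
Local Notation V := 'rV[R]_n.+1.
Local Notation W := 'rV[R]_n.
Implicit Types (i j : 'I_n.+1) (s : bool) (gamma : W -> R) (x z p v : V) (y : W).

Lemma bounded_normP (U : set V) : bounded_set U -> exists M : R, forall z, U z -> `|z| <= M.
Proof. by move=> [M [_ H]]; exists (M + 1) => z Uz; apply: (H (M + 1)) => //; rewrite ltrDl. Qed.

Lemma closure_norm_le (U : set V) x (M : R) z : (forall w, U w -> `|w - x| <= M) ->
  closure U z -> `|z - x| <= M.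
Proof.
move=> UM cz; rewrite leNgt; apply/negP => Mz.
have e0 : 0 < `|z - x| - M by rewrite subr_gt0.
have /cz[w [/UM wM /= wz]] : nbhs z [set w | `|w - z| < `|z - x| - M].
  by apply/near_normP; exists (`|z - x| - M).
have := ler_distD w z x; rewrite (distrC z w); lra.
Qed.

Lemma compact_boundary (U : set V) : bounded_set U -> compact (boundary U).
Proof.
move=> /bounded_normP[M UM]; apply: bounded_closed_compact.
  exists M; split; first exact: num_real.
  move=> B MB z [cz _]; rewrite -(subr0 z); apply: le_trans (ltW MB).
  by apply: closure_norm_le cz => w /UM; rewrite subr0.
rewrite /boundary setDE; apply: closedI; first exact: closed_closure.
by apply: open_closedC; exact: open_interior.
Qed.

(** Built on the squared Euclidean distance, which is smooth, while the support is
    measured in the sup norm: equal to one where the squared distance is below [r ^ 2 / 8],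
    and supported in the ball of radius [r / 2]. *)
Definition bump_fun x (r : R) z : R := cutoff (3 - 8 / r ^+ 2 * dotv (z - x) (z - x)).

Lemma C1at_sqdist x z : C1at (fun w : V => dotv (w - x) (w - x)) z.
Proof.
apply: C1at_sum => j; have C : C1at (fun w : V => (w - x) 0 j) z.
  apply: (C1at_near_eq _ (C1atD (C1at_proj j z) (C1at_cst (- x 0 j) z))).
  by apply: near_all => w; rewrite !mxE.
exact: C1atM.
Qed.

Lemma C1at_bump x (r : R) z : C1at (bump_fun x r) z.
Proof.
apply: (@C1at_comp1 _ _ cutoff dcutoff (fun w => 3 - 8 / r ^+ 2 * dotv (w - x) (w - x))).
- exact: is_derive_cutoff.
- exact: continuous_dcutoff.
- by apply: C1atB; [exact: C1at_cst|apply: C1atZ; exact: C1at_sqdist].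
Qed.

Lemma bump_itv x (r : R) z : 0 <= bump_fun x r z <= 1.
Proof. exact: cutoff_itv. Qed.

Lemma bump1 x (r : R) z : 0 < r -> dotv (z - x) (z - x) < r ^+ 2 / 8 -> bump_fun x r z = 1.
Proof.
move=> r0; rewrite /bump_fun => h; rewrite cutoff_ge2//.
have r2 : 0 < r ^+ 2 by rewrite exprn_gt0.
have : 8 / r ^+ 2 * dotv (z - x) (z - x) <= 8 / r ^+ 2 * (r ^+ 2 / 8).
  by apply: ler_wpM2l; [rewrite divr_ge0// ltW|exact: ltW].
rewrite (_ : 8 / r ^+ 2 * (r ^+ 2 / 8) = 1); first lra.
by field; rewrite gt_eqF.
Qed.

Lemma bump_support x (r : R) z : 0 < r -> bump_fun x r z != 0 -> `|z - x| <= r / 2.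
Proof.
move=> r0 /eqP b0; rewrite leNgt; apply/negP => far; apply: b0; rewrite /bump_fun cutoff_le1//.
have r2 : 0 < r ^+ 2 by rewrite exprn_gt0.
have h : r ^+ 2 / 4 <= dotv (z - x) (z - x).
  apply: le_trans (sqr_norm_le_dotvv _).
  have -> : r ^+ 2 / 4 = (r / 2) ^+ 2 by rewrite expr_div_n; congr (_ / _); ring.
  by rewrite ler_sqr ?nnegrE ?divr_ge0 ?(ltW r0)// ltW.
have : 8 / r ^+ 2 * (r ^+ 2 / 4) <= 8 / r ^+ 2 * dotv (z - x) (z - x).
  by apply: ler_wpM2l h; rewrite divr_ge0// ltW.
rewrite (_ : 8 / r ^+ 2 * (r ^+ 2 / 4) = 2); first lra.
by field; rewrite gt_eqF.
Qed.

Lemma telescope_partition (b : nat -> R) N :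
  \sum_(k < N) b k * \prod_(l < k) (1 - b l) = 1 - \prod_(k < N) (1 - b k).
Proof.
elim: N => [|N IH]; first by rewrite !big_ord0 subrr.
by rewrite !big_ord_recr/= IH; ring.
Qed.

(** Charts of the boundary with a partition of unity equal to one on a whole
    neighbourhood of it, so that multiplying by its complement removes the
    boundary altogether. *)
Definition chart_partition (U : set V) (N : nat) (ix : 'I_N -> 'I_n.+1)
    (sd : 'I_N -> bool) (gam : 'I_N -> W -> R) (chi : 'I_N -> V -> R) : Prop :=
  [/\ forall k, smooth setT (gam k),
      forall k, [/\ forall z, C1at (chi k) z, forall z, 0 <= chi k z & bounded_support (chi k)],
      forall k x, closure [set x | chi k x != 0] x ->
        \forall z \near x, U z <-> subgraph (ix k) (sd k) (gam k) z &
      forall x, boundary U x -> \forall z \near x, \sum_(k < N) chi k z = 1].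

(** The boundary is compact, so finitely many bumps [b k] supported in charts have plateaus
    covering it. The functions [b k * prod_(l < k) (1 - b l)] telescope to the sum
    [1 - prod (1 - b l)], which is one wherever some bump is one. *)
Lemma chart_partition_exists (U : set V) : open U -> bounded_set U -> smooth_boundary U ->
  exists N ix sd gam chi, @chart_partition U N ix sd gam chi.
Proof.
move=> oU bU sU.
have /choice[ch Hch] : forall x, exists c : 'I_n.+1 * bool * (W -> R) * R,
    boundary U x -> chart U x c.1.1.1 c.1.1.2 c.1.2 c.2.
  move=> x; have [bx|nbx] := pselect (boundary U x); last by exists (ord0, true, (fun=> 0), 0) => /nbx.
  by have [i [s [gamma [r C]]]] := boundary_chart oU sU bx; exists (i, s, gamma, r).
pose rr x := (ch x).2.
pose f x := [set z : V | dotv (z - x) (z - x) < rr x ^+ 2 / 8].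
have of_ x : boundary U x -> open (f x).
  move=> _; apply: (@open_comp _ _ (fun z : V => dotv (z - x) (z - x)) [set t | t < rr x ^+ 2 / 8]).
    by move=> z _; exact/C1at_cont/C1at_sqdist.
  exact: open_lt.
have rr0 x : boundary U x -> 0 < rr x by move=> /Hch[].
have cover : boundary U `<=` \bigcup_(x in boundary U) f x.
  by move=> x bx; exists x => //; rewrite /f /= subrr dotv0l divr_gt0// exprn_gt0// rr0.
have := compact_boundary bU; rewrite compact_cover => /(_ V (boundary U) f of_ cover)[D' DU DC].
pose xs : seq V := finmap.enum_fset D'.
have xsU (k : 'I_(size xs)) : boundary U (nth 0 xs k).
  by apply/set_mem/DU; exact: mem_nth.
pose b (l : nat) := bump_fun (nth 0 xs l) (rr (nth 0 xs l)).
exists (size xs), (fun k => (ch (nth 0 xs k)).1.1.1), (fun k => (ch (nth 0 xs k)).1.1.2),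
  (fun k => (ch (nth 0 xs k)).1.2), (fun k z => b k z * \prod_(l < k) (1 - b l z)).
have bS (k : 'I_(size xs)) z : b k z * \prod_(l < k) (1 - b l z) != 0 ->
    `|z - nth 0 xs k| <= rr (nth 0 xs k) / 2.
  by rewrite mulf_eq0 negb_or => /andP[h _]; apply: bump_support => //; exact/rr0.
split.
- by move=> k; have [] := Hch _ (xsU k).
- move=> k; split.
  + move=> z; apply: C1atM; first exact: C1at_bump.
    by apply: C1at_prod => l; apply: C1atB; [exact: C1at_cst|exact: C1at_bump].
  + move=> z; apply: mulr_ge0; first by have /andP[] := bump_itv (nth 0 xs k) (rr (nth 0 xs k)) z.
    by apply: prodr_ge0 => l _; rewrite subr_ge0; have /andP[] := bump_itv (nth 0 xs l) (rr (nth 0 xs l)) z.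
  + exists (`|nth 0 xs k| + rr (nth 0 xs k) / 2) => z far; apply/eqP/negPn/negP => /bS zx.
    have := ler_normD (z - nth 0 xs k) (nth 0 xs k); rewrite subrK.
    by move=> h; move: far; rewrite ltNge addrC (le_trans h)// lerD2r.
- move=> k x cx; have [r0 _ H] := Hch _ (xsU k).
  have xk : `|x - nth 0 xs k| <= rr (nth 0 xs k) / 2.
    by apply: closure_norm_le cx => w; exact: bS.
  apply/near_normP; exists (rr (nth 0 xs k) / 2); first by rewrite divr_gt0.
  move=> z zx; have [|+ _ _] := H z; last by rewrite -subgraphE.
  have := ler_distD x z (nth 0 xs k); move: r0 xk zx; rewrite -/(rr _); lra.
- move=> x /DC[y /= yD' fx].
  have ySU : boundary U y by apply/set_mem/DU.
  have nf : \forall z \near x, f y z by exact: (open_nbhs_nbhs (conj (of_ _ ySU) fx)).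
  apply: filterS nf => z fz; rewrite (telescope_partition (fun l => b l z)).
  have yi : (index y xs < size xs)%N by rewrite index_mem.
  rewrite (bigD1 (Ordinal yi))//= /b nth_index// bump1 ?subrr ?mul0r ?subr0//; exact: rr0.
Qed.

End Partition.

(** * The weak divergence of a field continuous across an interface *)

Section WeakForm.
Context {R : realType} {n : nat}.
Local Notation V := 'rV[R]_n.+1.
Local Notation W := 'rV[R]_n.
Implicit Types (i j : 'I_n.+1) (s : bool) (gamma : W -> R) (x z p v : V) (y : W).
Implicit Types (w f chi eta q : V -> R) (u : V -> V).

Lemma near_zero_off_support chi z : ~ closure [set x | chi x != 0] z ->
  \forall x \near z, chi x = 0.
Proof.
move=> nc; suff [B nB HB] : exists2 B : set V, nbhs z B & forall x, B x -> chi x = 0.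
  by apply: filterS nB => x; exact: HB.
apply: contrapT => H; apply: nc => B nB; apply: contrapT => H2; apply: H.
exists B => // x Bx; apply/eqP/negPn/negP => cx; apply: H2; by exists x.
Qed.

Lemma gradient_near f g z : (\forall x \near z, f x = g x) -> gradient f z = gradient g z.
Proof. by move=> fg; apply/rowP => j; rewrite !mxE (partial_near j fg). Qed.

Lemma gradient_cst (c : R) z : gradient (fun=> c) z = 0 :> V.
Proof. by apply/rowP => j; rewrite !mxE partial_cst. Qed.

Lemma gradientD f g z : differentiable f z -> differentiable g z ->
  gradient (fun x => f x + g x) z = gradient f z + gradient g z.
Proof. by move=> df dg; apply/rowP => j; rewrite !mxE partialD. Qed.

(** The pairing of a test function with the field [u] and its would-be divergence
    [q]; it vanishes for all test functions when [q] is the weak divergence. *)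
Definition flux_form w u q eta : R :=
  integral_row (fun z => w z * (dotv (gradient eta z) (u z) + eta z * q z)).

Definition test_function eta := (forall z, C1at eta z) /\ bounded_support eta.

Lemma test_functionM chi eta : test_function chi -> (forall z, C1at eta z) ->
  test_function (fun z => chi z * eta z).
Proof.
move=> [Cc [M c0]] Ce; split=> [z|]; first exact: C1atM.
by exists M => z /c0 ->; rewrite mul0r.
Qed.

Lemma test_function_remainder N (chi : 'I_N -> V -> R) eta :
  (forall k z, C1at (chi k) z) -> test_function eta ->
  test_function (fun z => (1 - \sum_(k < N) chi k z) * eta z).
Proof.
move=> Cchi te.
rewrite (_ : (fun _ => _) = fun z => eta z * (1 - \sum_(k < N) chi k z)).
  apply: (test_functionM te) => z; apply: C1atB; first exact: C1at_cst.
  by apply: C1at_sum => k; exact: Cchi.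
by apply/funext => z; rewrite mulrC.
Qed.

Lemma test_functionD chi eta : test_function chi -> test_function eta ->
  test_function (fun z => chi z + eta z).
Proof.
move=> [Cc [M c0]] [Ce [N e0]]; split=> [z|]; first exact: C1atD.
by exists (Num.max M N) => z; rewrite gt_max => /andP[/c0 -> /e0 ->]; rewrite addr0.
Qed.

Lemma test_function0 : test_function (fun=> 0).
Proof. by split=> [z|]; [exact: C1at_cst|exists 0]. Qed.

Lemma test_function_sum (I : Type) (r : seq I) (F : I -> V -> R) :
  (forall k, test_function (F k)) -> test_function (fun z => \sum_(k <- r) F k z).
Proof.
move=> tF; elim: r => [|k r IH].
  rewrite (_ : (fun _ => _) = fun=> 0); first exact: test_function0.
  by apply/funext => z; rewrite big_nil.
rewrite (_ : (fun _ => _) = fun z => F k z + \sum_(j <- r) F j z).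
  exact: test_functionD.
by apply/funext => z; rewrite big_cons.
Qed.

Section Forms.
Variables (w : V -> R) (u : V -> V) (q : V -> R).
Hypothesis mw : measurable_row w.
Hypothesis bw : locally_bounded w.
Hypothesis cu : forall z j, {for z, continuous (component u j)}.
Hypothesis mq : measurable_row q.
Hypothesis bq : locally_bounded q.

Lemma admissible_flux eta : test_function eta ->
  admissible (fun z => w z * (dotv (gradient eta z) (u z) + eta z * q z)).
Proof.
move=> [Ce eM].
rewrite (_ : (fun _ => _) = fun z => (dotv (gradient eta z) (u z) + eta z * q z) * w z).
  by apply: admissibleM => //; exact: admissible_field_div.
by apply/funext => z; rewrite mulrC.
Qed.

Lemma flux_formD chi eta : test_function chi -> test_function eta ->
  flux_form w u q (fun z => chi z + eta z) = flux_form w u q chi + flux_form w u q eta.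
Proof.
move=> tc te; rewrite /flux_form -integral_rowD; [|exact: admissible_flux..].
apply: eq_integral_row => z.
rewrite gradientD; [|by apply: C1at_diff; case: tc|by apply: C1at_diff; case: te].
by rewrite dotvDl; ring.
Qed.

Lemma flux_form0 : flux_form w u q (fun=> 0) = 0.
Proof.
rewrite -[RHS](@integral_row0 R n.+1); apply: eq_integral_row => z.
by rewrite gradient_cst dotv0l mul0r addr0 mulr0.
Qed.

Lemma flux_form_sum (I : Type) (r : seq I) (F : I -> V -> R) :
  (forall k, test_function (F k)) ->
  flux_form w u q (fun z => \sum_(k <- r) F k z) = \sum_(k <- r) flux_form w u q (F k).
Proof.
move=> tF; elim: r => [|k r IH].
  rewrite big_nil (_ : (fun _ => _) = fun=> 0); first exact: flux_form0.
  by apply/funext => z; rewrite big_nil.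
rewrite big_cons -IH -flux_formD//; last exact: test_function_sum.
by congr flux_form; apply/funext => z; rewrite big_cons.
Qed.

End Forms.

(** A test function and its gradient vanish off its closed support, so only the values of
    the weight and of [q] there matter. *)
Lemma eq_flux_form w1 w2 u q1 q2 eta :
  (forall z, closure [set x | eta x != 0] z -> w1 z = w2 z /\ (w2 z = 0 \/ q1 z = q2 z)) ->
  flux_form w1 u q1 eta = flux_form w2 u q2 eta.
Proof.
move=> H; apply: eq_integral_row => z.
have [/H[-> [->|->]]|/near_zero_off_support e0] := pselect (closure [set x | eta x != 0] z);
  rewrite ?mul0r//.
by rewrite (gradient_near e0) gradient_cst dotv0l (nbhs_singleton e0) !mul0r addr0 !mulr0.
Qed.

Lemma closure_support_mull chi eta z :
  closure [set x | chi x * eta x != 0] z -> closure [set x | chi x != 0] z.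
Proof.
by apply: closure_subset => x /=; rewrite mulf_eq0 negb_or => /andP[].
Qed.

Lemma measurable_height_pos i s gamma : smooth setT gamma ->
  measurable_row (\1_[set z | 0 < height i s gamma z] : V -> R).
Proof.
move=> sg; apply: measurable_row_open.
apply: (@open_comp _ _ (height i s gamma) [set t | 0 < t]); last exact: open_gt.
by move=> z _; apply/C1at_cont/C1at_height; exact: smooth_C1at.
Qed.

Lemma indic_in (A : set V) z : A z -> \1_A z = 1 :> R.
Proof. by move=> Az; rewrite indicE mem_set. Qed.

Lemma indic_out (A : set V) z : ~ A z -> \1_A z = 0 :> R.
Proof. by move=> Az; rewrite indicE memNset. Qed.

Lemma indic_itv (A : set V) z : 0 <= (\1_A z : R) <= 1.
Proof. by rewrite indicE ler0n lern1 leq_b1. Qed.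

Lemma locally_bounded_indic (A : set V) : locally_bounded (\1_A : V -> R).
Proof.
by move=> M; exists 1 => z _; have /andP[a b] := indic_itv A z; rewrite ger0_norm.
Qed.

(** Divergence theorem on one side of a graph, for a field that is only continuous
    up to it. *)
Lemma side_flux (A : set V) i s gamma chi u (c : R) : smooth setT gamma ->
  test_function chi ->
  (forall x, closure [set z | chi z != 0] x ->
     \forall z \near x, A z <-> subgraph i s gamma z) ->
  (forall z j, {for z, continuous (component u j)}) ->
  (forall z j, A z -> C1at (component u j) z) ->
  (forall z, A z -> divergence u z = c) ->
  flux_form (\1_[set z | 0 < height i s gamma z]) u (fun=> c) chi =
  integral_row (fun y => chi (graph_point i gamma y) *
     dotv (u (graph_point i gamma y)) (graph_normal i s gamma y)).
Proof.
move=> sg [Cc cM] cA cu CuA divA.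
apply: (boundary_layer (B := `|c|)) => //; first exact: measurable_cst.
move=> k; apply: (integral_transport (A := A)); [| | |exact: CuA|exact: divA].
- by move=> z; apply: C1atM; [exact: C1at_layer|exact: Cc].
- by have [M c0] := cM; exists M => z /c0 ->; rewrite mulr0.
- move=> z nAz.
  have [cz|/near_zero_off_support e0] := pselect (closure [set x | chi x != 0] z); last first.
    by apply: filterS e0 => x ->; rewrite mulr0.
  have hz : height i s gamma z <= 0.
    by rewrite leNgt; apply/negP => h; apply: nAz; apply/(nbhs_singleton (cA z cz))/subgraphE.
  have ch : {for z, continuous (height i s gamma)}.
    by apply/C1at_cont/C1at_height; exact: smooth_C1at.
  have k0 : 0 < k.+1%:R^-1 :> R by rewrite invr_gt0.
  have [r r0 Hr] := cont_normP ch k0.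
  apply/near_normP; exists r => // x /Hr/ltr_normlP[_].
  rewrite ltrBlDl => hx; rewrite /layer cutoff_le1 ?mul0r//.
  rewrite mulrC -ler_pdivlMr ?ltr0n// div1r.
  by apply: ltW; apply: lt_le_trans hx _; rewrite gerDr.
Qed.

Lemma height_trichotomy i s gamma z :
  \1_[set x | height i s gamma x = 0] z + \1_[set x | 0 < height i s gamma x] z +
    \1_[set x | 0 < height i (~~ s) gamma x] z = 1 :> R.
Proof.
have hN := heightN i s gamma z.
have [h|h|h] := ltgtP 0 (height i s gamma z).
- rewrite indic_out => [|/= E]; last by rewrite E ltxx in h.
  rewrite indic_in// indic_out => [|/=]; first by ring.
  by rewrite hN oppr_gt0 ltNge (ltW h).
- rewrite indic_out => [|/= E]; last by rewrite E ltxx in h.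
  rewrite indic_out => [|/=]; last by rewrite ltNge (ltW h).
  by rewrite indic_in /= ?hN ?oppr_gt0//; ring.
- by rewrite indic_in// indic_out /= ?hN -?h ?oppr0 ?ltxx// indic_out /= ?hN -?h ?oppr0 ?ltxx//; ring.
Qed.

(** Each line in the distinguished direction meets the graph in one point. *)
Lemma graph_null i s gamma F : smooth setT gamma -> admissible F ->
  integral_row (fun z => \1_[set x | height i s gamma x = 0] z * F z : R) = 0.
Proof.
move=> sg aF.
have ind0 : (\1_[set x | height i s gamma x = 0] : V -> R) =
    fun z => 1 - (\1_[set x | 0 < height i s gamma x] z +
                  \1_[set x | 0 < height i (~~ s) gamma x] z).
  by apply/funext => z; rewrite -(height_trichotomy i s gamma z); ring.
have aI : admissible (fun z => \1_[set x | height i s gamma x = 0] z * F z).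
  rewrite (_ : (fun _ => _) = fun z => F z * \1_[set x | height i s gamma x = 0] z).
    apply: admissibleM => //; last exact: locally_bounded_indic.
    rewrite ind0 (_ : (fun _ => _) = fun z => 1 + (- 1) * (\1_[set x | 0 < height i s gamma x] z +
                  \1_[set x | 0 < height i (~~ s) gamma x] z)).
      apply: measurable_rowD; first exact: measurable_cst.
      apply: measurable_rowM; first exact: measurable_cst.
      by apply: measurable_rowD; exact: measurable_height_pos.
    by apply/funext => z; rewrite mulN1r.
  by apply/funext => z; rewrite mulrC.
have [-> _] := integral_insert i aI.
rewrite -[RHS](@integral_row0 R n); apply: eq_integral_row => y.
rewrite -[RHS](@Rintegral_set1 R (fun t => \1_[set x | height i s gamma x = 0] (insert i y t) *
  F (insert i y t)) (gamma y)).
rewrite Rintegral_mkcond; congr Rintegral; apply/funext => t; rewrite /patch.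
case: ifPn => //; rewrite notin_setE /= => ty; rewrite indicE memNset ?mul0r//= height_insert.
by move/eqP; rewrite mulf_eq0 signr_eq0/= subr_eq0 => /eqP yt; apply: ty.
Qed.

Lemma open_exterior (A : set V) : open (~` closure A).
Proof. by apply: closed_openC; exact: closed_closure. Qed.

Definition two_values (D : set V) (a b : R) z : R := if z \in D then a else b.

Lemma two_valuesE (D : set V) (a b : R) z : two_values D a b z = b + (a - b) * \1_D z.
Proof.
by rewrite /two_values indicE; case: (z \in D); rewrite ?mulr1 ?mulr0 ?addr0// addrC subrK.
Qed.

Lemma measurable_two_values (D : set V) (a b : R) : open D -> measurable_row (two_values D a b).
Proof.
move=> oD; rewrite (_ : two_values D a b = fun z => b + (a - b) * \1_D z); last first.
  by apply/funext => z; exact: two_valuesE.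
apply: measurable_rowD; first exact: measurable_cst.
by apply: measurable_rowM; [exact: measurable_cst|exact: measurable_row_open].
Qed.

Lemma two_values_le (D : set V) (a b : R) z : `|two_values D a b z| <= `|a| + `|b|.
Proof. by rewrite /two_values; case: ifP => _; rewrite ?lerDl ?lerDr. Qed.

Lemma locally_bounded_two_values (D : set V) (a b : R) : locally_bounded (two_values D a b).
Proof. by move=> M; exists (`|a| + `|b|) => z _; exact: two_values_le. Qed.

Lemma locally_bounded_cst (c : R) : locally_bounded (fun _ : V => c).
Proof. by move=> M; exists `|c|. Qed.

Lemma admissible_graph F i gamma : smooth setT gamma ->
  (forall z, {for z, continuous F}) -> bounded_support F ->
  admissible (fun y => F (graph_point i gamma y)).
Proof.
move=> sg cF [M FM]; apply: admissible_cont; last first.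
  exists M => y My; apply: FM; apply: lt_le_trans My _; rewrite graph_pointE.
  by have [] := norm_le_insert i y (gamma y).
move=> y; apply: norm_contP => e e0.
have [r r0 Hr] := cont_normP (cF (graph_point i gamma y)) e0.
have [r2 r20 Hr2] := cont_normP (C1at_cont (smooth_C1at y sg)) r0.
exists (Num.min r r2) => [|x]; first by rewrite lt_min r0.
rewrite lt_min => /andP[xr /Hr2 xg]; apply: Hr; apply/norm_ltP => // j.
rewrite !mxE; case: unlift => [k|//].
by have := coord_le_norm (x - y) k; rewrite !mxE => h; exact: le_lt_trans h xr.
Qed.

(** Across the boundary of [D] the two one-sided fluxes cancel because the field is
    continuous: no surface term appears in its distributional divergence. *)
Lemma weak_divergence (D : set V) u (a b : R) eta :
  open D -> bounded_set D -> smooth_boundary D ->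
  (forall z j, {for z, continuous (component u j)}) ->
  (forall z j, D z -> C1at (component u j) z) ->
  (forall z j, (~` closure D) z -> C1at (component u j) z) ->
  (forall z, D z -> divergence u z = a) ->
  (forall z, (~` closure D) z -> divergence u z = b) ->
  test_function eta -> flux_form (fun=> 1) u (two_values D a b) eta = 0.
Proof.
move=> oD bD sD cu CuD CuE divD divE te; have [Ce eM] := te.
have [N [ix [sd [gam [chi [sg tchi Dchi sum1]]]]]] := chart_partition_exists oD bD sD.
set q := two_values D a b.
have mq : measurable_row q by exact: measurable_two_values.
have bq : locally_bounded q by exact: locally_bounded_two_values.
have m1 : measurable_row (fun _ : V => 1 : R) by exact: measurable_cst.
have Cchi k z : C1at (chi k) z by have [h1 _ _] := tchi k; exact: h1.
have tk k : test_function (fun z => chi k z * eta z).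
  have [h1 _ h3] := tchi k; exact: (test_functionM (conj h1 h3) Ce).
pose S z := \sum_(k < N) chi k z.
have t0 : test_function (fun z => (1 - S z) * eta z).
  exact: (test_function_remainder Cchi te).
have -> : eta = fun z => \sum_(k < N) (chi k z * eta z) + (1 - S z) * eta z.
  by apply/funext => z; rewrite -mulr_suml -mulrDl addrC subrK mul1r.
have lb1 : locally_bounded (fun _ : V => 1 : R) by exact: locally_bounded_cst.
rewrite (flux_formD m1 lb1 cu mq bq (test_function_sum _ tk) t0).
rewrite (flux_form_sum m1 lb1 cu mq bq _ tk).
rewrite big1 ?add0r => [|k _].
  have <- := integral_transport (A := D `|` ~` closure D) (eta := fun z => (1 - S z) * eta z)
    (u := u) (q := q).
  - by apply: eq_integral_row => z; rewrite mul1r.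
  - by case: t0.
  - by case: t0.
  - move=> z nz; have bz : boundary D z.
      rewrite /boundary (interior_id D).1//; split; last by move=> Dz; apply: nz; left.
      by apply: contrapT => ncz; apply: nz; right.
    by apply: filterS (sum1 z bz) => x; rewrite /S => ->; rewrite subrr mul0r.
  - by move=> z j [/CuD|/CuE]; apply.
  - move=> z [Dz|Ez]; rewrite /q /two_values.
      by rewrite mem_set//; exact: divD.
    by rewrite memNset ?divE// => /subset_closure.
have chart_k x : closure [set z | chi k z * eta z != 0] x -> exists r, chart D x (ix k) (sd k) (gam k) r.
  by move=> /closure_support_mull /Dchi; exact: near_chart.
have inner := side_flux (A := D) (sg k) (tk k) (fun x cx => Dchi k x (closure_support_mull cx)) cu CuD divD.
have outer : flux_form (\1_[set z | 0 < height (ix k) (~~ sd k) (gam k) z]) u (fun=> b)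
    (fun z => chi k z * eta z) =
  integral_row (fun y => chi k (graph_point (ix k) (gam k) y) * eta (graph_point (ix k) (gam k) y) *
     dotv (u (graph_point (ix k) (gam k) y)) (graph_normal (ix k) (~~ sd k) (gam k) y)).
  apply: (side_flux (A := ~` closure D)) => // x /chart_k[r [r0 _ H]].
  apply/near_normP; exists r => // z /H[_ + _]; rewrite subgraphE heightN oppr_gt0; exact.
(* The two one-sided fluxes differ by the sign of the normal. *)
have opp : flux_form (\1_[set z | 0 < height (ix k) (~~ sd k) (gam k) z]) u (fun=> b)
    (fun z => chi k z * eta z) =
  - flux_form (\1_[set z | 0 < height (ix k) (sd k) (gam k) z]) u (fun=> a)
    (fun z => chi k z * eta z).
  rewrite outer inner -mulN1r -integral_rowZ.
    by apply: eq_integral_row => y; rewrite graph_normalN dotvNr; ring.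
  pose Phi z := chi k z * eta z * dotv (u z) (graph_normal (ix k) (sd k) (gam k) (col' (ix k) z)).
  have [C0 [M HM]] := tk k.
  have cPhi z : {for z, continuous Phi}.
    apply: contM; first exact: C1at_cont (C0 z).
    by apply: cont_sum => j; apply: contM; [exact: cu|exact: cont_graph_normal (sg k)].
  have bPhi : bounded_support Phi by exists M => z /HM z0; rewrite /Phi z0 mul0r.
  have aPhi := admissible_graph (ix k) (sg k) cPhi bPhi.
  suff -> : (fun y => chi k (graph_point (ix k) (gam k) y) *
    eta (graph_point (ix k) (gam k) y) * dotv (u (graph_point (ix k) (gam k) y))
      (graph_normal (ix k) (sd k) (gam k) y)) =
    fun y => Phi (graph_point (ix k) (gam k) y) by exact: aPhi.
  by apply/funext => y; rewrite /Phi graph_pointE insertK.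
move: opp => /eqP; rewrite -addr_eq0 => /eqP opp.
pose G z := dotv (gradient (fun z => chi k z * eta z) z) (u z) + chi k z * eta z * q z.
have aG : admissible G.
  by have [h1 h2] := tk k; exact: admissible_field_div.
have mI s' : admissible (fun z => \1_[set z | 0 < height (ix k) s' (gam k) z] z * G z).
  rewrite (_ : (fun _ => _) = fun z => G z * \1_[set z | 0 < height (ix k) s' (gam k) z] z).
    apply: admissibleM => //; first exact: measurable_height_pos.
    exact: locally_bounded_indic.
  by apply/funext => z; rewrite mulrC.
have qE s' c : (forall x, closure [set z | chi k z * eta z != 0] x ->
      0 < height (ix k) s' (gam k) x -> c = q x) ->
    flux_form (\1_[set z | 0 < height (ix k) s' (gam k) z]) u (fun=> c) (fun z => chi k z * eta z) =
    integral_row (fun z => \1_[set z | 0 < height (ix k) s' (gam k) z] z * G z).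
  move=> H; apply: eq_flux_form => z cz; split=> //.
  have [h|h] := pselect (0 < height (ix k) s' (gam k) z); first by right; exact: H.
  by left; exact: indic_out.
have qin x : closure [set z | chi k z * eta z != 0] x ->
    0 < height (ix k) (sd k) (gam k) x -> a = q x.
  move=> /chart_k[r [r0 _ H]] h; rewrite /q /two_values mem_set//.
  by have [|Dx _ _] := H x; [rewrite subrr normr0|apply/Dx].
have qout x : closure [set z | chi k z * eta z != 0] x ->
    0 < height (ix k) (~~ sd k) (gam k) x -> b = q x.
  move=> /chart_k[r [r0 _ H]]; rewrite heightN oppr_gt0 => h; rewrite /q /two_values memNset//.
  have [|Dx _ _] := H x; first by rewrite subrr normr0.
  by move/Dx; rewrite ltNge (ltW h).
move: opp; rewrite (qE _ _ qout) (qE _ _ qin) => opp.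
(* The two sides and the graph make up the space, and the graph carries no mass. *)
have null := graph_null (ix k) (sd k) (sg k) aG.
have aN : admissible (fun z => \1_[set x | height (ix k) (sd k) (gam k) x = 0] z * G z).
  rewrite (_ : (fun _ => _) = fun z => G z + - 1 * (\1_[set z | 0 < height (ix k) (sd k) (gam k) z] z * G z
    + \1_[set z | 0 < height (ix k) (~~ sd k) (gam k) z] z * G z)); last first.
    apply/funext => z; have := height_trichotomy (ix k) (sd k) (gam k) z.
    set A := \1_ _ z; set P := \1_ _ z; set Q := \1_ _ z => APQ.
    have -> : A = 1 - P - Q by rewrite -APQ; ring.
    by ring.
  apply: admissibleD => //.
  rewrite (_ : (fun _ => _) = fun z => (\1_[set z | 0 < height (ix k) (sd k) (gam k) z] z * G z
    + \1_[set z | 0 < height (ix k) (~~ sd k) (gam k) z] z * G z) * - 1); last first.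
    by apply/funext => z; rewrite mulrC.
  apply: admissibleM; first exact: admissibleD.
    exact: measurable_cst.
  by move=> M; exists 1 => z _; rewrite normrN1.
have aS := admissibleD aN (mI (sd k)).
transitivity (integral_row (fun z => \1_[set x | height (ix k) (sd k) (gam k) x = 0] z * G z) +
  integral_row (fun z => \1_[set z | 0 < height (ix k) (sd k) (gam k) z] z * G z) +
  integral_row (fun z => \1_[set z | 0 < height (ix k) (~~ sd k) (gam k) z] z * G z)); last first.
  by rewrite null add0r addrC.
rewrite -(integral_rowD aN (mI (sd k))) -(integral_rowD aS (mI (~~ sd k))).
apply: eq_integral_row => z; rewrite -!mulrDl.
by rewrite height_trichotomy.
Qed.

End WeakForm.

(** * The divergence theorem and volumes *)

Section BoxMeasure.
Context {R : realType}.
Local Notation mR := (measurableTypeR R).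

Lemma measure_box_gt0 n (c : 'rV[R]_n) (r : R) : 0 < r ->
  (0 < lebesgue_tuple R n
    (@row_of_tuple R n @^-1` [set z | forall i, (`|z 0 i - c 0 i| < r)%R]))%E.
Proof.
move=> r0; elim: n c => [|n IH] c.
  rewrite /= diracE mem_set ?lte01//.
  by move=> [].
rewrite [X in (_ < X)%E](_ : _ = (@lebesgue_measure R \x lebesgue_tuple R n)%E
   (`](c 0 ord0 - r)%R, (c 0 ord0 + r)%R[ `*`
    (@row_of_tuple R n @^-1` [set z | forall i, (`|z 0 i - col' ord0 c 0 i| < r)%R]))); last first.
  rewrite /= /lebesgue_step /pushforward; congr (_ _).
  apply/seteqP; split => -[a t] /=; rewrite in_itv/= -ltr_distl.
    move=> H; split; first by have := H ord0; rewrite row_of_tupleE tnth0.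
    by move=> i; have := H (lift ord0 i); rewrite !row_of_tupleE tnthS col'E.
  move=> [h1 h2] i; rewrite row_of_tupleE; case: (unliftP ord0 i) => [j ->|->].
    by rewrite tnthS; have := h2 j; rewrite row_of_tupleE col'E.
  by rewrite tnth0.
rewrite product_measure1E//; last exact: measurable_box.
apply: mule_gt0; last exact: IH.
have fL : (0 < lebesgue_measure (`](c 0 ord0 - r)%R, (c 0 ord0 + r)%R[%classic : set R))%E.
  rewrite lebesgue_measure_itv/= lte_fin ltrD2l gtrN// -EFinB lte_fin; lra.
exact: fL.
Qed.

End BoxMeasure.

Section Divergence.
Context {R : realType} {n : nat}.
Local Notation V := 'rV[R]_n.+1.
Local Notation W := 'rV[R]_n.
Implicit Types (i j : 'I_n.+1) (s : bool) (gamma : W -> R) (x z p v : V) (y : W).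
Implicit Types (f chi eta q : V -> R) (u : V -> V).

Lemma bounded_supportP f : bounded_set [set x | f x != 0] <-> bounded_support f.
Proof.
split=> [/bounded_normP[M H]|[M H]].
  exists M => z Mz; apply/eqP/negPn/negP => /H; by rewrite leNgt Mz.
exists M; split; first exact: num_real.
move=> B MB z /= fz; apply: le_trans (ltW MB); rewrite leNgt; apply/negP => /H z0.
by rewrite z0 eqxx in fz.
Qed.

Lemma closure_support chi p : chi p != 0 -> closure [set z | chi z != 0] p.
Proof. by move=> cp B /nbhs_singleton Bp; exists p. Qed.

Lemma chart_at_support (U : set V) i s gamma p : open U -> smooth setT gamma ->
  (\forall z \near p, U z <-> subgraph i s gamma z) -> height i s gamma p = 0 ->
  boundary U p /\ outward_normal U p = (enorm (graph_normal i s gamma (col' i p)))^-1 *: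
    graph_normal i s gamma (col' i p).
Proof.
move=> oU sg near_p h0; have [r ch] := near_chart oU sg near_p.
have bp : boundary U p.
  have [r0 _ H] := ch; have [|_ _ B] := H p; first by rewrite subrr normr0.
  exact/B.
by split => //; exact: outward_normal_chart ch bp.
Qed.

(** The surface element of the graph is the length of the unnormalized normal, so
    it cancels the normalization. *)
Lemma graph_integral_flux (U : set V) i s gamma chi u : open U -> smooth setT gamma ->
  (forall x, closure [set z | chi z != 0] x ->
     \forall z \near x, U z <-> subgraph i s gamma z) ->
  graph_integral i gamma (fun x => chi x * dotv (u x) (outward_normal U x)) =
  integral_row (fun y => chi (graph_point i gamma y) *
     dotv (u (graph_point i gamma y)) (graph_normal i s gamma y)).
Proof.
move=> oU sg cU; apply: (@eq_integral_row _ _ (fun y : W =>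
  chi (graph_point i gamma y) * dotv (u (graph_point i gamma y))
    (outward_normal U (graph_point i gamma y)) *
  Num.sqrt (1 + enorm (gradient gamma y) ^+ 2))) => y.
have [->|c0] := eqVneq (chi (graph_point i gamma y)) 0; first by rewrite !mul0r.
have /cU near_p : closure [set z | chi z != 0] (graph_point i gamma y).
  exact: closure_support.
have [_ ->] := chart_at_support oU sg near_p (height_graph i s gamma y).
rewrite graph_pointE insertK -graph_pointE -(enorm_graph_normal i s) dotvZr.
by field; rewrite gt_eqF// enorm_graph_normal_gt0.
Qed.

Section Omega.
Variables (Omega : set V) (u : V -> V) (q : V -> R) (B : R).
Hypothesis oO : open Omega.
Hypothesis bO : bounded_set Omega.
Hypothesis sO : smooth_boundary Omega.
Hypothesis cu : forall z j, {for z, continuous (component u j)}.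
Hypothesis mq : measurable_row q.
Hypothesis qB : forall z, `|q z| <= B.
Hypothesis weak : forall eta, test_function eta -> flux_form (fun=> 1) u q eta = 0.

Let bq : locally_bounded q. Proof. by move=> M; exists B. Qed.
Let m1 : measurable_row (fun _ : V => 1 : R). Proof. exact: measurable_cst. Qed.
Let mO : measurable_row (\1_Omega : V -> R). Proof. exact: measurable_row_open. Qed.
Let lO : locally_bounded (\1_Omega : V -> R). Proof. exact: locally_bounded_indic. Qed.

(** Near the support of [chi] the set is one side of the graph, so the boundary layer of
    the graph applies; its test functions are those of the weak identity. *)
Lemma local_flux i s gamma chi : smooth setT gamma -> test_function chi ->
  (forall x, closure [set z | chi z != 0] x ->
     \forall z \near x, Omega z <-> subgraph i s gamma z) ->
  flux_form (\1_Omega) u q chi =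
  integral_row (fun y => chi (graph_point i gamma y) *
     dotv (u (graph_point i gamma y)) (graph_normal i s gamma y)).
Proof.
move=> sg [Cc cM] cO.
rewrite -(boundary_layer (q := q) (B := B) (i := i) (s := s) sg Cc cM cu mq qB); last first.
  move=> k; rewrite -[RHS](@weak (fun w => layer i s gamma k w * chi w)).
    by apply: eq_integral_row => z; rewrite mul1r.
  split=> [z|]; first by apply: C1atM; [exact: C1at_layer|exact: Cc].
  by have [M c0] := cM; exists M => z /c0 ->; rewrite mulr0.
apply: eq_flux_form => z cz; split; last by right.
have HH := nbhs_singleton (cO z cz).
have [Oz|nOz] := pselect (Omega z).
  by rewrite !indic_in//=; apply/subgraphE/HH.
by rewrite !indic_out//= => h; apply: nOz; apply/HH/subgraphE.
Qed.

(** A test function vanishing on the boundary carries no flux. Its restriction to [Omega]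
    is not smooth, so it is split by a partition of unity: the parts supported in charts
    have zero flux through the graph, and the remainder [zeta] vanishes near the boundary
    and can be used as a test function on the whole space. *)
Lemma flux_vanishing_boundary chi : test_function chi ->
  (forall x, boundary Omega x -> chi x = 0) -> flux_form (\1_Omega) u q chi = 0.
Proof.
move=> tc c0; have [Cc cM] := tc.
have [N [ix [sd [gam [xi [sg txi Oxi sum1]]]]]] := chart_partition_exists oO bO sO.
pose S z := \sum_(k < N) xi k z.
have Cxi k z : C1at (xi k) z by have [h1 _ _] := txi k; exact: h1.
have tk k : test_function (fun z => xi k z * chi z).
  have [h1 _ h3] := txi k; exact: (test_functionM (conj h1 h3) Cc).
have t0 : test_function (fun z => (1 - S z) * chi z).
  exact: (test_function_remainder Cxi tc).
have -> : chi = fun z => \sum_(k < N) (xi k z * chi z) + (1 - S z) * chi z.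
  by apply/funext => z; rewrite -mulr_suml -mulrDl addrC subrK mul1r.
rewrite (flux_formD mO lO cu mq bq (test_function_sum _ tk) t0).
rewrite (flux_form_sum mO lO cu mq bq _ tk) big1 ?add0r => [|k _]; last first.
  rewrite (local_flux (s := sd k) (sg k) (tk k) (fun x cx => Oxi k x (closure_support_mull cx))).
  rewrite -[RHS](@integral_row0 R n); apply: eq_integral_row => y.
  have [->|x0] := eqVneq (xi k (graph_point (ix k) (gam k) y)) 0; first by rewrite !mul0r.
  have /Oxi near_p : closure [set z | xi k z != 0] (graph_point (ix k) (gam k) y).
    exact: closure_support.
  have [bp _] := chart_at_support oO (sg k) near_p (height_graph (ix k) (sd k) (gam k) y).
  by rewrite (c0 _ bp) mulr0 mul0r.
pose zeta z := \1_Omega z * ((1 - S z) * chi z).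
have near_in z : Omega z -> \forall x \near z, zeta x = (1 - S x) * chi x.
  move=> Oz; have nO : \forall x \near z, Omega x by exact: open_nbhs_nbhs.
  by apply: filterS nO => x Ox; rewrite /zeta indic_in// mul1r.
have near_out z : ~ Omega z -> \forall x \near z, zeta x = 0.
  move=> nOz; have [bz|nbz] := pselect (boundary Omega z).
    by apply: filterS (sum1 z bz) => x; rewrite /zeta /S => ->; rewrite subrr mul0r mulr0.
  have Ez : (~` closure Omega) z.
    by move=> cz; apply: nbz; split=> //; rewrite (interior_id Omega).1.
  have nE : \forall x \near z, (~` closure Omega) x.
    by apply: open_nbhs_nbhs; split => //; exact: open_exterior.
  apply: filterS nE => x Ex; rewrite /zeta indic_out ?mul0r//.
  by move=> Ox; apply: Ex; exact: subset_closure.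
have tz : test_function zeta.
  have [C0 [M HM]] := t0; split=> [z|]; last by exists M => z /HM z0; rewrite /zeta z0 mulr0.
  have [Oz|nOz] := pselect (Omega z).
    by apply: C1at_near_eq (C0 z); apply: filterS (near_in z Oz) => x ->.
  by apply: C1at_near_eq (C1at_cst 0 z); apply: filterS (near_out z nOz) => x ->.
rewrite -[RHS](weak tz); apply: eq_integral_row => z.
have [Oz|nOz] := pselect (Omega z).
  rewrite indic_in// (gradient_near (near_in z Oz)) -(nbhs_singleton (near_in z Oz)).
  by [].
by rewrite indic_out// (gradient_near (near_out z nOz)) gradient_cst dotv0l
  (nbhs_singleton (near_out z nOz)) !mul0r addr0 mulr0.
Qed.

(** The functions of an atlas add up to one on the boundary only. With a function [beta]
    equal to one near the closure of [Omega], the difference of [beta] and their sum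
    vanishes on the boundary and carries no flux. *)
Lemma atlas_flux N (ix : 'I_N -> 'I_n.+1) (sd : 'I_N -> bool) (gam : 'I_N -> W -> R)
    (chi : 'I_N -> V -> R) : boundary_atlas Omega ix sd gam chi ->
  integral_row (fun z => \1_Omega z * q z) =
  \sum_(k < N) graph_integral (ix k) (gam k)
     (fun x => chi k x * dotv (u x) (outward_normal Omega x)).
Proof.
move=> [sg chiP chiO sum1].
have tk k : test_function (chi k).
  have [C _ b] := chiP k; split; last exact/bounded_supportP.
  by move=> z; apply: (Ck1_C1at openT C).
have [M OM] := bounded_normP bO.
pose r : R := 8 * n.+1%:R * (`|M| + 1).
have r0 : 0 < r by rewrite !mulr_gt0// ltr_wpDl.
pose beta : V -> R := bump_fun (0 : V) r.
have tb : test_function beta.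
  split=> [z|]; first exact: C1at_bump.
  exists (r / 2) => z rz; apply/eqP/negPn/negP => /(bump_support r0).
  by rewrite subr0 leNgt rz.
have beta1 z : closure Omega z -> \forall x \near z, beta x = 1.
  move=> cz; have zM : `|z| <= M.
    by rewrite -(subr0 z); apply: closure_norm_le cz => x /OM; rewrite subr0.
  have lt_r : dotv (z - 0) (z - 0) < r ^+ 2 / 8.
    rewrite subr0; apply: le_lt_trans (dotvv_le_sqr_norm z) _.
    have n1 : 1 <= n.+1%:R :> R by rewrite ler1n.
    have z2 : `|z| ^+ 2 <= `|M| ^+ 2.
      by rewrite ler_sqr ?nnegrE//; apply: le_trans zM (ler_norm _).
    have -> : r ^+ 2 / 8 = 8 * (n.+1%:R * n.+1%:R) * (`|M| + 1) ^+ 2.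
      by rewrite /r; field.
    have M0 := normr_ge0 M; have z0 := sqr_ge0 `|z|; nra.
  have cz' : {for z, continuous (fun w : V => dotv (w - 0) (w - 0))}.
    exact/C1at_cont/C1at_sqdist.
  have d0 : 0 < r ^+ 2 / 8 - dotv (z - 0) (z - 0) by rewrite subr_gt0.
  have [e e0 He] := cont_normP cz' d0.
  apply/near_normP; exists e => // x /He/ltr_normlP[_]; rewrite ltrD2r.
  exact: bump1.
have tb0 : test_function (fun z => beta z + - 1 * \sum_(k < N) chi k z).
  apply: test_functionD => //.
  rewrite (_ : (fun _ => _) = fun z => (\sum_(k < N) chi k z) * - 1).
    apply: test_functionM; first exact: test_function_sum.
    by move=> z; exact: C1at_cst.
  by apply/funext => z; rewrite mulrC.
transitivity (flux_form (\1_Omega) u q beta).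
  apply: eq_integral_row => z; have [Oz|nOz] := pselect (Omega z); last first.
    by rewrite indic_out// !mul0r.
  have b1 := beta1 z (subset_closure Oz).
  by rewrite (gradient_near b1) gradient_cst dotv0l (nbhs_singleton b1) add0r mul1r.
rewrite (_ : beta = fun z => \sum_(k < N) chi k z + (beta z + - 1 * \sum_(k < N) chi k z)); last first.
  by apply/funext => z; ring.
rewrite flux_formD//; last exact: test_function_sum.
rewrite (flux_vanishing_boundary tb0); last first.
  move=> x bx; rewrite sum1// mulr1 (nbhs_singleton (beta1 x _)) ?subrr//.
  by case: bx.
rewrite addr0 flux_form_sum//; apply: eq_bigr => k _.
rewrite (graph_integral_flux (s := sd k) u oO (sg k) (chiO k)).
exact: (local_flux (sg k) (tk k) (chiO k)).
Qed.

(** The boundary integral is defined by the choice of some atlas. The flux formula holds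
    for every atlas, so it only remains to produce one. *)
Lemma boundary_integral_flux :
  integral_row (fun z => \1_Omega z * q z) =
  boundary_integral Omega (fun x => dotv (u x) (outward_normal Omega x)).
Proof.
have [N [ix [sd [gam [chi [atlas ->]]]]]] : is_boundary_integral Omega
    (fun x => dotv (u x) (outward_normal Omega x))
    (boundary_integral Omega (fun x => dotv (u x) (outward_normal Omega x))).
  apply: (getPex (P := is_boundary_integral Omega (fun x => dotv (u x) (outward_normal Omega x)))).
  have [N [ix [sd [gam [chi [sg tchi Dchi sum1]]]]]] := chart_partition_exists oO bO sO.
  exists (\sum_(k < N) graph_integral (ix k) (gam k)
     (fun x => chi k x * dotv (u x) (outward_normal Omega x))).
  exists N, ix, sd, gam, chi; split=> //; split=> //.
    move=> k; have [C c0 b] := tchi k; split=> //; first exact: C1_Ck1.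
    exact/bounded_supportP.
  by move=> x /sum1/nbhs_singleton.
exact: (atlas_flux atlas).
Qed.

End Omega.

Lemma integral_indic_volume (U : set V) : open U -> bounded_set U ->
  integral_row (\1_U : V -> R) = fine (volume U) /\ admissible (\1_U : V -> R).
Proof.
move=> oU bU; split; last first.
  split; first exact: measurable_row_open.
  have [M UM] := bounded_normP bU; exists (Num.max 1 M); split=> z.
    by have /andP[a b] := indic_itv U z; rewrite ger0_norm// le_max b.
  by rewrite gt_max => /andP[_ Mz]; apply: indic_out => /UM; rewrite leNgt Mz.
have mU := measurable_open oU.
have := @integral_indic _ _ R (lebesgue_tuple R n.+1) setT measurableT _ mU.
rewrite setIT /volume => <-; rewrite /integral_row /Rintegral; congr fine.
Qed.

Lemma volume_gt0 (U : set V) : open U -> bounded_set U -> U !=set0 -> 0 < fine (volume U).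
Proof.
move=> oU bU [x Ux].
have [IU aU] := integral_indic_volume oU bU.
have [M UM] := bounded_normP bU.
have /near_normP[r r0 Hr] : \forall z \near x, U z by exact: open_nbhs_nbhs.
have fin : (volume U < +oo)%E.
  apply: le_lt_trans (finite_box n.+1 M); apply: le_measure; rewrite ?inE.
  - exact: measurable_open.
  - exact: measurable_norm_le.
  - by move=> t /UM.
rewrite fine_gt0// fin andbT; apply: lt_le_trans (measure_box_gt0 x r0) _.
apply: le_measure; rewrite ?inE; [exact: measurable_box|exact: measurable_open|].
move=> t /= tx; apply: Hr; apply/norm_ltP => // i; rewrite !mxE -row_of_tupleE.
exact: tx.
Qed.

End Divergence.

(** * First-order estimates up to an interface *)

Section FirstOrder.
Context {R : realType}.

Lemma C1_expansion m (f : 'rV[R]_m -> R) (x : 'rV[R]_m) : C1at f x ->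
  forall e : R, 0 < e -> exists2 r : R, 0 < r & forall w, `|w - x| < r ->
    `|f w - f x - dotv (w - x) (gradient f x)| <= e * `|w - x|.
Proof.
move=> [df cf] e e0.
have /near_normP[r1 r10 H1] := df.
have m1 : 0 < m.+1%:R :> R by rewrite ltr0n.
have e1 : 0 < e / m.+1%:R by rewrite divr_gt0.
have /choice[rr Hrr] : forall j : 'I_m, exists r : R, 0 < r /\ forall z, `|z - x| < r ->
    `|partial j f z - partial j f x| < e / m.+1%:R.
  by move=> j; have [r r0 H] := cont_normP (cf j) e1; exists r.
pose r := \big[Num.min/r1]_(j < m) rr j.
have r0 : 0 < r.
  by apply: lt_bigmin => // j _; have [] := Hrr j.
have rr1 : r <= r1 by exact: bigmin_le_id.
have rrj j : r <= rr j by exact: bigmin_le_cond.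
exists r => // w wr.
have line (t : R) : 0 <= t <= 1 -> `|x + t *: (w - x) - x| < r.
  move=> /andP[t0 t1]; rewrite addrC addKr normrZ ger0_norm//; apply: le_lt_trans wr.
  by rewrite ler_piMl.
have [t t01|t /andP[t0 t1]] := @MVT_seg _ _ f x (w - x).
  by apply: H1; apply: lt_le_trans rr1; exact: line.
rewrite [x + (w - x)]addrC subrK => ->; rewrite -dotvBr.
apply: le_trans (normr_dotv _ _) _; rewrite mulrC -mulrA mulrC.
apply: ler_wpM2r => //.
have gz : `|gradient f (x + t *: (w - x)) - gradient f x| <= e / m.+1%:R.
  apply/norm_leP => [|j]; first exact: ltW.
  rewrite !mxE; apply: ltW; have [_ H] := Hrr j; apply: H.
  by apply: lt_le_trans (rrj j); apply: line; rewrite !ltW.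
apply: (@le_trans _ _ (e / m.+1%:R * m%:R)); first exact: ler_wpM2r.
by rewrite mulrAC ler_pdivrMr// ler_pM2l// ler_nat.
Qed.

Lemma C1_gradient_bounded m (f : 'rV[R]_m -> R) (x : 'rV[R]_m) : C1at f x ->
  exists K : R, 0 <= K /\ exists2 r : R, 0 < r & forall w, `|w - x| < r -> `|gradient f w| <= K.
Proof.
move=> [_ cf]; exists (`|gradient f x| + 1); split; first by rewrite addr_ge0.
have /choice[rr Hrr] : forall j : 'I_m, exists r : R, 0 < r /\ forall z, `|z - x| < r ->
    `|partial j f z - partial j f x| < 1.
  by move=> j; have [r r0 H] := cont_normP (cf j) ltr01; exists r.
pose r := \big[Num.min/1]_(j < m) rr j.
exists r => [|w wr]; first by apply: lt_bigmin => // j _; have [] := Hrr j.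
apply/norm_leP => [|j]; first by rewrite addr_ge0.
have [_ H] := Hrr j; have rrj : r <= rr j by exact: bigmin_le_cond.
have {}H := H w (lt_le_trans wr rrj).
have := coord_le_norm (gradient f x) j; rewrite !mxE => h.
have := ler_normD (partial j f w - partial j f x) (partial j f x); rewrite subrK; lra.
Qed.

End FirstOrder.

Section Sides.
Context {R : realType} {n : nat}.
Local Notation V := 'rV[R]_n.+1.
Local Notation W := 'rV[R]_n.
Implicit Types (i j : 'I_n.+1) (s : bool) (gamma : W -> R) (x z p v : V) (y : W).
Implicit Types (f : V -> R).

(** Inside a chart two points on the same side of the graph are joined by a curve on
    that side, obtained by straightening the graph, whose length is comparable to
    their distance. *)
Lemma side_path i s gamma x : smooth setT gamma -> height i s gamma x = 0 ->
  exists C : R, 0 <= C /\ forall rho : R, 0 < rho -> exists2 r : R, 0 < r &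
  forall f (e : R), 0 <= e ->
  (forall z, `|z - x| < rho -> 0 < height i s gamma z ->
     differentiable f z /\ `|gradient f z| <= e) ->
  forall z1 z2, `|z1 - x| < r -> `|z2 - x| < r ->
    0 < height i s gamma z1 -> 0 < height i s gamma z2 ->
    `|f z1 - f z2| <= C * e * `|z1 - z2|.
Proof.
move=> sg hx0.
have ss : (-1) ^+ s * (-1) ^+ s = 1 :> R by rewrite -signr_addb addbb.
have [L [L0 [d d0 Hd]]] := C1_gradient_bounded (smooth_C1at (col' i x) sg).
pose C1 : R := n%:R * L + n%:R * L + 1.
have nL : 0 <= n%:R * L by exact: mulr_ge0.
exists (n.+1%:R * C1); split; first by rewrite mulr_ge0// /C1; lra.
move=> rho rho0; have rho2 : 0 < rho / 2 by rewrite divr_gt0.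
have [r1 r10 H1] := cont_normP (C1at_cont (smooth_C1at (col' i x) sg)) rho2.
have [r2 r20 H2] := cont_normP (C1at_cont (C1at_height (i := i) s (smooth_C1at (col' i x) sg))) rho2.
pose r := Num.min (Num.min d r1) (Num.min r2 rho).
have r0 : 0 < r by rewrite !lt_min d0 r10 r20.
exists r => // f e e0 Hf z1 z2; rewrite !lt_min => /andP[/andP[z1d z1r1] /andP[z1r2 z1rho]].
move=> /andP[/andP[z2d z2r1] /andP[z2r2 z2rho]] h1 h2.
pose y1 := col' i z1; pose y2 := col' i z2.
pose D := z1 - z2; pose a1 := height i s gamma z1; pose a2 := height i s gamma z2.
pose y (t : R) := y2 + t *: (y1 - y2).
pose a (t : R) := a2 + t * (a1 - a2).
(* A segment in the coordinates (projection, height), in which the side is a half-space. *)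
pose p (t : R) := insert i (y t) (gamma (y t) - (-1) ^+ s * a t).
have conv (t c : R) : 0 <= t <= 1 -> `|y1 - col' i x| < c -> `|y2 - col' i x| < c ->
    `|y t - col' i x| < c.
  move=> /andP[t0 t1] b1 b2.
  have -> : y t - col' i x = t *: (y1 - col' i x) + (1 - t) *: (y2 - col' i x).
    by apply/rowP => k; rewrite !mxE; ring.
  apply: le_lt_trans (ler_normD _ _) _; rewrite !normrZ ger0_norm// ger0_norm ?subr_ge0//.
  have [->|tn0] := eqVneq t 0; first by rewrite mul0r add0r subr0 mul1r.
  have tp : 0 < t by rewrite lt_neqAle eq_sym tn0.
  have : t * `|y1 - col' i x| < t * c by rewrite ltr_pM2l.
  have : (1 - t) * `|y2 - col' i x| <= (1 - t) * c by rewrite ler_wpM2l ?subr_ge0// ltW.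
  by move=> A B; have := ler_ltD A B; rewrite -mulrDl subrK mul1r addrC.
have yin (z : V) (c : R) : `|z - x| < c -> `|col' i z - col' i x| < c.
  by move=> zc; rewrite -col'B; exact: le_lt_trans (norm_col' _ _) zc.
have hp t : height i s gamma (p t) = a t.
  by rewrite height_insert opprB addrCA subrr addr0 mulrA ss mul1r.
have at0 t : 0 <= t <= 1 -> 0 < a t /\ a t < rho / 2.
  move=> /andP[t0 t1].
  have b1 : a1 < rho / 2 by have := H2 _ z1r2; rewrite hx0 subr0; apply: le_lt_trans; exact: ler_norm.
  have b2 : a2 < rho / 2 by have := H2 _ z2r2; rewrite hx0 subr0; apply: le_lt_trans; exact: ler_norm.
  have -> : a t = t * a1 + (1 - t) * a2 by rewrite /a; ring.
  have [->|tn0] := eqVneq t 0; first by rewrite mul0r add0r subr0 mul1r.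
  have tp : 0 < t by rewrite lt_neqAle eq_sym tn0.
  have A1 : 0 < t * a1 by exact: mulr_gt0.
  have A2 : 0 <= (1 - t) * a2 by rewrite mulr_ge0 ?subr_ge0// ltW.
  split; first by rewrite ltr_wpDr.
  have : t * a1 < t * (rho / 2) by rewrite ltr_pM2l.
  have : (1 - t) * a2 <= (1 - t) * (rho / 2) by rewrite ler_wpM2l ?subr_ge0// ltW.
  by move=> A B; have := ler_ltD A B; rewrite -mulrDl subrK mul1r addrC.
have gx : gamma (col' i x) = x 0 i.
  by move/eqP: hx0; rewrite mulf_eq0 signr_eq0/= subr_eq0 => /eqP.
have pin t : 0 <= t <= 1 -> `|p t - x| < rho.
  move=> t01; have [a0 aR] := at0 t t01.
  apply/norm_ltP => // j; case: (unliftP i j) => [k ->|->]; rewrite mxE [X in _ + X]mxE.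
    rewrite insert_lift.
    have := conv t rho t01 (yin _ _ z1rho) (yin _ _ z2rho).
    by apply: le_lt_trans; have := coord_le_norm (y t - col' i x) k; rewrite mxE [X in _ + X]mxE col'E.
  rewrite insert_at -gx addrAC.
  apply: le_lt_trans (ler_normB _ _) _; rewrite normrM normrX normrN1 expr1n mul1r.
  have := H1 _ (conv t r1 t01 (yin _ _ z1r1) (yin _ _ z2r1)); rewrite (gtr0_norm a0); lra.
pose dp t := insert i (y1 - y2) (dotv (y1 - y2) (gradient gamma (y t)) - (-1) ^+ s * (a1 - a2)).
have dpP (t : R) : is_derive t (1 : R) p (dp t).
  have dy : is_derive t (1 : R) y (y1 - y2) by exact: is_derive_line.
  have dg := is_derive_curve dy (C1at_diff (smooth_C1at (y t) sg)).
  have da : is_derive t (1 : R) a (a1 - a2).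
    have := @is_deriveD _ _ _ (cst a2) (fun t : R => t * (a1 - a2)) t 1 0 (a1 - a2) _ _.
    rewrite add0r; apply; have := @is_deriveM _ _ id (cst (a1 - a2)) t 1 1 0 _ _.
    by rewrite scaler0 add0r /GRing.scale/= mulr1; exact.
  have dlast : is_derive t (1 : R) (fun t => gamma (y t) - (-1) ^+ s * a t)
      (dotv (y1 - y2) (gradient gamma (y t)) - (-1) ^+ s * (a1 - a2)).
    exact: (@is_deriveB _ _ _ (gamma \o y) _ t 1 _ _ dg (is_deriveZ ((-1) ^+ s) da)).
  have dyc k : is_derive t (1 : R) (fun t => y t 0 k) ((y1 - y2) 0 k).
    have := is_derive_curve dy (differentiable_proj k (y t)).
    by rewrite -derive_gradient ?derive_proj//; exact: differentiable_proj.
  have pE b k : (fun t => p t b k) = if unlift i k is Some l then (fun t => y t 0 l)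
      else (fun t => gamma (y t) - (-1) ^+ s * a t).
    by apply/funext => t'; rewrite /p mxE; case: unlift.
  have dvb : derivable p t 1.
    apply/derivable_mxP => b k; rewrite pE; case: unlift => [l|]; first by case: (dyc l).
    by case: dlast.
  apply: DeriveDef => //; rewrite (derive_mx dvb); apply/rowP => k; rewrite !mxE pE.
  case: unlift => [l|]; last by case: dlast.
  by case: (dyc l) => _ ->; rewrite mxE.
have p0 : p 0 = z2.
  rewrite /p /y /a scale0r addr0 mul0r addr0 /a2 /height mulrA ss mul1r opprB addrC subrK.
  exact: insert_col'.
have p1 : p 1 = z1.
  rewrite /p /y /a scale1r mul1r ![_ + (_ - _)]addrC !subrK /a1 /height mulrA ss mul1r opprB addrC subrK.
  exact: insert_col'.
have fp t : 0 <= t <= 1 -> differentiable f (p t) /\ `|gradient f (p t)| <= e.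
  by move=> t01; apply: Hf; [exact: pin|rewrite hp; case: (at0 t t01)].
have [||t /andP[t0 t1]] := @MVT_curve _ _ f p dp 0 1 ltr01 (fun t _ => dpP t).
- by move=> t /andP[t0 t1]; case: (fp t) => //; rewrite !ltW.
- apply: continuous_in_subspaceT => t; rewrite inE/= in_itv/= => t01.
  apply: continuous_comp; last by apply: differentiable_continuous; case: (fp t t01).
  by apply/differentiable_continuous/derivable1_diffP; case: (dpP t).
have t01 : 0 <= t <= 1 by rewrite !ltW.
rewrite subr0 mulr1 p0 p1 => ->; apply: le_trans (normr_dotv _ _) _.
have [_ ge] := fp t t01.
have DN : `|y1 - y2| <= `|D| by rewrite -col'B norm_col'.
have gb (w : W) : `|w - col' i x| < d -> `|gradient gamma w| <= L by exact: Hd.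
have gdot (w : W) : `|w - col' i x| < d -> `|dotv (y1 - y2) (gradient gamma w)| <= n%:R * L * `|D|.
  move=> wd; apply: le_trans (normr_dotv _ _) _; rewrite -mulrA ler_wpM2l// mulrC.
  by apply: ler_pM => //; exact: gb.
have aD : `|a1 - a2| <= (n%:R * L + 1) * `|D|.
  have [t' /andP[t'0 t'1]|c /andP[c0 c1] E] := @MVT_seg _ _ gamma y2 (y1 - y2).
    by apply: C1at_diff; exact: smooth_C1at.
  rewrite [y2 + (y1 - y2)]addrC subrK in E.
  have -> : a1 - a2 = (-1) ^+ s * ((gamma y1 - gamma y2) - D 0 i).
    by rewrite /a1 /a2 /height !mxE -/y1 -/y2; ring.
  rewrite normrM normrX normrN1 expr1n mul1r; apply: le_trans (ler_normB _ _) _.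
  rewrite mulrDl mul1r E; apply: lerD; last exact: coord_le_norm.
  by apply: gdot; apply: conv; [rewrite !ltW|exact: yin|exact: yin].
have dpb : `|dp t| <= C1 * `|D|.
  apply: le_trans (norm_insert _ _ _) _; rewrite ge_max; apply/andP; split.
    apply: (le_trans DN); rewrite ler_peMl// /C1; lra.
  apply: le_trans (ler_normB _ _) _; rewrite normrM normrX normrN1 expr1n mul1r.
  have := gdot (y t) (conv t d t01 (yin _ _ z1d) (yin _ _ z2d)); rewrite /C1; move: aD; nra.
rewrite -!mulrA ler_wpM2l//.
apply: (@le_trans _ _ (C1 * `|D| * e)); first exact: ler_pM.
by rewrite -mulrA [`|D| * e]mulrC.
Qed.

(** The same estimate up to the graph, by pushing the points slightly into the
    side. *)
Lemma side_lipschitz i s gamma x : smooth setT gamma -> height i s gamma x = 0 ->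
  exists C : R, 0 <= C /\ forall rho : R, 0 < rho -> exists2 r : R, 0 < r &
  forall f (e : R), 0 <= e -> (forall z, {for z, continuous f}) ->
  (forall z, `|z - x| < rho -> 0 < height i s gamma z ->
     differentiable f z /\ `|gradient f z| <= e) ->
  forall z1 z2, `|z1 - x| < r -> `|z2 - x| < r ->
    0 <= height i s gamma z1 -> 0 <= height i s gamma z2 ->
    `|f z1 - f z2| <= C * e * `|z1 - z2|.
Proof.
move=> sg hx0; have [C [C0 H]] := side_path sg hx0; exists C; split=> // rho rho0.
have [r r0 Hr] := H rho rho0; exists r => // f e e0 cf Hf z1 z2 z1r z2r h1 h2.
rewrite leNgt; apply/negP => lt.
pose d := (`|f z1 - f z2| - C * e * `|z1 - z2|) / 2.
have d0 : 0 < d by rewrite divr_gt0// subr_gt0.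
have [r1 r10 H1] := cont_normP (cf z1) d0.
have [r2 r20 H2] := cont_normP (cf z2) d0.
have q1 : 0 < r - `|z1 - x| by rewrite subr_gt0.
have q2 : 0 < r - `|z2 - x| by rewrite subr_gt0.
have m1 : 0 < Num.min r1 r2 by rewrite lt_min r10.
have m2 : 0 < Num.min (r - `|z1 - x|) (r - `|z2 - x|) by rewrite lt_min q1.
have [t [t0 tm1 tm2]] := exists_lt_two m1 m2.
move: tm1 tm2; rewrite !lt_min => /andP[tr1 tr2] /andP[tq1 tq2].
(* Subtracting this vector increases the height by t. *)
pose sh : V := (t * (-1) ^+ s) *: delta_mx 0 i.
have shn : `|sh| <= t.
  rewrite normrZ normrM normrX normrN1 expr1n mulr1 gtr0_norm//.
  by rewrite ler_piMr ?norm_delta_le// ltW.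
have shd z : `|z - sh - z| <= t by rewrite addrAC subrr sub0r normrN.
have shx z (c : R) : t < c - `|z - x| -> `|z - sh - x| < c.
  move=> tc; have := ler_distD z (z - sh) x; have := shd z; lra.
have := Hr f e e0 Hf (z1 - sh) (z2 - sh) (shx _ _ tq1) (shx _ _ tq2).
rewrite !height_up => /(_ (ltr_wpDl h1 t0) (ltr_wpDl h2 t0)).
have -> : z1 - sh - (z2 - sh) = z1 - z2 by rewrite opprB addrA subrK.
have A1 := H1 _ (le_lt_trans (shd z1) tr1); have A2 := H2 _ (le_lt_trans (shd z2) tr2).
have T : `|f z1 - f z2| <= `|f (z1 - sh) - f z1| + `|f (z1 - sh) - f (z2 - sh)| + `|f (z2 - sh) - f z2|.
  apply: le_trans (ler_distD (f (z1 - sh)) _ _) _; rewrite (distrC (f z1)) -addrA lerD2l.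
  by apply: le_trans (ler_distD (f (z2 - sh)) _ _) _.
by move: T A1 A2; rewrite /d; lra.
Qed.

End Sides.

(** * The jump of the divergence across an interface *)

Section BlowUp.
Context {R : realType} {n : nat}.
Local Notation V := 'rV[R]_n.+1.
Implicit Types (i j : 'I_n.+1) (x y z v : V) (f : V -> R).

Lemma is_derive_quad (A B a t : R) :
  is_derive t (1 : R) (fun r => A * r + B * (a + r) ^+ 2) (A + 2 * B * (a + t)).
Proof.
apply: (@is_derive_quadratic_bound _ _ _ _ `|B|) => r.
have -> : A * r + B * (a + r) ^+ 2 - (A * t + B * (a + t) ^+ 2) - (A + 2 * B * (a + t)) * (r - t) =
  B * (r - t) ^+ 2 by ring.
by rewrite normrM [X in _ * X]ger0_norm ?sqr_ge0.
Qed.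

Lemma growth_bound (g dg : R -> R) (a b e : R) : a <= b ->
  (forall t, is_derive t (1 : R) g (dg t)) -> (forall t, a <= t <= b -> `|dg t| <= e) ->
  `|g b - g a| <= e * (b - a).
Proof.
move=> ab gP ge.
have cg : {within `[a, b], continuous g}.
  apply: continuous_subspaceT => r.
  by apply/differentiable_continuous/derivable1_diffP; case: (gP r).
have [c cab ->] := MVT_segment ab (fun t _ => gP t) cg.
by rewrite normrM [X in _ * X]ger0_norm ?subr_ge0// ler_wpM2r ?subr_ge0// ge.
Qed.

(** The second difference [phi (z + h nu) - phi z - q z] across the interface, with [q] the
    quadratic polynomial predicted by the first-order behaviour of [u . nu], is [o(h ^ 2)]
    by integration along [nu], while its Laplacian is the constant [b - a + c]. The maximum
    principle compares the two. *)
Lemma blow_up (phi : V -> R) (u : V -> V) (A B : set V) x (nu tau : V) (c a b : R) :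
  dotv nu nu = 1 ->
  (forall z, differentiable phi z) -> (forall z j, partial j phi z = u z 0 j) ->
  (forall z, A z -> (forall j, C1at (component u j) z) /\ divergence u z = a) ->
  (forall z, B z -> (forall j, C1at (component u j) z) /\ divergence u z = b) ->
  (forall e : R, 0 < e -> exists2 r : R, 0 < r & forall z, `|z - x| < r ->
     [/\ dotv nu (z - x) < - (e * `|z - x|) -> A z,
         e * `|z - x| < dotv nu (z - x) -> B z &
     `|dotv nu (u z) - dotv nu (u x) - dotv tau (z - x) + c * Num.max (dotv nu (z - x)) 0|
        <= e * `|z - x|]) ->
  b - a + c = 0.
Proof.
move=> nu1 dphi phiu AP BP H.
pose m : R := n.+1%:R; have m1 : 1 <= m by rewrite ler1n.
have nuN : `|nu| <= 1.
  by have := sqr_norm_le_dotvv nu; rewrite nu1 expr_le1.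
have key (e : R) : 0 < e -> e < 1 / 8 -> `|b - a + c| <= 8 * m * (28 * m ^+ 2) * e.
  move=> e0 e8; have [r r0 Hr] := H e e0.
  (* With k = m * rho, points z of the ball of radius rho about yc have s z between -3k and
     -k, so z lies in A, z + h nu lies in B, and the segment between them stays within
     7k < r of x. The dimension enters through the comparison of the two norms. *)
  pose rho := r / (8 * m); have m0 : 0 < m by lra.
  have rho0 : 0 < rho by rewrite divr_gt0// mulr_gt0.
  have mr : 8 * (m * rho) = r by rewrite /rho; field; rewrite gt_eqF.
  pose k := m * rho; have k0 : 0 < k by rewrite mulr_gt0.
  have rhok : rho <= k by rewrite ler_peMl// ltW.
  rewrite -/k in mr.
  pose h := 4 * k; pose yc := x - (2 * k) *: nu.
  pose s z := dotv nu (z - x).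
  have sE z (t : R) : s (z + t *: nu) = s z + t.
    rewrite /s (_ : z + t *: nu - x = z - x + t *: nu); last by rewrite addrAC.
    by rewrite [LHS]dotvDr dotvZr nu1 mulr1.
  have sb z : `|z - yc| <= rho -> - 3 * k <= s z <= - k.
    move=> zr; have -> : s z = dotv nu (z - yc) - 2 * k.
      by rewrite /s /yc opprB addrA !dotvBr !dotvDr dotvZr nu1; ring.
    have : `|dotv nu (z - yc)| <= k.
      apply: le_trans (normr_dotv _ _) _; rewrite /k ler_wpM2l ?(ltW m0)//.
      by apply: le_trans zr; rewrite ler_piMl.
    by rewrite ler_norml => /andP[? ?]; apply/andP; split; lra.
  have zx z : `|z - yc| <= rho -> `|z - x| <= 3 * k.
    move=> zr; have -> : z - x = (z - yc) - (2 * k) *: nu.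
      by rewrite /yc opprB [_ *: nu - x]addrC addrA addrK.
    apply: le_trans (ler_normB _ _) _; rewrite normrZ gtr0_norm; last by lra.
    have : 2 * k * `|nu| <= 2 * k by rewrite ler_piMr//; lra.
    lra.
  have ztx : forall z (t : R), `|z - yc| <= rho -> 0 <= t <= h -> `|z + t *: nu - x| <= 7 * k.
    move=> z t zr /andP[t0 th]; rewrite addrAC; apply: le_trans (ler_normD _ _) _.
    have := zx z zr; rewrite normrZ ger0_norm//.
    have : t * `|nu| <= t by rewrite ler_piMr.
    by rewrite /h in th; lra.
  have inA z : `|z - yc| <= rho -> A z.
    move=> zr; have zx3 := zx z zr; have /andP[s1 s2] := sb z zr.
    have [|+ _ _] := Hr z; first lra.
    apply; apply: le_lt_trans s2 _; rewrite ltrN2.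
    have := normr_ge0 (z - x); nra.
  have h0 : 0 < h by rewrite mulr_gt0.
  have inB z : `|z - yc| <= rho -> B (z + h *: nu).
    move=> zr; have zx7 : `|z + h *: nu - x| <= 7 * k by apply: ztx => //; rewrite lexx ltW.
    have /andP[s1 s2] := sb z zr.
    have [|_ + _] := Hr (z + h *: nu); first lra.
    apply; rewrite -/(s _) sE /h; have := normr_ge0 (z + h *: nu - x); rewrite /h; nra.
  pose fx := dotv nu (u x); pose tn := dotv tau nu.
  pose q z := (fx + dotv tau (z - x)) * h + 1 / 2 * tn * h ^+ 2 - 1 / 2 * c * (s z + h) ^+ 2.
  pose Wf z := phi (z + h *: nu) - phi z - q z.
  have Wb z : `|z - yc| <= rho -> `|Wf z| <= 28 * m ^+ 2 * e * rho ^+ 2.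
    move=> zr; have /andP[s1 s2] := sb z zr.
    pose F := fx + dotv tau (z - x).
    pose g1 t := phi (z + t *: nu) - (F * t + 1 / 2 * tn * (0 + t) ^+ 2).
    pose dg1 t := dotv nu (u (z + t *: nu)) - (F + 2 * (1 / 2 * tn) * (0 + t)).
    have g1P (t : R) : is_derive t (1 : R) g1 (dg1 t).
      have dphi_t : is_derive t (1 : R) (fun t => phi (z + t *: nu)) (dotv nu (u (z + t *: nu))).
        have := is_derive_curve (is_derive_line z nu t) (dphi (z + t *: nu)).
        by rewrite (_ : gradient phi _ = u (z + t *: nu))//; apply/rowP => j; rewrite mxE phiu.
      exact: (@is_deriveB _ _ _ _ _ t 1 _ _ dphi_t (is_derive_quad F (1 / 2 * tn) 0 t)).
    pose g2 t := g1 t + (0 * t + 1 / 2 * c * (s z + t) ^+ 2).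
    pose dg2 t := dg1 t + (0 + 2 * (1 / 2 * c) * (s z + t)).
    have g2P (t : R) : is_derive t (1 : R) g2 (dg2 t).
      exact: (@is_deriveD _ _ _ _ _ t 1 _ _ (g1P t) (is_derive_quad 0 (1 / 2 * c) (s z) t)).
    have near_t (t : R) : 0 <= t <= h ->
        `|dg1 t + c * Num.max (s z + t) 0| <= e * (7 * k).
      move=> th; have zt := ztx z t zr th.
      have [|_ _] := Hr (z + t *: nu); first lra.
      rewrite -/(s _) sE => E; apply: le_trans (ler_wpM2l (ltW e0) zt).
      apply: le_trans E; rewrite le_eqVlt; apply/orP; left; apply/eqP; congr `|_ + _|.
      have -> : dotv tau (z + t *: nu - x) = dotv tau (z - x) + t * tn.
        by rewrite -dotvZr -dotvDr addrAC.
      by rewrite /dg1 /F /fx; field.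
    (* The path is split at t = - s z, where the maximum in the hypothesis changes branch. *)
    have b1 : `|g1 (- s z) - g1 0| <= e * (7 * k) * (- s z - 0).
      apply: growth_bound g1P _; first lra.
      move=> t /andP[t0 t1]; have := near_t t; rewrite t0 /=.
      rewrite max_r ?mulr0 ?addr0; last lra.
      by apply; rewrite /h; lra.
    have b2 : `|g2 h - g2 (- s z)| <= e * (7 * k) * (h - - s z).
      apply: growth_bound g2P _; first by rewrite /h; lra.
      move=> t /andP[t0 t1]; have := near_t t; rewrite t1 andbT.
      rewrite max_l; last lra.
      rewrite (_ : dg2 t = dg1 t + c * (s z + t)); last by rewrite /dg2; field.
      by apply; lra.
    have -> : Wf z = (g2 h - g2 (- s z)) + (g1 (- s z) - g1 0).
      rewrite /g2 addrN expr0n /= /g1 scale0r addr0 /Wf /q -/F; ring.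
    apply: le_trans (ler_normD _ _) _.
    have -> : 28 * m ^+ 2 * e * rho ^+ 2 = e * (7 * k) * (h - - s z) + e * (7 * k) * (- s z - 0).
      by rewrite /h /k; ring.
    exact: lerD.
  have d1 w z : differentiable (fun z => dotv w (z - x)) z.
    rewrite (_ : (fun _ => _) = fun z => dotv w z + - dotv w x).
      by apply: differentiable_add; [exact: differentiable_dotv|exact: differentiable_cst].
    by apply/funext => z'; rewrite dotvBr.
  have pd w z j : partial j (fun z => dotv w (z - x)) z = w 0 j.
    rewrite (_ : (fun _ => _) = fun z => dotv w z + - dotv w x); last first.
      by apply/funext => z'; rewrite dotvBr.
    rewrite partialD; [|exact: differentiable_dotv|exact: differentiable_cst].
    by rewrite partial_cst addr0 partial_dotv.
  have dsh z : differentiable (fun z => s z + h) z.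
    by apply: differentiable_add; [exact: d1|exact: differentiable_cst].
  have psh z j : partial j (fun z => s z + h) z = nu 0 j.
    rewrite partialD; [|exact: d1|exact: differentiable_cst].
    by rewrite partial_cst addr0; exact: pd.
  pose q1 z := - (1 / 2 * c) * ((s z + h) * (s z + h)).
  have dq1 z : differentiable q1 z.
    by apply: differentiable_mul; [exact: differentiable_cst|exact: differentiable_mul].
  pose q2 z := h * dotv tau (z - x).
  have dq2 z : differentiable q2 z.
    by apply: differentiable_mul; [exact: differentiable_cst|exact: d1].
  have qE : q = fun z => q1 z + q2 z + (fx * h + 1 / 2 * tn * h ^+ 2).
    by apply/funext => z; rewrite /q /q1 /q2 -/(s z); ring.
  have dq12 z : differentiable (fun z => q1 z + q2 z) z by exact: differentiable_add.
  have dq z : differentiable q z.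
    by rewrite qE; apply: differentiable_add; [exact: dq12|exact: differentiable_cst].
  have pq z j : partial j q z = h * tau 0 j - c * (s z + h) * nu 0 j.
    rewrite qE partialD; [|exact: dq12|exact: differentiable_cst].
    rewrite partial_cst addr0 partialD; [|exact: dq1|exact: dq2].
    rewrite partialZ; last exact: differentiable_mul.
    rewrite partialM; [|exact: dsh|exact: dsh].
    by rewrite psh partialZ; [rewrite pd; field|exact: d1].
  have dN z : differentiable (fun z => - phi z) z by exact: differentiable_opp.
  have dS z : differentiable (fun z => phi (z + h *: nu)) z by exact: differentiable_shift.
  have dSN z : differentiable (fun z => phi (z + h *: nu) + - phi z) z.
    exact: differentiable_add.
  have dqN z : differentiable (fun z => - q z) z by exact: differentiable_opp.
  have dW z : differentiable Wf z by apply: differentiable_add; [exact: dSN|exact: dqN].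
  have pW j : partial j Wf = fun z => component u j (z + h *: nu) +
      (- component u j z + (c * nu 0 j * (s z + h) + - (h * tau 0 j))).
    apply/funext => z; rewrite partialD; [|exact: dSN|exact: dqN].
    rewrite partialD; [|exact: dS|exact: dN].
    rewrite partial_shift !partialN// pq !phiu /component; ring.
  have C1in j z : `|z - yc| < rho -> differentiable (component u j) z /\
      differentiable (component u j) (z + h *: nu).
    move=> /ltW zr; split; first by case: (AP z (inA z zr)) => /(_ j)/C1at_diff.
    by case: (BP _ (inB z zr)) => /(_ j)/C1at_diff.
  have dlin j z : differentiable (fun z => c * nu 0 j * (s z + h) + - (h * tau 0 j)) z.
    apply: differentiable_add; last exact: differentiable_cst.
    by apply: differentiable_mul; [exact: differentiable_cst|exact: dsh].
  have dmid j z : `|z - yc| < rho ->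
      differentiable (fun z => - component u j z + (c * nu 0 j * (s z + h) + - (h * tau 0 j))) z.
    move=> /(C1in j)[d _]; apply: differentiable_add; last exact: dlin.
    exact: differentiable_opp.
  have lapW z : `|z - yc| < rho -> laplacian Wf z = b - a + c.
    move=> zr; have [_ <-] := BP _ (inB z (ltW zr)); have [_ <-] := AP z (inA z (ltW zr)).
    rewrite /laplacian /divergence -[c in RHS]mulr1 -nu1 mulr_sumr -sumrB -big_split/=.
    apply: eq_bigr => j _; have [du1 du2] := C1in j z zr.
    rewrite pW partialD; [|exact: differentiable_shift|exact: dmid].
    rewrite partial_shift partialD; [|exact: differentiable_opp|exact: dlin].
    rewrite partialN// partialD; [|exact: differentiable_mul|exact: differentiable_cst].
    by rewrite partial_cst addr0 partialZ; [rewrite psh; ring|exact: dsh].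
  have := laplacian_bound rho0 (fun z _ => dW z) _ lapW Wb.
  have -> : 8 * n.+1%:R * (28 * m ^+ 2 * e * rho ^+ 2) = 8 * m * (28 * m ^+ 2) * e * rho ^+ 2.
    by rewrite -/m; ring.
  rewrite ler_pM2r ?exprn_gt0//; apply => z j zr.
  rewrite pW; apply: differentiable_add; last exact: dmid.
  by apply: differentiable_shift; case: (C1in j z zr).
apply/eqP/negPn/negP => X0; set X := b - a + c in key X0.
have Xp : 0 < `|X| by rewrite normr_gt0.
pose K : R := 8 * m * (28 * m ^+ 2).
have K0 : 0 < K by rewrite /K; nra.
have [e [e0 e1 e2]] : exists e : R, [/\ 0 < e, e < 1 / 8 & e < `|X| / K].
  by apply: exists_lt_two; [lra|rewrite divr_gt0].
have := key e e0 e1; rewrite -/K leNgt => /negP; apply.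
by rewrite mulrC -ltr_pdivlMr.
Qed.

End BlowUp.

Section Jump.
Context {R : realType} {n : nat}.
Local Notation V := 'rV[R]_n.+1.
Local Notation W := 'rV[R]_n.
Implicit Types (i j : 'I_n.+1) (s : bool) (gamma : W -> R) (x z v nu : V).
Implicit Types (f : V -> R).

Lemma side_const i s gamma x f (rho : R) : smooth setT gamma -> height i s gamma x = 0 ->
  0 < rho -> (forall z, `|z - x| < rho -> 0 < height i s gamma z ->
    differentiable f z /\ gradient f z = 0) ->
  exists a, exists2 r : R, 0 < r & forall z, `|z - x| < r -> 0 < height i s gamma z -> f z = a.
Proof.
move=> sg hx rho0 Hf; have [C [C0 H]] := side_path sg hx; have [r r0 Hr] := H _ rho0.
have [[p [pr hp]]|no] := pselect (exists p, `|p - x| < r /\ 0 < height i s gamma p).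
  exists (f p), r => // z zr hz; apply/eqP; rewrite -subr_eq0 -normr_le0.
  have := Hr f 0 (lexx _) _ z p zr pr hz hp; rewrite mulr0 mul0r; apply=> w wr hw.
  by have [df gf] := Hf w wr hw; split; [exact: df|rewrite gf normr0].
by exists 0, r => // z zr hz; case: no; exists z.
Qed.

(** A one-sided limit of the gradient at an interface point makes the function one-sidedly
    differentiable there, since the side is quasiconvex up to the interface. *)
Lemma side_expansion i s gamma x f (tau : V) : smooth setT gamma -> height i s gamma x = 0 ->
  (forall z, {for z, continuous f}) ->
  (forall e : R, 0 < e -> exists2 r : R, 0 < r & forall z, `|z - x| < r ->
    0 < height i s gamma z -> differentiable f z /\ `|gradient f z - tau| <= e) ->
  forall e : R, 0 < e -> exists2 r : R, 0 < r & forall z, `|z - x| < r ->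
    0 <= height i s gamma z -> `|f z - f x - dotv tau (z - x)| <= e * `|z - x|.
Proof.
move=> sg hx cf Hf e e0; have [C [C0 H]] := side_lipschitz sg hx.
have e1 : 0 < e / (C + 1) by rewrite divr_gt0// ltr_wpDl.
have [rho rho0 Hrho] := Hf _ e1; have [r r0 Hr] := H _ rho0.
exists r => // z zr hz.
pose F w := f w + - dotv tau w.
have dN w : differentiable (fun z => - dotv tau z) w.
  exact/differentiable_opp/differentiable_dotv.
have cF w : {for w, continuous F}.
  have cN : {for w, continuous (fun z => - dotv tau z)} by exact: differentiable_continuous (dN w).
  exact: contD (cf w) cN.
have HF w : `|w - x| < rho -> 0 < height i s gamma w ->
    differentiable F w /\ `|gradient F w| <= e / (C + 1).
  move=> wr hw; have [df gf] := Hrho w wr hw; split; first exact: differentiable_add.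
  have -> : gradient F w = gradient f w - tau => //.
  apply/rowP => j; rewrite !mxE partialD; [|exact: df|exact: dN].
  by rewrite partialN ?partial_dotv//; exact: differentiable_dotv.
have := Hr F _ (ltW e1) cF HF z x zr; rewrite subrr normr0 hx => /(_ r0 hz (lexx _)).
have -> : F z - F x = f z - f x - dotv tau (z - x) by rewrite /F dotvBr; ring.
move/le_trans; apply; rewrite ler_wpM2r// mulrA ler_pdivrMr ?ltr_wpDl//.
by rewrite mulrC ler_pM2l// lerDl.
Qed.

(** For a gradient field the traction is, up to the pressure, twice the gradient of the
    normal component. *)
Lemma traction_symmetric (lam : V -> R) (mu : R) (u : V -> V) nu z :
  (forall j, differentiable (component u j) z) ->
  (forall i j, partial i (component u j) z = partial j (component u i) z) ->
  traction lam mu u nu z = (lam z * divergence u z) *: nu +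
    (2 * mu) *: gradient (fun z => dotv nu (u z)) z.
Proof.
move=> du sym; apply/rowP => j; rewrite /traction /stress !mxE.
rewrite partial_sum => [|k]; last first.
  by apply: differentiable_mul; [exact: differentiable_cst|exact: du].
rewrite (eq_bigr (fun k => (lam z * divergence u z) * ((j == k)%:R * nu 0 k) +
    2 * mu * partial j (fun z => nu 0 k * component u k z) z)) => [|k _].
  rewrite big_split/= -!mulr_sumr; congr (_ * _ + _ * _).
  rewrite (bigD1 j)//= eqxx mul1r big1 ?addr0// => k kj.
  by rewrite eq_sym (negbTE kj) mul0r.
rewrite !mxE partialZ; last exact: du.
by rewrite (sym k j); case: (j == k); rewrite ?mulr1n ?mulr0n; ring.
Qed.

Lemma side_gradient (A : set V) (lam : V -> R) (la mu a : R) (u : V -> V) nu x (t : V) :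
  0 < mu -> traction lam mu u nu @ within A (nbhs x) --> t ->
  (forall z, A z -> lam z = la) ->
  (exists2 r : R, 0 < r & forall z, `|z - x| < r -> A z -> divergence u z = a) ->
  (forall z j, A z -> differentiable (component u j) z) ->
  (forall z i j, A z -> partial i (component u j) z = partial j (component u i) z) ->
  forall e : R, 0 < e -> exists2 r : R, 0 < r & forall z, `|z - x| < r -> A z ->
    differentiable (fun z => dotv nu (u z)) z /\
    `|gradient (fun z => dotv nu (u z)) z - (2 * mu)^-1 *: (t - (la * a) *: nu)| <= e.
Proof.
move=> mu0 Ht lamA [r1 r10 H1] du sym e e0.
have mu2 : 0 < 2 * mu by rewrite mulr_gt0.
have me : 0 < 2 * mu * e by rewrite mulr_gt0.
have /near_normP[r2 r20 H2] : \forall z \near x, A z -> `|t - traction lam mu u nu z| < 2 * mu * e.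
  by move/cvgrPdist_lt : Ht => /(_ _ me).
exists (Num.min r1 r2); first by rewrite lt_min r10.
move=> z; rewrite lt_min => /andP[zr1 zr2] Az; split.
  apply: differentiable_sum_fun => k; apply: differentiable_mul; first exact: differentiable_cst.
  exact: (du z k Az).
have := H2 z zr2 Az; rewrite (traction_symmetric _ _ _ (fun j => du z j Az) (fun i j => sym z i j Az)).
rewrite lamA// H1//; set g := gradient _ z => H.
have -> : g - (2 * mu)^-1 *: (t - (la * a) *: nu) =
    - ((2 * mu)^-1 *: (t - ((la * a) *: nu + (2 * mu) *: g))).
  by clear -mu0; clearbody g; apply/rowP => k; rewrite !mxE; field; rewrite gt_eqF.
rewrite normrN normrZ gtr0_norm ?invr_gt0// ler_pdivrMl//.
exact: ltW.
Qed.

(** On the side where the height is nonnegative the normal coordinate is negligible or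
    negative; with both signs reversed this covers the other side. *)
Lemma flat_sign (m q t d : R) : 1 <= m -> `|t + m * q| <= d -> 0 <= t -> q <= d.
Proof.
move=> m1 td t0; have d0 := le_trans (normr_ge0 _) td.
have [q0|q0] := leP q 0; first exact: le_trans d0.
apply: le_trans (ler_peMl (ltW q0) m1) _; apply: le_trans (ler_norm _) (le_trans _ td).
by rewrite !ger0_norm ?lerDr ?addr_ge0// mulr_ge0 ?(ltW q0)// (le_trans ler01).
Qed.

(** To first order the height is the distance to the tangent plane, scaled by the length
    of the unnormalized normal and counted negatively outwards. *)
Lemma boundary_flat i s gamma x : smooth setT gamma -> height i s gamma x = 0 ->
  let N := graph_normal i s gamma (col' i x) in
  forall e : R, 0 < e -> exists2 r : R, 0 < r & forall z, `|z - x| < r ->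
    `|height i s gamma z + enorm N * dotv ((enorm N)^-1 *: N) (z - x)| <= e * `|z - x|.
Proof.
move=> sg hx N e e0.
have Cg := smooth_C1at (col' i x) sg.
have [r r0 H] := C1_expansion (C1at_height (i := i) s Cg) e0.
exists r => // z /H; rewrite hx subr0 (gradient_height s (C1at_diff Cg)) dotvNr opprK.
by rewrite dotvZl mulrA mulfV ?mul1r 1?dotvC// gt_eqF// enorm_graph_normal_gt0.
Qed.

(** Across the interface the traction condition fixes the jump of the normal
    derivative of [u . n], hence that of the divergence. *)
Lemma divergence_jump (D : set V) (la1 la2 mu : R) (phi : V -> R) (h u : V -> V) x :
  open D -> smooth_boundary D -> boundary D x ->
  0 < mu -> la1 + 2 * mu != 0 -> la2 + 2 * mu != 0 ->
  (forall z, differentiable phi z) -> (forall z j, partial j phi z = u z 0 j) ->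
  transmission_solution D mu la1 la2 h u ->
  exists a b, [/\ (la1 + 2 * mu) * a = (la2 + 2 * mu) * b &
  exists2 r : R, 0 < r & forall z, `|z - x| < r ->
    (D z -> divergence u z = a) /\ ((~` closure D) z -> divergence u z = b)].
Proof.
move=> oD sD bx mu0 l1 l2 dphi phiu sol.
have oE : open (~` closure D) by exact: open_exterior.
have DE z : (~` closure D) z -> ~ D z by move=> nc Dz; apply: nc; exact: subset_closure.
have [i [s [gamma [rc ch]]]] := boundary_chart oD sD bx.
have hx := chart_boundary_pt ch bx; have [rc0 sg Hc] := ch.
have hx' : height i (~~ s) gamma x = 0 by rewrite heightN hx oppr0.
have dphiA (A : set V) z : A z -> differentiable phi z by [].
have phiuA (A : set V) z j : A z -> partial j phi z = u z 0 j by [].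
have CD k j := sol_smooth_in sol j k; have CE k j := sol_smooth_out sol j k.
have sideD z : `|z - x| < rc -> 0 < height i s gamma z -> D z.
  by move=> /Hc[E _ _] hz; exact/E.
have sideE z : `|z - x| < rc -> 0 < height i (~~ s) gamma z -> (~` closure D) z.
  by move=> /Hc[_ E _]; rewrite heightN oppr_gt0 => hz; exact/E.
have Dside z : `|z - x| < rc -> D z -> 0 < height i s gamma z.
  by move=> /Hc[E _ _] Dz; exact/E.
have Eside z : `|z - x| < rc -> (~` closure D) z -> 0 < height i (~~ s) gamma z.
  by move=> /Hc[_ E _] Ez; rewrite heightN oppr_gt0; exact/E.
have div0 := potential_divergence_flat dphi phiu.
have [a [ra ra0 Ha]] := @side_const i s gamma x (divergence u) rc sg hx rc0
  (fun z zr hz => div0 D la1 mu oD l1 (CD 2) (sol_lame_in sol) z (sideD z zr hz)).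
have [b [rb rb0 Hb]] := @side_const i (~~ s) gamma x (divergence u) rc sg hx' rc0
  (fun z zr hz => div0 _ la2 mu oE l2 (CE 2) (sol_lame_out sol) z (sideE z zr hz)).
pose r := Num.min rc (Num.min ra rb).
have r0 : 0 < r by rewrite !lt_min rc0 ra0.
have HaD z : `|z - x| < r -> D z -> divergence u z = a.
  by rewrite !lt_min => /and3P[zc za _] Dz; apply: Ha => //; exact: Dside.
have HbE z : `|z - x| < r -> (~` closure D) z -> divergence u z = b.
  by rewrite !lt_min => /and3P[zc _ zb] Ez; apply: Hb => //; exact: Eside.
exists a, b; split; last by exists r => // z zr; split; [exact: HaD|exact: HbE].
pose N := graph_normal i s gamma (col' i x); pose nu := outward_normal D x.
have nuE : nu = (enorm N)^-1 *: N by exact: outward_normal_chart ch bx.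
have N1 : 1 <= enorm N.
  rewrite -ler_sqr ?nnegrE ?sqrtr_ge0 ?ler01// expr1n enormK.
  exact: dotv_graph_normal_ge1.
have N0 : enorm N != 0 by rewrite gt_eqF// (lt_le_trans ltr01).
have nu1 : dotv nu nu = 1.
  by rewrite nuE dotvZl dotvZr -enormK expr2; field.
have [t [tin tout]] := sol_traction sol bx.
pose fn z := dotv nu (u z).
(* The limits of the gradient of fn at x from inside and from outside, as read off from
   the common limit t of the tractions. *)
pose tau1 := (2 * mu)^-1 *: (t - (la1 * a) *: nu).
pose tau2 := (2 * mu)^-1 *: (t - (la2 * b) *: nu).
pose c := (la2 * b - la1 * a) / (2 * mu).
have tau12 : tau2 = tau1 - c *: nu.
  clear -mu0; apply/rowP => k; rewrite /tau1 /tau2 /c; clearbody nu.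
  by rewrite !mxE; field; rewrite gt_eqF.
have symm (A : set V) : open A -> (forall j, Ck 1 A (component u j)) ->
    forall z i j, A z -> partial i (component u j) z = partial j (component u i) z.
  by move=> oA CA z; exact: (potential_symmetric oA (@dphiA A) (@phiuA A) CA).
have C1A (A : set V) : open A -> (forall j, Ck 1 A (component u j)) ->
    forall z j, A z -> C1at (component u j) z.
  by move=> oA CA z j; exact: (Ck1_C1at oA (CA j)).
have lamD z : D z -> lame_modulus D la1 la2 z = la1.
  by move=> Dz; rewrite /lame_modulus mem_set.
have lamE z : (~` closure D) z -> lame_modulus D la1 la2 z = la2.
  by move=> Ez; rewrite /lame_modulus memNset//; exact: DE.
have gin := side_gradient mu0 tin lamD
  (ex_intro2 _ _ r r0 HaD) (fun z j Dz => C1at_diff (C1A D oD (CD 1%N) z j Dz))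
  (symm D oD (CD 1%N)).
have gout := side_gradient mu0 tout lamE
  (ex_intro2 _ _ r r0 HbE) (fun z j Ez => C1at_diff (C1A _ oE (CE 1%N) z j Ez))
  (symm _ oE (CE 1%N)).
have cf z : {for z, continuous fn}.
  apply: cont_sum => k; apply: contM; first exact: cont_cst.
  by apply: (@continuous_comp _ _ _ u (fun w : V => w 0 k)); [exact: (sol_continuous sol)|exact: coord_continuous].
have Ein (e : R) : 0 < e -> exists2 r : R, 0 < r & forall z, `|z - x| < r ->
    0 <= height i s gamma z -> `|fn z - fn x - dotv tau1 (z - x)| <= e * `|z - x|.
  apply: (side_expansion sg hx cf) => {}e e0.
  have [r1 r10 H1] := gin e e0.
  exists (Num.min r1 rc); first by rewrite lt_min r10.
  by move=> z; rewrite lt_min => /andP[z1 z2] hz; apply: H1 => //; exact: sideD.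
have Eout (e : R) : 0 < e -> exists2 r : R, 0 < r & forall z, `|z - x| < r ->
    0 <= height i (~~ s) gamma z -> `|fn z - fn x - dotv tau2 (z - x)| <= e * `|z - x|.
  apply: (side_expansion sg hx' cf) => {}e e0.
  have [r1 r10 H1] := gout e e0.
  exists (Num.min r1 rc); first by rewrite lt_min r10.
  by move=> z; rewrite lt_min => /andP[z1 z2] hz; apply: H1 => //; exact: sideE.
have : b - a + c = 0.
  apply: (@blow_up _ _ phi u (D `&` [set z | `|z - x| < r])
    (~` closure D `&` [set z | `|z - x| < r]) x nu tau1) => //.
  - by move=> z [Dz zr]; split=> [j|]; [exact: (C1A D)|exact: HaD].
  - by move=> z [Ez zr]; split=> [j|]; [exact: (C1A _ oE)|exact: HbE].
  move=> e e0; pose e' := e / (2 * (`|c| + 1)).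
  have c0 := normr_ge0 c.
  have e'0 : 0 < e' by rewrite divr_gt0// mulr_gt0// ltr_wpDl.
  have e'c : (`|c| + 1) * e' = e / 2 by rewrite /e'; field; lra.
  have [r1 r10 H1] := Ein e' e'0; have [r2 r20 H2] := Eout e' e'0.
  have [r3 r30 H3] := boundary_flat sg hx e'0.
  exists (Num.min r (Num.min r1 (Num.min r2 r3))); first by rewrite lt_min r0 lt_min r10 lt_min r20.
  move=> z; rewrite lt_min => /andP[zr]; rewrite lt_min => /andP[z1]; rewrite lt_min => /andP[z2 z3].
  have := H3 z z3; rewrite -/N -nuE => F3.
  have zrc : `|z - x| < rc by move: zr; rewrite /r !lt_min => /and3P[].
  set q := dotv nu (z - x) in F3 *; set hz := height i s gamma z in F3 *.
  have z0 := normr_ge0 (z - x); set w := `|z - x| in z0 F3 *.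
  have e'e : e' <= e / 2 by rewrite -e'c ler_peMl ?(ltW e'0)// lerDr.
  have ew : e' * w <= e * w by apply: ler_wpM2r => //; apply: (le_trans e'e); rewrite ler_pdivrMr// ler_peMr ?(ltW e0)// ler1n.
  have ew0 : 0 <= e' * w by rewrite mulr_ge0// ltW.
  have up : 0 <= hz -> q <= e' * w by exact: flat_sign N1 F3.
  have down : hz <= 0 -> - q <= e' * w.
    by rewrite -oppr_ge0; apply: flat_sign N1 _; rewrite mulrN -opprD normrN.
  split.
  - move=> qe; split; last by [].
    apply: sideD => //; rewrite -/hz ltNge; apply/negP => /down/le_trans/(_ ew).
    by rewrite leNgt ltrNr qe.
  - move=> qe; split; last by [].
    apply: sideE => //; rewrite heightN oppr_gt0 -/hz ltNge; apply/negP => /up/le_trans/(_ ew).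
    by rewrite leNgt qe.
  rewrite -/(fn z) -/(fn x); set Y := _ - dotv tau1 _.
  have final (Y' m : R) : `|Y'| <= e' * w -> `|m| <= e' * w -> `|Y' + c * m| <= e * w.
    move=> Y1 m1; apply: le_trans (ler_normD _ _) _; rewrite normrM.
    apply: (@le_trans _ _ (e' * w + `|c| * (e' * w))); first by rewrite lerD// ler_wpM2l.
    rewrite -{1}[e' * w]mul1r -mulrDl [1 + _]addrC mulrA e'c ler_wpM2r//.
    by rewrite ler_pdivrMr// ler_peMr ?(ltW e0)// ler1n.
  have [h0|h0] := leP 0 hz.
    apply: final; first exact: H1.
    have [q0|q0] := leP 0 q; last by rewrite normr0.
    by rewrite ger0_norm//; exact: up.
  have -> : Y + c * Num.max q 0 = (Y + c * q) + c * (Num.max q 0 - q) by ring.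
  apply: final.
    have := H2 z z2; rewrite heightN oppr_ge0 tau12 dotvBl dotvZl -/q => /(_ (ltW h0)).
    by rewrite /Y opprB addrA addrAC.
  have [q0|q0] := leP 0 q; first by rewrite subrr normr0.
  by rewrite sub0r normrN ltr0_norm//; exact: down (ltW h0).
move=> E; have : 2 * mu * (b - a + c) = 0 by rewrite E mulr0.
have -> : 2 * mu * (b - a + c) = (la2 + 2 * mu) * b - (la1 + 2 * mu) * a.
  by rewrite /c; field; rewrite gt_eqF.
by move/eqP; rewrite subr_eq0 => /eqP.
Qed.

End Jump.

(** * The divergence of the transmission solution *)

Section Constants.
Context {R : realType} {n : nat}.
Local Notation V := 'rV[R]_n.+1.
Implicit Types (i j : 'I_n.+1) (x z v w : V) (f : V -> R) (D : set V).

Lemma gradient0_const_ball f x (r : R) :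
  (forall z, `|z - x| < r -> differentiable f z /\ gradient f z = 0) ->
  forall z, `|z - x| < r -> f z = f x.
Proof.
move=> H z zr.
have line (t : R) : 0 <= t <= 1 -> `|x + t *: (z - x) - x| < r.
  move=> /andP[t0 t1]; rewrite addrC addKr normrZ ger0_norm//; apply: le_lt_trans zr.
  by rewrite ler_piMl.
have [t t01|c /andP[c0 c1]] := @MVT_seg _ _ f x (z - x).
  by case: (H _ (line t t01)).
rewrite [x + (z - x)]addrC subrK; have [|_ ->] := H (x + c *: (z - x)).
  by apply: line; rewrite !ltW.
by rewrite dotv0r => /eqP; rewrite subr_eq0 => /eqP.
Qed.

Lemma gradient0_const f : (forall z, differentiable f z /\ gradient f z = 0) ->
  forall x z, f z = f x.
Proof.
move=> H x z; apply: (@gradient0_const_ball f x (`|z - x| + 1)) => [w _|]; first exact: H.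
by rewrite ltrDl.
Qed.

(** A locally constant function has zero gradient, so the mean value theorem on segments
    replaces a connectedness argument. *)
Lemma locally_constant (c : V -> R) :
  (forall x, \forall z \near x, c z = c x) -> forall x z, c z = c x.
Proof.
move=> H; apply: gradient0_const => z.
have near_z : \forall w \near z, c z = c w.
  by have : \forall w \near z, c w = c z := H z; apply: filterS => w.
split; first exact: (near_eq_diff near_z (differentiable_cst _ _)).
by apply/rowP => j; rewrite !mxE -(partial_near j near_z) partial_cst.
Qed.

(** A quantity that is locally the same constant on both sides of the boundary is
    globally constant, since the two sides together are dense. *)
Lemma constant_across D (p1 p2 : V -> R) :
  (forall x, exists a, exists2 r : R, 0 < r & forall z, `|z - x| < r ->
    (D z -> p1 z = a) /\ ((~` closure D) z -> p2 z = a)) ->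
  exists a, forall z, (D z -> p1 z = a) /\ ((~` closure D) z -> p2 z = a).
Proof.
move=> /choice[c Hc].
have dense x (r : R) : 0 < r -> exists z, `|z - x| < r /\ (D z \/ (~` closure D) z).
  move=> r0; have [cx|ncx] := pselect (closure D x); last first.
    by exists x; split; [rewrite subrr normr0|right].
  have /cx[z [Dz zr]] : nbhs x [set z | `|z - x| < r] by apply/near_normP; exists r.
  by exists z; split=> //; left.
have loc x : \forall z \near x, c z = c x.
  have [r r0 Hr] := Hc x; apply/near_normP; exists r => // z zr.
  have [r' r'0 Hr'] := Hc z.
  have zr0 : 0 < r - `|z - x| by rewrite subr_gt0.
  have [t [t0 t1 t2]] := exists_lt_two zr0 r'0.
  have [w [wt side]] := dense z t t0.
  have wx : `|w - x| < r.
    by have := ler_distD z w x; move: wt t1; lra.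
  have [A1 A2] := Hr w wx; have [B1 B2] := Hr' w (lt_trans wt t2).
  by case: side => [h|h]; [rewrite -(B1 h) A1|rewrite -(B2 h) A2].
exists (c 0) => z; have [r r0 Hr] := Hc z; rewrite -(locally_constant loc 0 z).
by apply: Hr; rewrite subrr normr0.
Qed.

Lemma laplacian_constant (g : V -> R) (la mu : R) : la + 2 * mu != 0 -> Ck 3 setT g ->
  (forall x, lame_operator la mu (gradient g) x = 0) ->
  forall x z, laplacian g z = laplacian g x.
Proof.
move=> l0 [dg Cg] lame.
have gE j : component (gradient g) j = partial j g.
  by apply/funext => z; rewrite /component mxE.
have C2 j : Ck 2 setT (component (gradient g) j) by rewrite gE.
have dE : divergence (gradient g) = laplacian g.
  by apply/funext => z; apply: eq_bigr => j _; rewrite gE.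
have dg' z : differentiable g z by exact: dg.
have gu z j : partial j g z = gradient g z 0 j by rewrite mxE.
rewrite -dE; apply: gradient0_const => z.
exact: (potential_divergence_flat dg' gu openT l0 C2 (fun x _ => lame x) I).
Qed.

(** On ever larger balls a function of linear growth has a Laplacian as small as
    one likes. *)
Lemma laplacian_far f (K M rho : R) :
  (forall z, rho <= `|z| -> differentiable f z /\ `|gradient f z| <= M) ->
  (forall z i, rho <= `|z| -> differentiable (partial i f) z) ->
  (forall z, rho <= `|z| -> laplacian f z = K) -> K = 0.
Proof.
move=> df ddf lap; apply/eqP/negPn/negP => K0.
have Kp : 0 < `|K| by rewrite normr_gt0.
pose m : R := n.+1%:R; have m1 : 1 <= m by rewrite ler1n.
pose e0 : V := delta_mx 0 ord0.
have ne0 : 1 <= `|e0|.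
  by have := coord_le_norm e0 ord0; rewrite mxE !eqxx normr1.
have ne1 : `|e0| <= 1 by exact: norm_delta_le.
pose rad := `|rho| + (8 * m ^+ 2 * `|M|) / `|K| + 1.
have rr : `|rho| + 1 <= rad by rewrite /rad lerD2r lerDl divr_ge0// mulr_ge0// mulr_ge0// sqr_ge0.
have rad0 : 0 < rad by apply: lt_le_trans rr; rewrite ltr_wpDl.
pose c := (2 * rad) *: e0.
have far z : `|z - c| <= rad -> rho <= `|z|.
  move=> zc; have : `|c| <= `|z - c| + `|z|.
    by rewrite -{1}(subrK z c) distrC; exact: ler_normD.
  rewrite normrZ gtr0_norm; last by rewrite mulr_gt0.
  have : 2 * rad <= 2 * rad * `|e0| by rewrite ler_peMr// mulr_ge0// ltW.
  have := ler_norm rho; lra.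
have fb z : `|z - c| <= rad -> `|f z - f c| <= m * (rad * `|M|).
  move=> zr.
  have line (t : R) : 0 <= t <= 1 -> `|c + t *: (z - c) - c| <= rad.
    move=> /andP[t0 t1]; rewrite addrC addKr normrZ ger0_norm//; apply: le_trans zr.
    by rewrite ler_piMl.
  have [t t01|t /andP[t0 t1]] := @MVT_seg _ _ f c (z - c).
    by case: (df _ (far _ (line t t01))).
  rewrite [c + (z - c)]addrC subrK => ->; apply: le_trans (normr_dotv _ _) _.
  rewrite ler_wpM2l// ler_pM//; have [|_ gM] := df (c + t *: (z - c)).
    by apply: far; apply: line; rewrite !ltW.
  exact: le_trans gM (ler_norm _).
pose F z := f z + (- f c).
have dfz z : `|z - c| <= rad -> differentiable f z by move=> /far/df[].
have pF z i : `|z - c| <= rad -> partial i F z = partial i f z.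
  move=> zr; rewrite partialD; [|exact: dfz|exact: differentiable_cst].
  by rewrite partial_cst addr0.
have pFn z i : `|z - c| < rad -> \forall w \near z, partial i f w = partial i F w.
  move=> zr; apply/near_normP; exists (rad - `|z - c|); first by rewrite subr_gt0.
  move=> w wz; rewrite pF//; have := ler_distD z w c; move: wz; lra.
have : `|K| * rad ^+ 2 <= 8 * n.+1%:R * (m * (rad * `|M|)).
  apply: (@laplacian_bound _ _ F c) => //.
  - by move=> z zr; apply: differentiable_add; [exact: dfz|exact: differentiable_cst].
  - by move=> z i zr; apply: (near_eq_diff (pFn z i zr)); apply: ddf; exact: far (ltW zr).
  - move=> z zr; rewrite -(lap z (far z (ltW zr))); apply: eq_bigr => i _.
    by rewrite -(partial_near i (pFn z i zr)).
apply/negP; rewrite -ltNge -/m.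
have -> : 8 * m * (m * (rad * `|M|)) = (8 * m ^+ 2 * `|M|) * rad by ring.
rewrite (_ : `|K| * rad ^+ 2 = `|K| * rad * rad); last by rewrite expr2 mulrA.
rewrite ltr_pM2r// -ltr_pdivrMl// mulrC /rad.
by have := normr_ge0 rho; lra.
Qed.

End Constants.

Section TransmissionDivergence.
Context {R : realType} {n : nat}.
Local Notation V := 'rV[R]_n.+1.
Implicit Types (i j : 'I_n.+1) (x z : V) (D : set V).

(** The exponent is not positive, so the decay gives a bound outside a ball; it is stated
    for the sup norm, with which balls are measured below. *)
Lemma decay_bounded (h u : V -> V) :
  (exists C r : R, forall x, r <= enorm x ->
    enorm (u x - h x) <= C * enorm x ^ (1 - n.+1%:Z)) ->
  exists M r : R, forall x, r <= `|x| -> `|u x - h x| <= M.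
Proof.
move=> [C [r H]]; exists `|C|, (Num.max r 1) => x; rewrite ge_max => /andP[rx x1].
have e1 : 1 <= enorm x by exact: le_trans (norm_le_enorm x).
apply: le_trans (norm_le_enorm _) _; apply: le_trans (H x _) _.
  exact: le_trans (norm_le_enorm x).
apply: le_trans (ler_norm _) _; rewrite normrM ler_piMr//.
have -> : 1 - n.+1%:Z = - (n%:Z) by lia.
rewrite -exprnN normfV normrX ger0_norm ?sqrtr_ge0//.
by rewrite invf_le1 ?exprn_ege1// exprn_gt0// (lt_le_trans ltr01).
Qed.

(** The constant common to both sides is read off far away, where [phi - g] has bounded
    gradient and constant Laplacian [div u - Cg]. *)
Lemma transmission_divergence D (la1 la2 mu Cg : R) (g phi : V -> R) (u : V -> V) :
  open D -> bounded_set D -> smooth_boundary D ->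
  0 < mu -> la1 + 2 * mu != 0 -> la2 + 2 * mu != 0 ->
  Ck 3 setT g -> (forall x, laplacian g x = Cg) ->
  transmission_solution D mu la1 la2 (gradient g) u ->
  (forall z, differentiable phi z) -> (forall z j, partial j phi z = u z 0 j) ->
  (forall z, D z -> divergence u z = (la2 + 2 * mu) / (la1 + 2 * mu) * Cg) /\
  (forall z, (~` closure D) z -> divergence u z = Cg).
Proof.
move=> oD bD sD mu0 l1 l2 Cg3 lapg sol dphi phiu.
have oE : open (~` closure D) by exact: open_exterior.
have DE z : (~` closure D) z -> ~ D z by move=> nc Dz; apply: nc; exact: subset_closure.
have CD k j := sol_smooth_in sol j k; have CE k j := sol_smooth_out sol j k.
have div0 := potential_divergence_flat dphi phiu.
have inner (A : set V) la x : open A -> la + 2 * mu != 0 ->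
    (forall j, Ck 2 A (component u j)) -> (forall z, A z -> lame_operator la mu u z = 0) ->
    A x -> exists2 r : R, 0 < r & forall z, `|z - x| < r -> A z /\ divergence u z = divergence u x.
  move=> oA l0 CA lA Ax; have /near_normP[r r0 Hr] : \forall z \near x, A z.
    exact: open_nbhs_nbhs.
  exists r => // z zr; split; first exact: Hr.
  by apply: gradient0_const_ball zr => w /Hr; exact: div0 A la mu oA l0 CA lA w.
have [a Ha] : exists a, forall z, (D z -> (la1 + 2 * mu) * divergence u z = a) /\
    ((~` closure D) z -> (la2 + 2 * mu) * divergence u z = a).
  apply: (@constant_across _ _ D (fun z => (la1 + 2 * mu) * divergence u z)
     (fun z => (la2 + 2 * mu) * divergence u z)) => x.
  have [Dx|nDx] := pselect (D x).
    have [r r0 Hr] := inner _ _ _ oD l1 (CD 2) (sol_lame_in sol) Dx.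
    exists ((la1 + 2 * mu) * divergence u x), r => // z zr; have [Dz dz] := Hr z zr.
    by split=> [_|/DE//]; rewrite dz.
  have [cx|ncx] := pselect (closure D x); last first.
    have [r r0 Hr] := inner _ _ _ oE l2 (CE 2) (sol_lame_out sol) ncx.
    exists ((la2 + 2 * mu) * divergence u x), r => // z zr; have [Ez dz] := Hr z zr.
    by split=> [/(DE z Ez)//|_]; rewrite dz.
  have bx : boundary D x by split=> //; rewrite (iffLR (interior_id D) oD).
  have [b1 [b2 [b12 [r r0 Hr]]]] := divergence_jump oD sD bx mu0 l1 l2 dphi phiu sol.
  exists ((la1 + 2 * mu) * b1), r => // z zr; have [H1 H2] := Hr z zr.
  by split=> [/H1 ->//|/H2 ->].
have HE z : (~` closure D) z -> divergence u z = a / (la2 + 2 * mu).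
  by move=> Ez; have [_ /(_ Ez) <-] := Ha z; rewrite mulrC mulKf.
have [dg Cg2] := Cg3.
have dg' z : differentiable g z by exact: dg.
have Cgp i z : C1at (partial i g) z.
  have [d H] := Cg2 i; apply: (Ck1_C1at openT _ I); split=> // k y _.
  by have [dd _] := H k; exact/differentiable_continuous/dd.
have K0 : a / (la2 + 2 * mu) - Cg = 0.
  have [M [r1 HM]] := decay_bounded (sol_decay sol).
  have [B HB] := bounded_normP bD.
  have farE z : B + 1 <= `|z| -> (~` closure D) z.
    move=> zB cz; have HB0 w : D w -> `|w - 0| <= B by rewrite subr0; exact: HB.
    by have := closure_norm_le HB0 cz; rewrite subr0; move: zB; lra.
  have dfun z : differentiable (fun z => phi z + - g z) z.
    by apply: differentiable_add => //; exact: differentiable_opp.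
  have pE i : partial i (fun z => phi z + - g z) = fun z => component u i z + - partial i g z.
    apply/funext => z; rewrite partialD//; last exact: differentiable_opp.
    by rewrite partialN// phiu.
  have dN i z : differentiable (fun z => - partial i g z) z.
    by apply: differentiable_opp; exact: C1at_diff (Cgp i z).
  have du i z : (~` closure D) z -> differentiable (component u i) z.
    by move=> Ez; apply: C1at_diff; exact: (Ck1_C1at oE (CE 1%N i)).
  apply: (@laplacian_far _ _ (fun z => phi z + - g z) _ M (Num.max r1 (B + 1))).
  - move=> z; rewrite ge_max => /andP[z1 z2]; split; first exact: dfun.
    have -> : gradient (fun z => phi z + - g z) z = u z - gradient g z; last exact: HM.
    by apply/rowP => i; rewrite mxE pE !mxE.
  - move=> z i; rewrite ge_max => /andP[_ /farE Ez]; rewrite pE.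
    by apply: differentiable_add; [exact: du|exact: dN].
  - move=> z; rewrite ge_max => /andP[_ /farE Ez]; rewrite -(HE z Ez) -(lapg z).
    rewrite /laplacian /divergence -sumrB; apply: eq_bigr => i _.
    rewrite pE partialD; [|exact: du|exact: dN].
    by rewrite partialN//; exact: C1at_diff (Cgp i z).
have aE : a = (la2 + 2 * mu) * Cg.
  by move/eqP: K0; rewrite subr_eq0 => /eqP <-; rewrite mulrC divfK.
split=> z; last by move=> /HE ->; rewrite aE mulrC mulKf.
move=> Dz; have [/(_ Dz) E _] := Ha z.
by rewrite mulrAC -aE -E mulrAC divff ?mul1r.
Qed.

End TransmissionDivergence.

(** * The volume fraction *)

Lemma volume_fraction (R : realType) (n : nat) (D Omega : set 'rV[R]_n.+1)
  (u : 'rV[R]_n.+1 -> 'rV[R]_n.+1) (C1 C2 : R) :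
  open D -> bounded_set D -> smooth_boundary D ->
  Omega !=set0 -> open Omega -> bounded_set Omega -> smooth_boundary Omega ->
  D `<=` Omega -> C1 != C2 ->
  (forall z j, {for z, continuous (component u j)}) ->
  (forall z j, D z -> C1at (component u j) z) ->
  (forall z j, (~` closure D) z -> C1at (component u j) z) ->
  (forall z, D z -> divergence u z = C1) ->
  (forall z, (~` closure D) z -> divergence u z = C2) ->
  fine (volume D) / fine (volume Omega) =
    (C1 - C2)^-1 * ((fine (volume Omega))^-1 *
      boundary_integral Omega (fun x => dotv (u x) (outward_normal Omega x)) - C2).
Proof.
move=> oD bD sD nO oO bO sO DO C12 cu CuD CuE divD divE.
have vO := volume_gt0 oO bO nO.
have [ID aD] := integral_indic_volume oD bD.
have [IO aO] := integral_indic_volume oO bO.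
have mq : measurable_row (two_values D C1 C2) by exact: measurable_two_values.
rewrite -(boundary_integral_flux oO bO sO cu mq (two_values_le D C1 C2)
  (fun eta => weak_divergence oD bD sD cu CuD CuE divD divE)).
rewrite (@eq_integral_row _ _ _ (fun z => C2 * \1_Omega z + (C1 - C2) * \1_D z)); last first.
  move=> z; rewrite two_valuesE mulrDr mulrC; congr (_ + _).
  rewrite mulrCA; congr (_ * _); rewrite -[RHS]mul1r !indicE.
  have [zD|] := boolP (z \in D); last by rewrite !mulr0.
  by rewrite mem_set//; apply: DO; rewrite inE in zD.
have mc (c : R) : measurable_row (fun _ : 'rV[R]_n.+1 => c) by exact: measurable_cst.
have aZ (c : R) F : admissible F -> admissible (fun z : 'rV[R]_n.+1 => c * F z).
  move=> aF; rewrite (_ : (fun _ => _) = fun z => F z * c).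
    exact: (admissibleM aF (mc c) (@locally_bounded_cst R n c)).
  by apply/funext => z; rewrite mulrC.
rewrite integral_rowD; [|exact: aZ|exact: aZ].
rewrite !integral_rowZ// IO ID; move: (fine _) (fine _) vO => VO VD VO0.
by field; rewrite subr_eq0 C12 gt_eqF.
Qed.

Theorem theorem3p1 (R : realType) (d : nat) (D Omega : set 'rV[R]_d)
  (mu lambda1 lambda2 : R) (g : 'rV[R]_d -> R) (u : 'rV[R]_d -> 'rV[R]_d) :
  d = 2%N \/ d = 3%N ->
  D !=set0 -> open D -> bounded_set D -> smooth_boundary D ->
  Omega !=set0 -> open Omega -> bounded_set Omega -> smooth_boundary Omega ->
  D `<=` Omega ->
  0 < mu ->
  0 < d%:R * lambda1 + 2 * mu ->
  0 < d%:R * lambda2 + 2 * mu ->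
  lambda1 != lambda2 ->
  Ck 3 setT g ->
  (forall x, lame_operator lambda2 mu (gradient g) x = 0) ->
  (exists x, laplacian g x != 0) ->
  transmission_solution D mu lambda1 lambda2 (gradient g) u ->
  (exists phi : 'rV[R]_d -> R,
    Ck 1 setT phi /\ forall x, u x = gradient phi x) ->
  exists Cg : R, [/\ Cg != 0, forall x, laplacian g x = Cg &
    let C1 := (lambda2 + 2 * mu) / (lambda1 + 2 * mu) * Cg in
    let C2 := Cg in
    fine (volume D) / fine (volume Omega) =
      (C1 - C2)^-1 *
      ((fine (volume Omega))^-1 *
         boundary_integral Omega
           (fun x => dotv (u x) (outward_normal Omega x)) - C2)].
Proof.
move=> d23 nD oD bD sD nO oO bO sO DO mu0 la1p la2p la12 Cg3 lame [x0 lapx0] sol [phi [Cphi uphi]].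
have modulus (la : R) : 0 < d%:R * la + 2 * mu -> la + 2 * mu != 0.
  by case: d23 => -> h; rewrite gt_eqF//; move: h mu0; lra.
have l1 := modulus _ la1p; have l2 := modulus _ la2p.
have [n dE] : exists n, d = n.+1 by case: d23 => ->; [exists 1%N|exists 2%N].
subst d.
have lapg x : laplacian g x = laplacian g x0 by exact: laplacian_constant l2 Cg3 lame x0 x.
exists (laplacian g x0); split=> //=.
set Cg := laplacian g x0 in lapg lapx0 *.
have dphi z : differentiable phi z by case: Cphi => + _; apply.
have phiu z j : partial j phi z = u z 0 j by rewrite uphi mxE.
have oE : open (~` closure D) by exact: open_exterior.
have [divD divE] := transmission_divergence oD bD sD mu0 l1 l2 Cg3 lapg sol dphi phiu.
apply: volume_fraction divD divE => //.
- apply/eqP => E; move: la12; rewrite -(inj_eq (addIr (2 * mu))) => /eqP; apply.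
  apply/esym/(mulIf lapx0); have := E; rewrite mulrAC => /(canRL (mulfVK l1)) ->.
  by rewrite mulrC.
- move=> z j; apply: (@continuous_comp _ _ _ u (fun w : 'rV[R]_n.+1 => w 0 j)).
    exact: (sol_continuous sol).
  exact: coord_continuous.
- by move=> z j; apply: (Ck1_C1at oD); exact: (sol_smooth_in sol j 1%N).
- by move=> z j; apply: (Ck1_C1at oE); exact: (sol_smooth_out sol j 1%N).
Qed.
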